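(* Let $\Omega\subset\mathbb{H}$ be a circular domain and let $h,\tilde h\in\mathcal{R}(\Omega)$ be such that $h\neq\tilde h$ and $\exp_*(h)=\exp_*(\tilde h)\notin\mathcal{R}_{\mathbb{R}}(\Omega)$. (a) If $\Omega$ is a slice domain, then $h_0\equiv\tilde h_0$, both $h_v$ and $\tilde h_v$ have no non-real isolated zeroes, both $h_v^s$ and $\tilde h_v^s$ have a square root on $\Omega$, and there exist $m\in\mathbb{Z}\setminus\{0\}$, $\alpha\in\mathcal{R}_{\mathbb{R}}(\Omega)$ and $H_v\in\mathcal{R}(\Omega)$ with $H_v^s\equiv1$ such that $h_v=\alpha H_v$ and $\tilde h_v=(\alpha+2\pi m)H_v=h_v+2\pi mH_v$, so that $\tilde h=h+2\pi mH_v$. (b) If $\Omega$ is a product domain, then one of the following holds: (1) there exists $n\in\mathbb{Z}\setminus\{0\}$ such that $\tilde h=h+2\pi n\mathcal{J}$; (2) both $h_v$ and $\tilde h_v$ are not zero divisors and have no non-real isolated zeroes, both $h_v^s$ and $\tilde h_v^s$ have a square root on $\Omega$, and there exist $n,m\in\mathbb{Z}$ with $m\neq0$ and $m\equiv n\pmod 2$, $\alpha\in\mathcal{R}_{\mathbb{R}}(\Omega)$ and $H_v\in\mathcal{R}(\Omega)$ with $H_v^s\equiv1$, such that $h_v=\alpha H_v$ and $\tilde h=h_0+\pi n\mathcal{J}+(\alpha+\pi m)H_v=h+\pi(n\mathcal{J}+mH_v)$.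
   Context: $\mathbb{H}$ is the algebra of quaternions; $q=q_0+q_v$ with $q_0$ real and $q_v$ purely imaginary, $q^c=q_0-q_v$, $\mathbb{S}=\{I\in\mathbb{H}: I^2=-1\}$, $\mathbb{C}_I=\mathbb{R}+\mathbb{R}I$, $\mathbb{S}_q=\{q_0+\|q_v\|J: J\in\mathbb{S}\}$, $\Omega_I=\Omega\cap\mathbb{C}_I$. A domain (nonempty connected open set) $\Omega\subset\mathbb{H}$ is circular if $\mathbb{S}_q\subset\Omega$ for all $q\in\Omega$; it is a slice domain if $\Omega\cap\mathbb{R}\neq\emptyset$ and a product domain if $\Omega\cap\mathbb{R}=\emptyset$. A function $f:\Omega\to\mathbb{H}$ is slice regular if $f(\alpha+I\beta)=F_0(\alpha+\sqrt{-1}\beta)+I F_1(\alpha+\sqrt{-1}\beta)$ for all $I\in\mathbb{S}$ and $\alpha,\beta\in\mathbb{R}$ with $\alpha+I\beta\in\Omega$, where $F_0,F_1:\{\alpha+\sqrt{-1}\beta:\alpha+I\beta\in\Omega\}\to\mathbb{H}$ are $C^1$, $F_0(\bar z)=F_0(z)$, $F_1(\bar z)=-F_1(z)$ and $\partial_\alpha F_0=\partial_\beta F_1$, $\partial_\beta F_0=-\partial_\alpha F_1$. $\mathcal{R}(\Omega)$ is the set of slice regular functions; $f\in\mathcal{R}(\Omega)$ is slice preserving if $f(\Omega_I)\subset\mathbb{C}_I$ for all $I\in\mathbb{S}$, and $\mathcal{R}_{\mathbb{R}}(\Omega)$ is the set of slice preserving functions. The $*$-product is $(f*g)(q)=0$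 if $f(q)=0$, and $(f*g)(q)=f(q)\,g(f(q)^{-1}qf(q))$ otherwise; with pointwise sum it makes $\mathcal{R}(\Omega)$ an associative algebra. The slice conjugate $f^c$ is the function induced by $(F_0^c,F_1^c)$ (pointwise conjugates), and $f^s=f*f^c\in\mathcal{R}_{\mathbb{R}}(\Omega)$. A function $f\not\equiv0$ is a zero divisor (for $*$) if and only if $f^s\equiv0$. Every $f\in\mathcal{R}(\Omega)$ is uniquely $f=f_0+f_1i+f_2j+f_3k$ with $f_\ell\in\mathcal{R}_{\mathbb{R}}(\Omega)$; $f_0$ is its real part, $f_v=f-f_0$ its vector part, and $f_v^s:=(f_v)^s=f_1^2+f_2^2+f_3^2$. $\exp_*(f)=\sum_{n\ge0}f^{*n}/n!$, with $f^{*n}$ the $n$-th $*$-power. A square root on $\Omega$ of $u\in\mathcal{R}_{\mathbb{R}}(\Omega)$ is a $\tau\in\mathcal{R}_{\mathbb{R}}(\Omega)$ with $\tau^2=u$. $\mathcal{J}:\mathbb{H}\setminus\mathbb{R}\to\mathbb{S}$ is the slice preserving regular function $\mathcal{J}(q)=q_v/\|q_v\|$. Non-real isolated zeroes: let $f\in\mathcal{R}(\Omega)$ with $f^s\not\equiv0$ and $q_0\in\Omega\setminus\mathbb{R}$. Write $f=\Delta^m\tilde f$ with $m\ge0$ the largest integer for which this is possible with $\tilde f\in\mathcal{R}(\Omega)$, where $\Delta(q)=q^2-2q\,\mathrm{Re}(q_0)+|q_0|^2$ (so $\tilde f\not\equiv0$ on $\mathbb{S}_{q_0}$). The point $q_0$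 is a non-real isolated zero of $f$ if $\tilde f(q_0)=0$. If $f^s\equiv0$, $f$ has no non-real isolated zeroes. *)

(* Defs.v *)
From HB Require Import structures.
From mathcomp Require Import all_boot all_order all_algebra.
From mathcomp Require Import all_classical all_reals all_analysis.
From mathcomp Require Import ring lra.

Set Implicit Arguments.
Unset Strict Implicit.
Unset Printing Implicit Defensive.

Import Order.TTheory GRing.Theory Num.Theory.
Import numFieldNormedType.Exports.
Local Open Scope classical_set_scope.
Local Open Scope ring_scope.

(* Quat a b c d is the quaternion a + b i + c j + d k. *)
Record quat (R : realType) : Type :=
  Quat { qre : R; qi : R; qj : R; qk : R }.

Arguments qre {R} _.
Arguments qi {R} _.
Arguments qj {R} _.
Arguments qk {R} _.

Section QuaternionAlgebra.
Context {R : realType}.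
Implicit Types p q r : quat R.

Definition quat_to_tuple q : R * R * R * R := (qre q, qi q, qj q, qk q).
Definition quat_of_tuple (t : R * R * R * R) : quat R :=
  Quat t.1.1.1 t.1.1.2 t.1.2 t.2.

Lemma quat_to_tupleK : cancel quat_to_tuple quat_of_tuple.
Proof. by case. Qed.

HB.instance Definition _ :=
  Choice.copy (quat R) (can_type quat_to_tupleK).

Lemma quat_ext p q :
  qre p = qre q -> qi p = qi q -> qj p = qj q -> qk p = qk q -> p = q.
Proof. by case: p q => [a b c d] [a' b' c' d'] /= -> -> -> ->. Qed.

Definition qadd p q : quat R :=
  Quat (qre p + qre q) (qi p + qi q) (qj p + qj q) (qk p + qk q).
Definition qopp q : quat R := Quat (- qre q) (- qi q) (- qj q) (- qk q).
Definition qzero : quat R := Quat 0 0 0 0.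

Lemma qaddA : associative qadd.
Proof. by move=> p q r; apply: quat_ext; rewrite /= addrA. Qed.
Lemma qaddC : commutative qadd.
Proof. by move=> p q; apply: quat_ext; rewrite /= addrC. Qed.
Lemma qadd0q : left_id qzero qadd.
Proof. by move=> p; apply: quat_ext; rewrite /= add0r. Qed.
Lemma qaddNq : left_inverse qzero qopp qadd.
Proof. by move=> p; apply: quat_ext; rewrite /= addNr. Qed.

HB.instance Definition _ :=
  GRing.isZmodule.Build (quat R) qaddA qaddC qadd0q qaddNq.

Definition qmul p q : quat R :=
  Quat (qre p * qre q - qi p * qi q - qj p * qj q - qk p * qk q)
       (qre p * qi q + qi p * qre q + qj p * qk q - qk p * qj q)
       (qre p * qj q - qi p * qk q + qj p * qre q + qk p * qi q)
       (qre p * qk q + qi p * qj q - qj p * qi q + qk p * qre q).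
Definition qone : quat R := Quat 1 0 0 0.

Lemma qmulA : associative qmul.
Proof. by move=> p q r; apply: quat_ext => /=; ring. Qed.
Lemma qmul1q : left_id qone qmul.
Proof. by move=> p; apply: quat_ext => /=; ring. Qed.
Lemma qmulq1 : right_id qone qmul.
Proof. by move=> p; apply: quat_ext => /=; ring. Qed.
Lemma qmulDl : left_distributive qmul +%R.
Proof. by move=> p q r; apply: quat_ext => /=; ring. Qed.
Lemma qmulDr : right_distributive qmul +%R.
Proof. by move=> p q r; apply: quat_ext => /=; ring. Qed.
Lemma qone_neq0 : qone != 0.
Proof. by apply/eqP => /(congr1 qre) /eqP; rewrite /= oner_eq0. Qed.

HB.instance Definition _ := GRing.Zmodule_isNzRing.Build (quat R)
  qmulA qmul1q qmulq1 qmulDl qmulDr qone_neq0.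

Definition qscale (a : R) q : quat R :=
  Quat (a * qre q) (a * qi q) (a * qj q) (a * qk q).

Lemma qscaleA a b q : qscale a (qscale b q) = qscale (a * b) q.
Proof. by apply: quat_ext; rewrite /= mulrA. Qed.
Lemma qscale1 : left_id 1 qscale.
Proof. by move=> q; apply: quat_ext; rewrite /= mul1r. Qed.
Lemma qscaleDr : right_distributive qscale +%R.
Proof. by move=> a p q; apply: quat_ext; rewrite /= mulrDr. Qed.
Lemma qscaleDl q : {morph qscale^~ q : a b / a + b}.
Proof. by move=> a b; apply: quat_ext; rewrite /= mulrDl. Qed.

HB.instance Definition _ := GRing.Zmodule_isLmodule.Build R (quat R)
  qscaleA qscale1 qscaleDr qscaleDl.

Lemma qscaleAl (a : R) p q : a *: (p * q) = (a *: p) * q.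
Proof. by apply: quat_ext => /=; ring. Qed.

HB.instance Definition _ := GRing.Lmodule_isLalgebra.Build R (quat R) qscaleAl.

Lemma qscaleAr (a : R) p q : a *: (p * q) = p * (a *: q).
Proof. by apply: quat_ext => /=; ring. Qed.

HB.instance Definition _ := GRing.Lalgebra_isAlgebra.Build R (quat R) qscaleAr.

Definition qnorm2 q : R := qre q ^+ 2 + qi q ^+ 2 + qj q ^+ 2 + qk q ^+ 2.
Definition qnorm q : R := Num.sqrt (qnorm2 q).

Lemma qnorm2_ge0 q : 0 <= qnorm2 q.
Proof. by rewrite !addr_ge0 ?sqr_ge0. Qed.

Lemma qnorm2_eq0 q : qnorm2 q = 0 -> q = 0.
Proof.
move/eqP; rewrite /qnorm2 !paddr_eq0 ?addr_ge0 ?sqr_ge0 // !sqrf_eq0.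
by move=> /andP[/andP[/andP[/eqP ? /eqP ?] /eqP ?] /eqP ?]; exact: quat_ext.
Qed.

Lemma qnormD p q : qnorm (p + q) <= qnorm p + qnorm q.
Proof.
have sp : qnorm p ^+ 2 = qnorm2 p by rewrite sqr_sqrtr ?qnorm2_ge0.
have sq : qnorm q ^+ 2 = qnorm2 q by rewrite sqr_sqrtr ?qnorm2_ge0.
have np : 0 <= qnorm p := sqrtr_ge0 _.
have nq : 0 <= qnorm q := sqrtr_ge0 _.
rewrite -(@ler_pXn2r _ 2) ?nnegrE ?addr_ge0 ?sqrtr_ge0 //.
rewrite [X in X <= _]sqr_sqrtr ?qnorm2_ge0 // sqrrD sp sq.
pose s : R := qre p * qre q + qi p * qi q + qj p * qj q + qk p * qk q.
have s_le : s <= qnorm p * qnorm q.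
  apply: le_trans (ler_norm _) _.
  rewrite -(@ler_pXn2r _ 2) ?nnegrE ?mulr_ge0 // exprMn sp sq real_normK ?num_real //.
  rewrite -subr_ge0.
  have -> : qnorm2 p * qnorm2 q - s ^+ 2 =
    (qre p * qi q - qi p * qre q) ^+ 2 + (qre p * qj q - qj p * qre q) ^+ 2 +
    (qre p * qk q - qk p * qre q) ^+ 2 + (qi p * qj q - qj p * qi q) ^+ 2 +
    (qi p * qk q - qk p * qi q) ^+ 2 + (qj p * qk q - qk p * qj q) ^+ 2.
    by rewrite /s /qnorm2; ring.
  by rewrite !addr_ge0 ?sqr_ge0.
have -> : qnorm2 (p + q) = qnorm2 p + s *+ 2 + qnorm2 q.
  by rewrite /s /qnorm2 /=; ring.
by rewrite lerD2r lerD2l lerMn2r s_le orbT.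
Qed.

Lemma qnormZ (a : R) q : qnorm (a *: q) = `|a| * qnorm q.
Proof.
rewrite -sqrtr_sqr -sqrtrM ?sqr_ge0 //; congr Num.sqrt.
by rewrite /qnorm2 /=; ring.
Qed.

Lemma qnorm0_eq0 q : qnorm q = 0 -> q = 0.
Proof.
move=> q0; apply: qnorm2_eq0.
by rewrite -[LHS]sqr_sqrtr ?qnorm2_ge0 // -/(qnorm q) q0 expr0n.
Qed.

(* From here on `|q| is the Euclidean norm, and it defines the topology. *)
HB.instance Definition _ :=
  Lmodule_isNormed.Build R (quat R) qnormD qnormZ qnorm0_eq0.

Definition qconj q : quat R := Quat (qre q) (- qi q) (- qj q) (- qk q).
Definition qinv q : quat R := (qnorm2 q)^-1 *: qconj q.

Lemma qmulVq : {in [pred q | q != 0], left_inverse 1 qinv *%R}.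
Proof.
move=> q; rewrite inE => q0.
have {}q0 : qnorm2 q != 0 by apply: contra q0 => /eqP/qnorm2_eq0/eqP.
by apply: quat_ext => /=; move: q0; rewrite /qnorm2 => q0; field; exact: q0.
Qed.

Lemma qmulqV : {in [pred q | q != 0], right_inverse 1 qinv *%R}.
Proof.
move=> q; rewrite inE => q0.
have {}q0 : qnorm2 q != 0 by apply: contra q0 => /eqP/qnorm2_eq0/eqP.
by apply: quat_ext => /=; move: q0; rewrite /qnorm2 => q0; field; exact: q0.
Qed.

Lemma qunitP p q : q * p = 1 /\ p * q = 1 -> p != 0.
Proof.
move=> [qp _]; apply/eqP => p0.
by move/eqP: qp; rewrite p0 mulr0 eq_sym oner_eq0.
Qed.

Lemma qinv_out : {in [predC [pred q | q != 0]], qinv =1 id}.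
Proof.
move=> q; rewrite !inE negbK => /eqP ->.
by apply: quat_ext; rewrite /= ?oppr0 mulr0.
Qed.

HB.instance Definition _ := GRing.NzRing_hasMulInverse.Build (quat R)
  qmulVq qmulqV qunitP qinv_out.

End QuaternionAlgebra.

Section SliceRegular.
Context {R : realType}.

Definition Qi : quat R := Quat 0 1 0 0.
Definition Qj : quat R := Quat 0 0 1 0.
Definition Qk : quat R := Quat 0 0 0 1.

Definition qvec (q : quat R) : quat R := Quat 0 (qi q) (qj q) (qk q).

Definition imag_units : set (quat R) := [set I | I * I = -1].

(* a%:A = a *: 1 is the real number a as a quaternion. *)
Definition slice_pt (I : quat R) (z : R * R) : quat R := z.1%:A + z.2 *: I.

Definition real_line : set (quat R) := range (fun a : R => a%:A).

Definition slice_plane (I : quat R) : set (quat R) := range (slice_pt I).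

Definition sphere (q : quat R) : set (quat R) :=
  [set slice_pt J (qre q, `|qvec q|) | J in imag_units].

Definition imag_dir (q : quat R) : quat R := (`|qvec q|)^-1 *: qvec q.

Implicit Types (Om : set (quat R)) (f g h : quat R -> quat R).

Definition circular_domain Om : Prop :=
  [/\ Om !=set0, connected Om, open Om & forall q, Om q -> sphere q `<=` Om].

Definition slice_domain Om : Prop := Om `&` real_line !=set0.

Definition product_domain Om : Prop := Om `&` real_line = set0.

(* The complex numbers carrying stem functions are pairs (alpha, beta). *)
Definition stem_domain Om : set (R * R) :=
  [set z | exists2 I, imag_units I & Om (slice_pt I z)].

Definition cconj (z : R * R) : R * R := (z.1, - z.2).
Definition dir_alpha : R * R := (1, 0).
Definition dir_beta : R * R := (0, 1).

(* Used only on open D, where this is being C^1. *)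
Definition C1_on (D : set (R * R)) (F : R * R -> quat R) : Prop :=
  forall z, D z ->
    [/\ derivable F z dir_alpha, derivable F z dir_beta,
        {for z, continuous (fun w => 'D_dir_alpha F w)} &
        {for z, continuous (fun w => 'D_dir_beta F w)}].

Definition is_stem Om f (F : (R * R -> quat R) * (R * R -> quat R)) :
    Prop :=
  [/\ C1_on (stem_domain Om) F.1 /\ C1_on (stem_domain Om) F.2,
      forall z, stem_domain Om z ->
        F.1 (cconj z) = F.1 z /\ F.2 (cconj z) = - F.2 z,
      forall z, stem_domain Om z ->
        'D_dir_alpha F.1 z = 'D_dir_beta F.2 z /\
        'D_dir_beta F.1 z = - 'D_dir_alpha F.2 z &
      forall I z, imag_units I -> Om (slice_pt I z) ->
        f (slice_pt I z) = F.1 z + I * F.2 z].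

Definition slice_regular Om f : Prop := exists F, is_stem Om f F.

Definition slice_preserving Om f : Prop :=
  slice_regular Om f /\
  forall I, imag_units I ->
    f @` (Om `&` slice_plane I) `<=` slice_plane I.

(* A function on Om is represented by a total function of which only the
   values on Om matter; {in Om, f =1 g} is equality of functions on Om.
   Products written by juxtaposition in the mathematics have a
   slice preserving left factor and are then pointwise products. *)

Definition star f g : quat R -> quat R :=
  fun q => if f q == 0 then 0 else f q * g ((f q)^-1 * q * f q).

Definition star_exp f (n : nat) : quat R -> quat R :=
  iter n (star f) (fun=> 1).

Definition exp_star f : quat R -> quat R :=
  fun q => limn (series (fun n => (n`!%:R : R)^-1 *: star_exp f n q)).

(* The stem function of a slice regular function is unique on stem_domain. *)
Definition stem Om f : (R * R -> quat R) * (R * R -> quat R) :=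
  xget (fun=> 0, fun=> 0) (is_stem Om f).

(* At a real q, imag_dir q = 0 and F.2 vanishes by oddness. *)
Definition induced (F : (R * R -> quat R) * (R * R -> quat R)) :
    quat R -> quat R :=
  fun q => let z := (qre q, `|qvec q|) in F.1 z + imag_dir q * F.2 z.

Definition slice_conj Om f : quat R -> quat R :=
  induced (qconj \o (stem Om f).1, qconj \o (stem Om f).2).

Definition symm Om f : quat R -> quat R := star f (slice_conj Om f).

Definition is_real_part Om f f0 : Prop :=
  exists f1 f2 f3 : quat R -> quat R,
    [/\ slice_preserving Om f0, slice_preserving Om f1,
        slice_preserving Om f2, slice_preserving Om f3 &
        {in Om, forall q, f q = f0 q + f1 q * Qi + f2 q * Qj + f3 q * Qk}].

(* The decomposition of a slice regular function is unique on Om. *)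
Definition real_part Om f : quat R -> quat R :=
  xget (fun=> 0) (is_real_part Om f).

Definition vector_part Om f : quat R -> quat R :=
  fun q => f q - real_part Om f q.

Definition zero_divisor Om f : Prop :=
  ~ {in Om, f =1 fun=> 0} /\
  exists g, [/\ slice_regular Om g, ~ {in Om, g =1 fun=> 0} &
    {in Om, star f g =1 fun=> 0} \/ {in Om, star g f =1 fun=> 0}].

Definition has_sqrt Om u : Prop :=
  exists2 t, slice_preserving Om t & {in Om, forall q, t q ^+ 2 = u q}.

Definition sphere_poly (q0 : quat R) : quat R -> quat R :=
  fun q => q ^+ 2 - 2 * q * (qre q0)%:A + (`|q0| ^+ 2)%:A.

Definition divides_sphere_poly Om f (q0 : quat R) (m : nat) g : Prop :=
  slice_regular Om g /\ {in Om, forall q, f q = sphere_poly q0 q ^+ m * g q}.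

Definition nonreal_isolated_zero Om f (q0 : quat R) : Prop :=
  [/\ Om q0, ~ real_line q0, ~ {in Om, symm Om f =1 fun=> 0} &
    exists m g,
      [/\ divides_sphere_poly Om f q0 m g,
          forall m' g', divides_sphere_poly Om f q0 m' g' -> (m' <= m)%N &
          g q0 = 0]].

Definition no_nonreal_isolated_zero Om f : Prop :=
  forall q, ~ nonreal_isolated_zero Om f q.

(* A function written with the index v, as H_v, is its own vector part. *)
Definition unit_vector_fun Om H : Prop :=
  [/\ slice_regular Om H, {in Om, real_part Om H =1 fun=> 0} &
      {in Om, symm Om H =1 fun=> 1}].

End SliceRegular.

(* Main.v *)
Require Import Defs.
From HB Require Import structures.
From mathcomp Require Import all_boot all_order all_algebra.
From mathcomp Require Import all_classical all_reals all_analysis.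
From mathcomp Require Import ring lra.
From mathcomp Require Import complex.

Set Implicit Arguments.
Unset Strict Implicit.
Unset Printing Implicit Defensive.

Import Order.TTheory GRing.Theory Num.Theory.
Import numFieldNormedType.Exports.
Import ComplexField.Normc.
Local Open Scope classical_set_scope.
Local Open Scope ring_scope.

(** Write a slice function as a holomorphic function [F] with values in the
    complexified quaternions, [F = f_0 + f_v].  The star product becomes the
    pointwise product, and since [f_v^2 = - u] with [u = f_v^s], the star
    exponential is [exp f_0 (cos s + (sin s / s) f_v)] where [s^2 = u].

    Suppose that [h] and [ht] have the same exponential.  At a point where its
    vector part does not vanish, write [h_v = s H] and [ht_v = s' H'] with
    [H^s = H'^s = 1].  For a suitable sign of [s'] comparison gives [H' = H]
    and equality of the exponentials of the eigenvalues [h_0 + i s] and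
    [h_0 - i s] with those of [ht]; the eigenvalues then differ by [2 i pi a]
    and [2 i pi b].  Hence [ht_0 = h_0 + i pi n] and [ht_v = h_v + pi m H] with
    [n = a + b] and [m = a - b] ([equal_bexp]).  No choice of [s] or [H]
    survives in the consequences that [ht_0 - h_0 = i pi n], that
    [(ht_v - h_v)^s = (pi m)^2] and that [h_v] and [ht_v] are parallel.  Near a
    good point [n] and [m] are constant, so these are identities between
    holomorphic functions, and the identity theorem extends them to all of
    [Om] ([equal_exp_star]).  A good point exists, for otherwise the
    exponential would be slice preserving ([exp_slice_preserving]).

    If [m = 0] then [ht_v = h_v], and [ht] differs from [h] by a multiple of
    the function [J], which is excluded on a slice domain because [h_0] and
    [ht_0] are real on the real axis.  If [m <> 0], then
    [H = (ht_v - h_v) / (pi m)] is globally defined with [H^s = 1], and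
    [h_v = al H], [ht_v = (al + pi m) H] where [al] is the dot product of [h_v]
    and [H] ([equal_exp_polar]).  The remaining claims are properties of
    functions of the form [al H]: the square root of [(al H)^s] is [al], and a
    non-real isolated zero would have to come from a zero of [al], which occurs
    on whole spheres ([polar_no_isolated_zero]).

    The complex analysis rests on the mean value property, proved by averaging
    over the vertices of regular polygons ([mean_value_bound]).  It yields
    Cauchy's estimate, hence Weierstrass' theorem on uniform limits, and from
    this the differentiability of derivatives and of difference quotients.
    Unique continuation follows from the mean value property of
    [f / (z - z0)^n] for large [n] ([near_zero_spread]). *)

(** * Complex modulus and strict differentiability *)

Section ComplexModulus.
Context {R : realType}.
Local Notation C := R[i].
Implicit Types z w : C.

Lemma normc_ge0 z : 0 <= normc z.
Proof. by case: z => a b; rewrite sqrtr_ge0. Qed.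

Lemma normc_gt0 z : (0 < normc z) = (z != 0).
Proof.
rewrite lt_neqAle normc_ge0 andbT eq_sym; congr (~~ _).
by apply/eqP/eqP => [/eq0_normc|->] //; rewrite normc0.
Qed.

Lemma normcD z w : normc (z + w) <= normc z + normc w.
Proof. exact: le_normcD. Qed.

Lemma normc_opp z : normc (- z) = normc z.
Proof. exact: normcN. Qed.

Lemma normcB z w : normc (z - w) = normc (w - z).
Proof. by rewrite -normc_opp opprB. Qed.

Lemma normc_triangle u z w : normc (z - w) <= normc (z - u) + normc (u - w).
Proof.
have -> : z - w = (z - u) + (u - w) by ring.
exact: normcD.
Qed.

Lemma normcX z n : normc (z ^+ n) = normc z ^+ n.
Proof.
elim: n => [|n IH]; first exact: normc1.
by rewrite !exprS normcM IH.
Qed.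

Lemma normc_sum (I : Type) (r : seq I) (P : pred I) (F : I -> C) :
  normc (\sum_(i <- r | P i) F i) <= \sum_(i <- r | P i) normc (F i).
Proof.
elim/big_ind2 : _ => //; first by rewrite normc0 lexx.
by move=> z x w y zx wy; apply: le_trans (normcD _ _) _; rewrite lerD.
Qed.

Lemma normc_sqr z : normc z ^+ 2 = complex.Re z ^+ 2 + complex.Im z ^+ 2.
Proof. by case: z => a b /=; rewrite sqr_sqrtr // addr_ge0 ?sqr_ge0. Qed.

Lemma normcRe z : `|complex.Re z| <= normc z.
Proof.
rewrite -(@ler_pXn2r _ 2) ?nnegrE ?normc_ge0 // normc_sqr real_normK ?num_real //.
by rewrite lerDl sqr_ge0.
Qed.

Lemma normcIm z : `|complex.Im z| <= normc z.
Proof.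
rewrite -(@ler_pXn2r _ 2) ?nnegrE ?normc_ge0 // normc_sqr real_normK ?num_real //.
by rewrite lerDr sqr_ge0.
Qed.

Lemma normc_le z : normc z <= `|complex.Re z| + `|complex.Im z|.
Proof.
rewrite -(@ler_pXn2r _ 2) ?nnegrE ?normc_ge0 ?addr_ge0 // normc_sqr sqrrD.
rewrite !real_normK ?num_real // -subr_ge0.
set x := _ ^+ 2; set y := _ ^+ 2.
have : 0 <= `|complex.Re z| * `|complex.Im z| by rewrite mulr_ge0.
by lra.
Qed.

Lemma normc_real (x : R) : normc (x%:C)%C = `|x|.
Proof. by rewrite /= expr0n addr0 sqrtr_sqr. Qed.

Lemma normc_conj z : normc (z^*)%C = normc z.
Proof. by case: z => a b /=; rewrite sqrrN. Qed.

Lemma normc_le0 z : (forall e, 0 < e -> normc z <= e) -> z = 0.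
Proof.
move=> H; apply: eq0_normc; apply/eqP; rewrite eq_le normc_ge0 andbT.
by apply/ler_addgt0Pl => e e0; rewrite addr0; exact: H.
Qed.

End ComplexModulus.

Section StrictDerivative.
Context {R : realType}.
Local Notation C := R[i].
Implicit Types (f g : C -> C) (z w l m : C) (D : set C).

(** Strict differentiability: the increment of [f] between two points that
    both tend to [z] is compared with the linear map.  At every point of an
    open set this is continuous complex differentiability, and unlike the
    latter it is stable under uniform limits. *)
Definition sder f z l := forall e, 0 < e -> exists2 d, 0 < d &
  forall w w', normc (w - z) < d -> normc (w' - z) < d ->
    normc (f w' - f w - l * (w' - w)) <= e * normc (w' - w).

Definition holo f z := exists l, sder f z l.

Definition dc f z := xget 0 (sder f z).

Lemma dcP f z : holo f z -> sder f z (dc f z).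
Proof. by move=> [l fl]; rewrite /dc; apply: xgetPex; exists l. Qed.

(** Lets the rules of differentiation be proved up to a constant factor in the
    error. *)
Lemma sder_scale f z l K : 0 < K ->
  (forall e, 0 < e -> e <= 1 -> exists2 d, 0 < d &
  forall w w', normc (w - z) < d -> normc (w' - z) < d ->
    normc (f w' - f w - l * (w' - w)) <= K * e * normc (w' - w)) ->
  sder f z l.
Proof.
move=> K0 H e e0.
have e1 : 0 < Num.min (e / K) 1 by rewrite lt_min ltr01 andbT divr_gt0.
have [|d d0 Hd] := H _ e1; first by rewrite ge_min lexx orbT.
exists d => // w w' wd w'd; apply: le_trans (Hd _ _ wd w'd) _.
rewrite ler_wpM2r ?normc_ge0 // mulrC -ler_pdivlMr //.
by rewrite ge_min lexx.
Qed.

Lemma sder_near f g z l d : 0 < d ->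
  (forall w, normc (w - z) < d -> f w = g w) -> sder f z l -> sder g z l.
Proof.
move=> d0 fg fl e e0; have [d' d'0 Hd] := fl e e0.
exists (Num.min d d'); first by rewrite lt_min d0.
move=> w w'; rewrite !lt_min => /andP[wd wd'] /andP[w'd w'd'].
by rewrite -!fg //; exact: Hd.
Qed.

Lemma holo_near f g z d : 0 < d ->
  (forall w, normc (w - z) < d -> f w = g w) -> holo f z -> holo g z.
Proof. by move=> d0 fg [l fl]; exists l; exact: sder_near fg fl. Qed.

Lemma sder_cst c z : sder (fun=> c) z 0.
Proof.
move=> e e0; exists 1 => // w w' _ _.
by rewrite subrr mul0r subrr normc0 mulr_ge0 ?normc_ge0 // ltW.
Qed.

Lemma sder_id z : sder id z 1.
Proof.
move=> e e0; exists 1 => // w w' _ _.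
by rewrite mul1r subrr normc0 mulr_ge0 ?normc_ge0 // ltW.
Qed.

Lemma sder_lip f z l : sder f z l -> exists2 d, 0 < d &
  forall w w', normc (w - z) < d -> normc (w' - z) < d ->
    normc (f w' - f w) <= (normc l + 1) * normc (w' - w).
Proof.
move=> /(_ 1 ltr01)[d d0 H]; exists d => // w w' wd w'd.
have -> : f w' - f w = (f w' - f w - l * (w' - w)) + l * (w' - w) by ring.
apply: le_trans (normcD _ _) _; rewrite normcM.
by have := H _ _ wd w'd; lra.
Qed.

Lemma sder_cont f z l : sder f z l -> forall e, 0 < e -> exists2 d, 0 < d &
  forall w, normc (w - z) < d -> normc (f w - f z) < e.
Proof.
move=> /sder_lip[d d0 H] e e0.
have k0 : 0 < normc l + 1 by rewrite ltr_wpDl ?normc_ge0.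
exists (Num.min d (e / (normc l + 1))).
  by rewrite lt_min d0 divr_gt0.
move=> w; rewrite lt_min => /andP[wd we].
have zd : normc (z - z) < d by rewrite subrr normc0.
apply: le_lt_trans (H _ _ zd wd) _.
by rewrite mulrC -ltr_pdivlMr.
Qed.

Lemma holo_cont f z : holo f z -> forall e, 0 < e -> exists2 d, 0 < d &
  forall w, normc (w - z) < d -> normc (f w - f z) < e.
Proof. by move=> [l]; exact: sder_cont. Qed.

Lemma sderD f g z l m : sder f z l -> sder g z m ->
  sder (fun w => f w + g w) z (l + m).
Proof.
move=> fl gm; apply: (@sder_scale _ _ _ 2) => // e e0 _.
have [d d0 Hf] := fl e e0; have [d' d'0 Hg] := gm e e0.
exists (Num.min d d'); first by rewrite lt_min d0.
move=> w w'; rewrite !lt_min => /andP[wd wd'] /andP[w'd w'd'].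
have -> : f w' + g w' - (f w + g w) - (l + m) * (w' - w) =
  (f w' - f w - l * (w' - w)) + (g w' - g w - m * (w' - w)) by ring.
apply: le_trans (normcD _ _) _.
by have := Hf _ _ wd w'd; have := Hg _ _ wd' w'd'; lra.
Qed.

Lemma sderM f g z l m : sder f z l -> sder g z m ->
  sder (fun w => f w * g w) z (l * g z + f z * m).
Proof.
move=> fl gm.
pose K := normc (g z) + normc l + normc (f z) + normc m + 2.
have nl := normc_ge0 l; have nm := normc_ge0 m.
have nf := normc_ge0 (f z); have ng := normc_ge0 (g z).
have K0 : 0 < K by rewrite /K; lra.
apply: (@sder_scale _ _ _ K) => // e e0 e1.
have [d d0 Hf] := fl e e0; have [d' d'0 Hg] := gm e e0.
have [c c0 Cf] := sder_cont fl e0; have [c' c'0 Cg] := sder_cont gm e0.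
exists (Num.min (Num.min d d') (Num.min c c')); first by rewrite !lt_min d0 d'0 c0.
move=> w w'; rewrite !lt_min => /andP[/andP[wd wd'] /andP[wc wc']].
move=> /andP[/andP[w'd w'd'] /andP[w'c w'c']].
have -> : f w' * g w' - f w * g w - (l * g z + f z * m) * (w' - w) =
  (f w' - f w - l * (w' - w)) * g w' + l * (g w' - g z) * (w' - w)
  + (f w * (g w' - g w - m * (w' - w)) + (f w - f z) * m * (w' - w)) by ring.
have := Hf _ _ wd w'd; have := Hg _ _ wd' w'd'.
have := Cf _ wc; have := Cg _ w'c'.
set A := f w' - _ - _; set B := g w' - g w - _.
set P := f w - f z; set Q := g w' - g z; set t := w' - w => hQ hP hB hA.
have gw' : normc (g w') <= normc (g z) + 1.
  have -> : g w' = g z + Q by rewrite /Q; ring.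
  by apply: le_trans (normcD _ _) _; lra.
have fw : normc (f w) <= normc (f z) + 1.
  have -> : f w = f z + P by rewrite /P; ring.
  by apply: le_trans (normcD _ _) _; lra.
apply: le_trans (normcD _ _) _.
apply: le_trans (lerD (normcD _ _) (normcD _ _)) _; rewrite !normcM.
have t0 := normc_ge0 t.
have et0 : 0 <= e * normc t by rewrite mulr_ge0 // ltW.
have h1 : normc A * normc (g w') <= (e * normc t) * (normc (g z) + 1).
  by apply: ler_pM => //; exact: normc_ge0.
have h2 : normc l * normc Q * normc t <= normc l * e * normc t.
  by rewrite ler_wpM2r // ler_wpM2l // ltW.
have h3 : normc (f w) * normc B <= (normc (f z) + 1) * (e * normc t).
  by apply: ler_pM => //; exact: normc_ge0.
have h4 : normc P * normc m * normc t <= e * normc m * normc t.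
  by rewrite ler_wpM2r // ler_wpM2r // ltW.
have -> : K * e * normc t = (e * normc t) * (normc (g z) + 1) + normc l * e * normc t
  + ((normc (f z) + 1) * (e * normc t) + e * normc m * normc t).
  by rewrite /K; ring.
by rewrite !lerD.
Qed.

Lemma sder_comp f g z l m : sder f z l -> sder g (f z) m ->
  sder (fun w => g (f w)) z (m * l).
Proof.
move=> fl gm.
pose K := normc l + 1 + normc m.
have nl := normc_ge0 l; have nm := normc_ge0 m.
apply: (@sder_scale _ _ _ K); first by rewrite /K; lra.
move=> e e0 e1.
have [d d0 Hf] := fl e e0; have [d' d'0 Hg] := gm e e0.
have [c c0 Cf] := sder_cont fl d'0; have [c' c'0 Lf] := sder_lip fl.
exists (Num.min d (Num.min c c')); first by rewrite !lt_min d0 c0.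
move=> w w'; rewrite !lt_min => /and3P[wd wc wc'] /and3P[w'd w'c w'c'].
have -> : g (f w') - g (f w) - m * l * (w' - w) =
  (g (f w') - g (f w) - m * (f w' - f w)) + m * (f w' - f w - l * (w' - w)).
  by ring.
apply: le_trans (normcD _ _) _; rewrite normcM.
have h1 := Hg _ _ (Cf _ wc) (Cf _ w'c).
have h2 := Lf _ _ wc' w'c'.
have h3 : e * normc (f w' - f w) <= e * ((normc l + 1) * normc (w' - w)).
  by rewrite ler_wpM2l // ltW.
have h4 : normc m * normc (f w' - f w - l * (w' - w)) <= normc m * (e * normc (w' - w)).
  by rewrite ler_wpM2l // Hf.
by rewrite /K; lra.
Qed.

Lemma sderV z : z != 0 -> sder (fun w => w^-1) z (- (z ^+ 2)^-1).
Proof.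
move=> z0; have nz : 0 < normc z by rewrite normc_gt0.
apply: (@sder_scale _ _ _ (12 / normc z ^+ 2)); first by rewrite divr_gt0 ?exprn_gt0.
move=> e e0 e1; exists (e * (normc z / 2)); first by rewrite mulr_gt0 ?divr_gt0.
have far w : normc (w - z) < e * (normc z / 2) -> normc z / 2 <= normc w.
  move=> wz; have : normc (w - z) < normc z / 2.
    by apply: lt_le_trans wz _; rewrite ler_piMl // divr_ge0 // ltW.
  have := normc_triangle w z 0; rewrite !subr0 (normcB z w).
  by lra.
move=> w w' wz w'z.
have hw := far _ wz; have hw' := far _ w'z.
have w0 : w != 0 by rewrite -normc_gt0; lra.
have w'0 : w' != 0 by rewrite -normc_gt0; lra.
have -> : w'^-1 - w^-1 - - (z ^+ 2)^-1 * (w' - w) =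
  ((w - z) * w' + z * (w' - z)) * (z ^+ 2)^-1 * (w^-1 * w'^-1) * (w' - w).
  by field; rewrite w0 w'0 z0.
rewrite 4!normcM !normcV normcX; apply: ler_wpM2r; first exact: normc_ge0.
have w'b : normc w' <= 2 * normc z.
  have -> : w' = (w' - z) + z by ring.
  apply: le_trans (normcD _ _) _.
  suff : e * (normc z / 2) <= normc z / 2 by lra.
  by rewrite ler_piMl // divr_ge0 // ltW.
have h1 : normc ((w - z) * w' + z * (w' - z)) <= 3 / 2 * e * normc z ^+ 2.
  apply: le_trans (normcD _ _) _; rewrite !normcM.
  have a1 : normc (w - z) * normc w' <= e * (normc z / 2) * (2 * normc z).
    by apply: ler_pM => //; rewrite ?normc_ge0 // ltW.
  have a2 : normc z * normc (w' - z) <= normc z * (e * (normc z / 2)).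
    by apply: ler_pM => //; rewrite ?normc_ge0 // ltW.
  by lra.
have h2 : (normc w)^-1 * (normc w')^-1 <= (normc z / 2)^-1 * (normc z / 2)^-1.
  apply: ler_pM; rewrite ?invr_ge0 ?normc_ge0 // lef_pV2 ?posrE ?divr_gt0 //.
    by rewrite normc_gt0.
  by rewrite normc_gt0.
have z2 : 0 < normc z ^+ 2 by rewrite exprn_gt0.
apply: (@le_trans _ _ ((3 / 2 * e * normc z ^+ 2) * (normc z ^+ 2)^-1 *
    ((normc z / 2)^-1 * (normc z / 2)^-1))).
  apply: ler_pM => //.
  - by rewrite mulr_ge0 ?normc_ge0 // invr_ge0 ltW.
  - by rewrite mulr_ge0 ?invr_ge0 ?normc_ge0.
  - by rewrite ler_wpM2r // invr_ge0 ltW.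
rewrite -subr_ge0.
have -> : 12 / normc z ^+ 2 * e - 3 / 2 * e * normc z ^+ 2 / normc z ^+ 2 *
    ((normc z / 2)^-1 / (normc z / 2)) = 6 * e / normc z ^+ 2.
  by field; rewrite gt_eqF.
by rewrite divr_ge0 ?(ltW z2) // mulr_ge0 // ltW.
Qed.

Lemma holo_cst c z : holo (fun=> c) z.
Proof. by exists 0; exact: sder_cst. Qed.

Lemma holo_id z : holo id z.
Proof. by exists 1; exact: sder_id. Qed.

Lemma holoD f g z : holo f z -> holo g z -> holo (fun w => f w + g w) z.
Proof. by move=> [l fl] [m gm]; exists (l + m); exact: sderD. Qed.

Lemma holoM f g z : holo f z -> holo g z -> holo (fun w => f w * g w) z.
Proof. by move=> [l fl] [m gm]; eexists; exact: sderM fl gm. Qed.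

Lemma holoN f z : holo f z -> holo (fun w => - f w) z.
Proof.
move=> fz; apply: (@holo_near (fun w => (-1) * f w) _ _ 1) => //.
  by move=> w _; rewrite mulN1r.
by apply: holoM => //; exact: holo_cst.
Qed.

Lemma holoB f g z : holo f z -> holo g z -> holo (fun w => f w - g w) z.
Proof. by move=> fz gz; apply: holoD => //; exact: holoN. Qed.

Lemma holoX f z n : holo f z -> holo (fun w => f w ^+ n) z.
Proof.
move=> fz; elim: n => [|n IH].
  by apply: (@holo_near (fun=> 1) _ _ 1) => //; exact: holo_cst.
apply: (@holo_near (fun w => f w * f w ^+ n) _ _ 1) => //.
  by move=> w _; rewrite exprS.
exact: holoM.
Qed.

Lemma holoV f z : holo f z -> f z != 0 -> holo (fun w => (f w)^-1) z.
Proof.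
move=> [l fl] z0; eexists; apply: (sder_comp fl (sderV z0)).
Qed.

Lemma holo_comp f g z : holo f z -> holo g (f z) -> holo (fun w => g (f w)) z.
Proof. by move=> [l fl] [m gm]; eexists; exact: sder_comp fl gm. Qed.

End StrictDerivative.

(** * Uniform estimates and the mean value property *)

Section CompactAnnulus.
Context {R : realType}.
Local Notation C := R[i].
Implicit Types (z w p : C).

Definition cplx (x : R * R) : C := Complex x.1 x.2.

Let annulus p (r0 r : R) : set (R * R) :=
  [set x | r0 <= normc (cplx x - p) <= r].

Let normc_cont p : continuous (fun x : R * R => normc (cplx x - p)).
Proof.
case: p => a b x; rewrite /cplx /=.
apply: (@continuous_comp _ _ _ (fun x : R * R => (x.1 - a) ^+ 2 + (x.2 - b) ^+ 2)).
  have sq (g : R * R -> R) c : {for x, continuous g} ->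
      {for x, continuous (fun y => (g y - c) ^+ 2)}.
    move=> gx; have gc : (fun y => g y - c) @ x --> g x - c.
      by apply: cvgB => //; exact: cvg_cst.
    by rewrite /prop_for /continuous_at expr2; under eq_fun do rewrite expr2; exact: cvgM.
  by apply: cvgD; apply: sq; [exact: cvg_fst | exact: cvg_snd].
exact: sqrt_continuous.
Qed.

Let annulus_compact p r0 r : compact (annulus p r0 r).
Proof.
pose a := complex.Re p; pose b := complex.Im p.
apply: (@subclosed_compact _ _ (`[a - r, a + r] `*` `[b - r, b + r])).
- have -> : annulus p r0 r = (fun x => normc (cplx x - p)) @^-1` `[r0, r].
    by apply/seteqP; split=> x /=; rewrite in_itv.
  apply: preimage_closed; last exact: interval_closed.
  by move=> x _; exact: normc_cont.
- by apply: compact_setX; exact: segment_compact.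
- move=> [x y] /= /andP[_ h]; rewrite !in_itv /=.
  have := normcRe (cplx (x, y) - p); have := normcIm (cplx (x, y) - p).
  rewrite /cplx /a /b; case: (p) h => a' b' /= h.
  rewrite !ler_norml => /andP[i1 i2] /andP[j1 j2].
  by split; apply/andP; split; lra.
Qed.

(** Compactness, in the form of a Lebesgue number: it turns strict
    differentiability at each point into a uniform estimate. *)
Lemma annulus_uniform p (r0 r : R) (P : R -> C -> Prop) :
  (forall d d' w, d' <= d -> P d w -> P d' w) ->
  (forall z, r0 <= normc (z - p) <= r -> exists2 d, 0 < d &
     forall w, r0 <= normc (w - p) <= r -> normc (w - z) < d -> P d w) ->
  exists2 d, 0 < d & forall w, r0 <= normc (w - p) <= r -> P d w.
Proof.
move=> mono loc.
have /near_covering_withinP cov : near_covering (annulus p r0 r).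
  by apply/compact_near_coveringP; exact: annulus_compact.
have := cov R (0 : R)^'+ (fun d x => P d (cplx x)) _.
have cover : forall x, annulus p r0 r x ->
    \forall x' \near x & i \near 0^'+, annulus p r0 r x' -> P i (cplx x').
  move=> x xA; have [d d0 Hd] := loc _ xA.
  have d2 : 0 < d / 2 by rewrite divr_gt0.
  exists (ball x (d / 2), [set i | i <= d]).
    split; first exact: nbhsx_ballx.
    exact: nbhs_right_le.
  move=> [x' i] /= [[b1 b2] id] x'A; apply: mono id _; apply: Hd => //.
  apply: le_lt_trans (normc_le _) _ => /=.
  by move: b1 b2; rewrite /ball /= !(distrC x.1) (distrC x.2); lra.
move=> /(_ _ cover) H.
near (0 : R)^'+ => d.
exists d => // w wA.
have dP : annulus p r0 r `<=` P d \o cplx by near: d; exact: H.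
have := dP (complex.Re w, complex.Im w).
by rewrite /cplx /annulus /=; case: (w) wA => x y /= wA; exact.
Unshelve. all: by end_near. Qed.

End CompactAnnulus.

Section MeanValue.
Context {R : realType}.
Local Notation C := R[i].
Implicit Types (f g : C -> C) (z w p l : C).

(** The derivatives at two nearby points are close because both linear maps
    approximate the same increment, here the one over a short real step. *)
Lemma sder_uniform f p (r0 r : R) :
  (forall z, r0 <= normc (z - p) <= r -> holo f z) ->
  forall e, 0 < e -> exists2 d, 0 < d &
  forall w w', r0 <= normc (w - p) <= r -> normc (w' - w) < d ->
    normc (f w' - f w - dc f w * (w' - w)) <= e * normc (w' - w).
Proof.
move=> hf e e0.
pose P d w := forall w', normc (w' - w) < d ->
  normc (f w' - f w - dc f w * (w' - w)) <= e * normc (w' - w).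
suff [d d0 Hd] : exists2 d, 0 < d & forall w, r0 <= normc (w - p) <= r -> P d w.
  by exists d => // w w' wA; exact: Hd.
apply: annulus_uniform => [d d' w dd' H w' w'd|z zA].
  by apply: H; exact: lt_le_trans dd'.
have e2 : 0 < e / 4 by rewrite divr_gt0.
have [d d0 Hd] := dcP (hf _ zA) e2.
have d2 : 0 < d / 2 by rewrite divr_gt0.
exists (d / 2) => // w wA wz w' w'w.
have wd : normc (w - z) < d by lra.
have w'd : normc (w' - z) < d by have := normc_triangle w w' z; lra.
have lw : normc (dc f w - dc f z) <= e / 2.
  have [d' d'0 Hd'] := dcP (hf _ wA) e2.
  pose t := (Num.min d' (d / 2)) / 2.
  have t0 : 0 < t by rewrite divr_gt0 // lt_min d'0.
  have tw : normc ((w + t%:C)%C - w) = t.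
    by rewrite addrC addKr normc_real ger0_norm // ltW.
  have td' : t < d'.
    by rewrite /t ltr_pdivrMr // gt_min; apply/orP; left; lra.
  have td : t < d / 2.
    by rewrite /t ltr_pdivrMr // gt_min; apply/orP; right; lra.
  have w0 : normc (w - w) < d' by rewrite subrr normc0.
  have A := Hd' w (w + t%:C)%C w0 _; rewrite tw in A; have {}A := A td'.
  have B := Hd w (w + t%:C)%C wd _; rewrite tw in B.
  have {B} : normc (f (w + t%:C)%C - f w - dc f z * ((w + t%:C)%C - w)) <= e / 4 * t.
    by apply: B; have := normc_triangle w (w + t%:C)%C z; rewrite tw; lra.
  move: A; rewrite [(w + _)%C - w]addrC addKr; set F := f _ - f w => A B.
  have : normc ((dc f w - dc f z) * t%:C)%C <= e / 2 * t.
    have -> : ((dc f w - dc f z) * t%:C = (F - dc f z * t%:C) - (F - dc f w * t%:C))%C.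
      by ring.
    by apply: le_trans (normcD _ _) _; rewrite normc_opp; lra.
  by rewrite normcM normc_real ger0_norm ?(ltW t0) // ler_pM2r.
have -> : f w' - f w - dc f w * (w' - w) =
  (f w' - f w - dc f z * (w' - w)) + (dc f z - dc f w) * (w' - w) by ring.
apply: le_trans (normcD _ _) _; rewrite normcM (normcB (dc f z)).
have := Hd _ _ wd w'd.
have : normc (dc f w - dc f z) * normc (w' - w) <= e / 2 * normc (w' - w).
  by rewrite ler_wpM2r ?normc_ge0.
have := mulr_ge0 (ltW e0) (normc_ge0 (w' - w)).
by lra.
Qed.

Lemma holo_bounded f p (r0 r : R) :
  (forall z, r0 <= normc (z - p) <= r -> holo f z) ->
  exists2 M, 0 < M & forall z, r0 <= normc (z - p) <= r -> normc (f z) <= M.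
Proof.
move=> hf.
suff [d d0 Hd] : exists2 d, 0 < d & forall z, r0 <= normc (z - p) <= r ->
    normc (f z) * d <= 1.
  exists d^-1; first by rewrite invr_gt0.
  by move=> z zA; rewrite -(mul1r d^-1) ler_pdivlMr //; exact: Hd.
apply: annulus_uniform => [d d' w dd' H|z zA].
  by apply: le_trans H; rewrite ler_wpM2l ?normc_ge0.
have [d d0 Hd] := holo_cont (hf _ zA) ltr01.
have k0 : 0 < normc (f z) + 1 by rewrite ltr_wpDl ?normc_ge0.
exists (Num.min d (normc (f z) + 1)^-1); first by rewrite lt_min d0 invr_gt0.
move=> w wA; rewrite lt_min => /andP[wd _].
have fw : normc (f w) <= normc (f z) + 1.
  have -> : f w = f z + (f w - f z) by ring.
  by apply: le_trans (normcD _ _) _; have := Hd _ wd; lra.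
apply: (@le_trans _ _ ((normc (f z) + 1) * (normc (f z) + 1)^-1)).
  apply: ler_pM => //; first exact: normc_ge0.
  - by rewrite le_min (ltW d0) invr_ge0 ltW.
  - by rewrite ge_min lexx orbT.
by rewrite mulfV // gt_eqF.
Qed.

Lemma sum_ord_const (A : pzSemiRingType) n (c : A) : \sum_(k < n) c = n%:R * c.
Proof. by rewrite sumr_const card_ord mulr_natl. Qed.

Lemma archi_div (b d : R) : 0 < d -> exists n : nat, b / n.+1%:R < d.
Proof.
move=> d0; have [n hn] : exists n : nat, b / d < n%:R.
  by exists (Num.truncn (b / d)).+1; rewrite truncnS_gt.
exists n; rewrite ltr_pdivrMr ?ltr0n // mulrC -ltr_pdivrMr //.
by apply: lt_trans hn _; rewrite ltr_nat.
Qed.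

(** Local Lipschitz bounds along a segment add up over a subdivision. *)
Lemma lip_chain (g : R -> C) (a b L d : R) : 0 < d -> a <= b ->
  (forall s s', a <= s -> s <= s' -> s' <= b -> s' - s < d ->
     normc (g s' - g s) <= L * (s' - s)) ->
  normc (g b - g a) <= L * (b - a).
Proof.
move=> d0 ab H; have [n hn] := archi_div (b - a) d0.
pose t k := a + (b - a) * (k%:R / n.+1%:R).
have n0 : 0 < n.+1%:R :> R by rewrite ltr0n.
have tS k : t k.+1 - t k = (b - a) / n.+1%:R.
  have : n.+1%:R != 0 :> R by rewrite gt_eqF.
  by rewrite /t -(natr1 k); set N : R := n.+1%:R => N0; field.
have step k : (k <= n.+1)%N -> normc (g (t k) - g a) <= L * (t k - a).
  elim: k => [|k IH] kn.
    by rewrite /t mul0r mulr0 addr0 !subrr mulr0 normc0.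
  apply: le_trans (normc_triangle (g (t k)) _ _) _.
  have -> : t k.+1 - a = (t k.+1 - t k) + (t k - a) by ring.
  rewrite mulrDr lerD ?IH ?(ltnW kn) //; apply: H.
  - by rewrite /t lerDl mulr_ge0 ?subr_ge0 // divr_ge0 // ltW.
  - by rewrite -subr_ge0 tS divr_ge0 ?subr_ge0 // ltW.
  - rewrite /t -lerBrDl ler_piMr ?subr_ge0 // ler_pdivrMr // mul1r.
    by rewrite ler_nat.
  - by rewrite tS.
have := step n.+1 (leqnn _).
by rewrite /t divff ?gt_eqF // mulr1 (addrC a) subrK.
Qed.

Lemma holo_lipschitz f p (r M : R) :
  (forall z, normc (z - p) <= r -> holo f z /\ normc (dc f z) <= M) ->
  forall w w', normc (w - p) <= r -> normc (w' - p) <= r ->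
    normc (f w' - f w) <= M * normc (w' - w).
Proof.
move=> hf w w' wr w'r.
apply/ler_addgt0Pl => e e0.
have k0 : 0 < normc (w' - w) + 1 by rewrite ltr_wpDl ?normc_ge0.
have e1 : 0 < e / (normc (w' - w) + 1) by rewrite divr_gt0.
have [|d d0 Hd] := @sder_uniform f p (-1) r _ _ e1.
  by move=> z /andP[_ /hf[]].
pose g t := f (w + t%:C * (w' - w))%C.
have -> : f w' = g 1 by rewrite /g mul1r addrC subrK.
have -> : f w = g 0 by rewrite /g mul0r addr0.
have inD t : 0 <= t -> t <= 1 -> normc ((w + t%:C * (w' - w))%C - p) <= r.
  move=> t0 t1.
  have -> : ((w + t%:C * (w' - w)) - p = (1 - t)%:C * (w - p) + t%:C * (w' - p))%C.
    by rewrite rmorphB rmorph1; ring.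
  apply: le_trans (normcD _ _) _; rewrite !normcM !normc_real.
  rewrite !ger0_norm ?subr_ge0 //.
  have -> : r = (1 - t) * r + t * r by ring.
  by rewrite lerD // ler_wpM2l ?subr_ge0.
have -> : e + M * normc (w' - w) = (e + M * normc (w' - w)) * (1 - 0) by ring.
have d1 : 0 < d / (normc (w' - w) + 1) by rewrite divr_gt0.
apply: (lip_chain d1) => // s s' s0 ss' s'1 sd.
have inc : ((w + s'%:C * (w' - w)) - (w + s%:C * (w' - w)) = (s' - s)%:C * (w' - w))%C.
  by rewrite rmorphB; ring.
have s's : 0 <= s' - s by rewrite subr_ge0.
have ninc : normc ((w + s'%:C * (w' - w))%C - (w + s%:C * (w' - w))%C) = (s' - s) * normc (w' - w).
  by rewrite inc normcM normc_real ger0_norm.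
have sin : normc ((w + s%:C * (w' - w))%C - p) <= r.
  by apply: inD => //; apply: le_trans s'1.
have := Hd (w + s%:C * (w' - w))%C (w + s'%:C * (w' - w))%C.
rewrite (le_trans _ (normc_ge0 _)) ?lerN10 // sin ninc => /(_ isT) => H.
have {}H := H _.
have lt_d : (s' - s) * normc (w' - w) < d.
  move: sd; rewrite ltr_pdivlMr // mulrDr mulr1; lra.
have {}H := H lt_d; rewrite inc in H.
rewrite /g; set F := f _ - f _ in H *; set l := dc f _ in H.
have -> : F = (F - l * ((s' - s)%:C * (w' - w))%C) + l * ((s' - s)%:C * (w' - w))%C by ring.
apply: le_trans (normcD _ _) _; rewrite normcM normcM normc_real ger0_norm //.
rewrite (mulrDl e) lerD //.
  apply: le_trans H _; rewrite mulrAC ler_pdivrMr // -mulrA.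
  by rewrite ler_wpM2l ?(ltW e0) // ler_wpM2l // lerDl.
rewrite -mulrA (mulrC (normc (w' - w))) ler_wpM2r ?mulr_ge0 ?normc_ge0 //.
by have [] := hf _ sin.
Qed.

Definition cis (t : R) : C := Complex (cos t) (sin t).

Lemma cisD s t : cis (s + t) = cis s * cis t.
Proof.
by rewrite /cis; simpc; rewrite cosD sinD [_ * sin t + _]addrC.
Qed.

Lemma cis0 : cis 0 = 1.
Proof. by rewrite /cis cos0 sin0. Qed.

Lemma cisX t n : cis (t *+ n) = cis t ^+ n.
Proof. by elim: n => [|n IH]; rewrite ?cis0 // mulrS exprS cisD IH. Qed.

Lemma normc_cis t : normc (cis t) = 1.
Proof. by rewrite /= cos2Dsin2 sqrtr1. Qed.

(** Rotations [u] that carry a regular polygon with short sides to itself. *)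
Lemma near_root_of_unity (d : R) : 0 < d -> exists n (u : C),
  [/\ u ^+ n.+1 = 1, normc u = 1, u != 1 & normc (u - 1) < d].
Proof.
move=> d0; have d2 : 0 < d / 2 by rewrite divr_gt0.
have near0 (f : R -> R) : {for 0, continuous f} ->
    exists2 e, 0 < e & forall t, `|t| < e -> `|f t - f 0| < d / 2.
  move=> fc.
  have /cvgrPdist_lt/(_ _ d2)/nbhs_ballP[e e0 He] := fc.
  exists e => // t te; rewrite distrC; apply: He.
  by rewrite /ball /= sub0r normrN.
have [e1 e10 H1] := near0 _ (@continuous_cos R 0).
have [e2 e20 H2] := near0 _ (@continuous_sin R 0).
have pi0 : 0 < pi :> R := pi_gt0 R.
have e0 : 0 < Num.min (Num.min e1 e2) pi by rewrite !lt_min e10 e20.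
have [n hn] := archi_div (2 * pi) e0.
set t := 2 * pi / n.+1%:R in hn.
have t0 : 0 < t by rewrite divr_gt0 ?mulr_gt0 ?ltr0n.
move: hn; rewrite !lt_min => /andP[/andP[t1 t2] t3].
exists n, (cis t); split.
- rewrite -cisX -mulr_natr /t divfK ?pnatr_eq0 // mulrDl !mul1r /cis.
  by rewrite -mulr2n cos2pi sin2pi.
- exact: normc_cis.
- have s0 : 0 < sin t by apply: sin_gt0_pi; rewrite t0.
  by rewrite /cis eq_complex /= negb_and (gt_eqF s0) orbT.
- have nt : `|t| = t by rewrite ger0_norm // ltW.
  apply: le_lt_trans (normc_le _) _ => /=; rewrite subr0.
  have := H1 t; have := H2 t; rewrite nt cos0 sin0 subr0 => /(_ t2) ? /(_ t1) ?.
  by lra.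
Qed.

(** The discrete average of [dc f (p + s u^k) * u^k] over the [n]-th roots of
    unity is small, because the increments of [f] along the polygon with
    vertices [p + s u^k] add up to zero. *)
Lemma polygon_derivative f p (r0 r e d s : R) (u : C) n :
  (forall w w', r0 <= normc (w - p) <= r -> normc (w' - w) < d ->
    normc (f w' - f w - dc f w * (w' - w)) <= e * normc (w' - w)) ->
  u ^+ n = 1 -> normc u = 1 -> u != 1 -> 0 < s ->
  r0 <= s <= r -> s * normc (u - 1) < d ->
  normc (\sum_(k < n) dc f (p + s%:C * u ^+ k)%C * u ^+ k) <= n%:R * e.
Proof.
move=> unif un nu u1 s0 sr sd.
pose w k := (p + s%:C * u ^+ k)%C.
have nk k : normc (u ^+ k) = 1 by rewrite normcX nu expr1n.
have wS k : w k.+1 - w k = (s%:C * u ^+ k * (u - 1))%C by rewrite /w exprS; ring.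
have nw k : normc (w k.+1 - w k) = s * normc (u - 1).
  by rewrite wS !normcM nk normc_real ger0_norm ?(ltW s0) // mulr1.
have wA k : r0 <= normc (w k - p) <= r.
  have -> : w k - p = (s%:C * u ^+ k)%C by rewrite /w; ring.
  by rewrite normcM nk normc_real mulr1 ger0_norm // ltW.
have u10 : 0 < normc (u - 1) by rewrite normc_gt0 subr_eq0.
have tele : \sum_(k < n) (f (w k.+1) - f (w k)) = 0.
  rewrite -(big_mkord xpredT (fun k => f (w k.+1) - f (w k))) telescope_sumr //.
  by rewrite /w un expr0 subrr.
have key : (\sum_(k < n) dc f (w k) * u ^+ k) * (s%:C * (u - 1))%C =
    - \sum_(k < n) (f (w k.+1) - f (w k) - dc f (w k) * (w k.+1 - w k)).
  transitivity (\sum_(k < n) dc f (w k) * (w k.+1 - w k) -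
      \sum_(k < n) (f (w k.+1) - f (w k))); last first.
    by rewrite -sumrB -sumrN; apply: eq_bigr => k _; ring.
  rewrite tele subr0 mulr_suml; apply: eq_bigr => k _.
  by rewrite wS; ring.
have := congr1 (@normc R) key.
rewrite normcM normc_opp normcM normc_real (ger0_norm (ltW s0)) => keyn.
rewrite -(ler_pM2r (mulr_gt0 s0 u10)) keyn.
apply: le_trans (normc_sum _ _ _) _.
apply: (@le_trans _ _ (\sum_(k < n) e * (s * normc (u - 1)))).
  by apply: ler_sum => k _; rewrite -(nw k); apply: unif => //; rewrite nw.
by rewrite sum_ord_const mulrA.
Qed.

(** The mean value property, for a function that is holomorphic in a punctured
    disc and has a limit at the centre.  Averages over the vertices of regular
    polygons take the place of integrals over circles. *)
Lemma mean_value_bound f p L (r M : R) : 0 < r ->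
  (forall z, z != p -> normc (z - p) <= r -> holo f z) ->
  (forall e, 0 < e -> exists2 d, 0 < d &
     forall z, z != p -> normc (z - p) < d -> normc (f z - L) <= e) ->
  (forall z, normc (z - p) = r -> normc (f z) <= M) ->
  normc L <= M.
Proof.
move=> r0 hf fL fM; apply/ler_addgt0Pl => e e0.
pose e1 := e / (1 + 2 * r).
have k0 : 0 < 1 + 2 * r by rewrite ltr_wpDr // mulr_ge0 // ltW.
have e10 : 0 < e1 by rewrite divr_gt0.
have [d d0 Hd] := fL _ e10.
pose rho := Num.min d r / 2.
have m0 : 0 < Num.min d r by rewrite lt_min d0.
have rho0 : 0 < rho by rewrite divr_gt0.
have rhom : rho < Num.min d r by rewrite /rho; lra.
move: (rhom); rewrite lt_min => /andP[rhod rhor].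
have ann z : rho <= normc (z - p) <= r -> holo f z.
  move=> /andP[z1 z2]; apply: hf => //.
  by rewrite -subr_eq0 -normc_gt0; exact: lt_le_trans z1.
have [c c0 Hc] := sder_uniform ann e10.
have cr : 0 < c / r by rewrite divr_gt0.
have [n [u [un nu u1 uc]]] := near_root_of_unity cr.
pose A s := \sum_(k < n.+1) f (p + s%:C * u ^+ k)%C.
have nk k : normc (u ^+ k) = 1 by rewrite normcX nu expr1n.
have wp (s : R) k : 0 <= s -> normc ((p + s%:C * u ^+ k)%C - p) = s.
  move=> s0; have -> : (p + s%:C * u ^+ k - p = s%:C * u ^+ k)%C by ring.
  by rewrite normcM nk normc_real mulr1 ger0_norm.
pose N : R := n.+1%:R.
have N0 : 0 < N by rewrite /N ltr0n.
(* The average moves slowly with the radius, by [polygon_derivative]. *)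
have radial : normc (A r - A rho) <= (2 * N * e1) * (r - rho).
  apply: (lip_chain c0) => [|s s' rs ss' s'r sc]; first exact: ltW.
  have s0 : 0 < s by exact: lt_le_trans rs.
  have s's : 0 <= s' - s by rewrite subr_ge0.
  have s'0 : 0 < s' by exact: lt_le_trans ss'.
  have sr : s <= r by exact: le_trans s'r.
  have inc k : ((p + s'%:C * u ^+ k) - (p + s%:C * u ^+ k) = (s' - s)%:C * u ^+ k)%C.
    by rewrite rmorphB; ring.
  have ninc k : normc ((p + s'%:C * u ^+ k)%C - (p + s%:C * u ^+ k)%C) = s' - s.
    by rewrite inc normcM nk mulr1 normc_real ger0_norm.
  pose E (k : 'I_n.+1) := f (p + s'%:C * u ^+ k)%C - f (p + s%:C * u ^+ k)%C -
    dc f (p + s%:C * u ^+ k)%C * ((s' - s)%:C * u ^+ k)%C.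
  have -> : A s' - A s = \sum_k E k +
      (s' - s)%:C%C * \sum_(k < n.+1) dc f (p + s%:C * u ^+ k)%C * u ^+ k.
    by rewrite /A -sumrB mulr_sumr -big_split; apply: eq_bigr => k _ /=; rewrite /E; ring.
  apply: le_trans (normcD _ _) _; rewrite normcM normc_real ger0_norm //.
  have h1 : normc (\sum_k E k) <= N * e1 * (s' - s).
    apply: le_trans (normc_sum _ _ _) _.
    apply: (@le_trans _ _ (\sum_(k < n.+1) e1 * (s' - s))).
      apply: ler_sum => k _; rewrite /E.
      have := Hc (p + s%:C * u ^+ k)%C (p + s'%:C * u ^+ k)%C.
      by rewrite wp ?(ltW s0) // rs sr ninc inc => /(_ isT sc).
    by rewrite sum_ord_const mulrA.
  have h2 : normc (\sum_(k < n.+1) dc f (p + s%:C * u ^+ k)%C * u ^+ k) <= N * e1.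
    apply: (polygon_derivative Hc un nu u1 s0); first by rewrite rs.
    move: uc; rewrite ltr_pdivlMr // => uc; apply: le_lt_trans uc.
    by rewrite mulrC ler_wpM2l ?normc_ge0.
  have : (s' - s) * normc (\sum_(k < n.+1) dc f (p + s%:C * u ^+ k)%C * u ^+ k)
      <= (s' - s) * (N * e1) by rewrite ler_wpM2l.
  by lra.
have Ar : normc (A r) <= N * M.
  apply: le_trans (normc_sum _ _ _) _.
  apply: (@le_trans _ _ (\sum_(k < n.+1) M)).
    by apply: ler_sum => k _; apply: fM; rewrite wp // ltW.
  by rewrite sum_ord_const.
have AL : normc (A rho - N%:C%C * L) <= N * e1.
  have -> : N%:C%C * L = \sum_(k < n.+1) L.
    by rewrite sum_ord_const /N rmorph_nat.
  rewrite /A -sumrB; apply: le_trans (normc_sum _ _ _) _.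
  apply: (@le_trans _ _ (\sum_(k < n.+1) e1)).
    apply: ler_sum => k _; apply: Hd; last by rewrite wp // ltW.
    by rewrite -subr_eq0 -normc_gt0 wp // ltW.
  by rewrite sum_ord_const.
have NL : N * normc L <= N * (e + M).
  have -> : N * normc L = normc (N%:C%C * L).
    by rewrite normcM normc_real ger0_norm // ltW.
  have -> : N%:C%C * L = A r - (A r - A rho) - (A rho - N%:C%C * L) by ring.
  apply: le_trans (normcD _ _) _; rewrite normc_opp.
  apply: le_trans (lerD (normcD _ _) (lexx _)) _; rewrite normc_opp.
  have : 2 * N * e1 * (r - rho) <= 2 * N * e1 * r.
    apply: ler_wpM2l; first by apply: mulr_ge0 (ltW e10); exact: mulr_ge0 (ltW N0).
    by rewrite lerBlDr lerDl ltW.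
  have : N * e = N * e1 + 2 * N * e1 * r.
    by rewrite /e1; field; rewrite gt_eqF.
  by lra.
by rewrite ler_pM2l in NL.
Qed.

End MeanValue.

(** * Cauchy's estimate, Weierstrass' theorem, division and unique continuation *)

Section LocalTheory.
Context {R : realType}.
Local Notation C := R[i].
Implicit Types (f g : C -> C) (z w p l : C).

(** Cauchy's estimate is the mean value property of the difference quotient. *)
Lemma cauchy_estimate f p l (r M : R) : 0 < r ->
  (forall z, normc (z - p) <= r -> holo f z) ->
  (forall z, normc (z - p) <= r -> normc (f z) <= M) ->
  sder f p l -> normc l <= 2 * M / r.
Proof.
move=> r0 hf fM fl.
apply: (@mean_value_bound _ (fun z => (f z - f p) / (z - p)) p l r) => //.
- move=> z zp zr; apply: holoM.
    by apply: holoB; [exact: hf | exact: holo_cst].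
  apply: holoV; first by apply: holoB; [exact: holo_id | exact: holo_cst].
  by rewrite subr_eq0.
- move=> e e0; have [d d0 Hd] := fl _ e0; exists d => // z zp zd.
  have z0 : z - p != 0 by rewrite subr_eq0.
  have -> : (f z - f p) / (z - p) - l = (f z - f p - l * (z - p)) / (z - p).
    by field.
  rewrite normcM normcV ler_pdivrMr ?normc_gt0 //; apply: Hd => //.
  by rewrite subrr normc0.
- move=> z zr; rewrite normcM normcV zr ler_pM2r ?invr_gt0 //.
  apply: le_trans (normcD _ _) _; rewrite normc_opp mulr_natl mulr2n.
  by rewrite lerD ?fM ?zr // subrr normc0 ltW.
Qed.

Let gap n : R := n.+1%:R^-1.

Let gap_gt0 n : 0 < gap n. Proof. by rewrite invr_gt0 ltr0n. Qed.

Let gap_lt e : 0 < e -> exists n, gap n < e.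
Proof. by move=> /(archi_div 1)[n]; rewrite mul1r; exists n. Qed.

(** The limit is a supremum: [x n - K gap n <= x m + K gap m] for all [n], [m]. *)
Let complete_real (x : nat -> R) K :
  (forall n m, `|x n - x m| <= K * (gap n + gap m)) ->
  exists y, forall n, `|x n - y| <= K * gap n.
Proof.
move=> H; pose S := range (fun n => x n - K * gap n).
have ub n m : x n - K * gap n <= x m + K * gap m.
  by have := H n m; rewrite ler_norml => /andP[]; lra.
exists (sup S) => n; rewrite ler_norml; apply/andP; split.
  rewrite lerBrDr addrC lerBlDl addrC; apply: ge_sup.
    by exists (x 0%N - K * gap 0%N), 0%N.
  by move=> _ [m _ <-]; exact: ub.
rewrite lerBlDr -lerBlDl; apply: ub_le_sup; last by exists n.
by exists (x n + K * gap n) => _ [m _ <-]; exact: ub.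
Qed.

Let complete_complex (u : nat -> C) K :
  (forall n m, normc (u n - u m) <= K * (gap n + gap m)) ->
  exists l, forall n, normc (u n - l) <= 2 * K * gap n.
Proof.
move=> H.
have [|x Hx] := @complete_real (fun n => complex.Re (u n)) K.
  move=> n m; apply: le_trans (H n m); apply: le_trans (normcRe _).
  by case: (u n) (u m) => a b [a' b'].
have [|y Hy] := @complete_real (fun n => complex.Im (u n)) K.
  move=> n m; apply: le_trans (H n m); apply: le_trans (normcIm _).
  by case: (u n) (u m) => a b [a' b'].
exists (Complex x y) => n; apply: le_trans (normc_le _) _.
have := Hx n; have := Hy n; case: (u n) => a b /=; lra.
Qed.

(** Weierstrass: a uniform limit of holomorphic functions is holomorphic.  By
    Cauchy's estimate the differences of the approximations have small
    Lipschitz constants on a smaller disc, and strict differentiability passes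
    to limits in the Lipschitz seminorm. *)
Lemma holo_uniform_limit f p (r : R) : 0 < r ->
  (forall e, 0 < e -> exists g, forall z, normc (z - p) <= r ->
     holo g z /\ normc (f z - g z) <= e) ->
  holo f p.
Proof.
move=> r0 H.
have /choice[g Hg] : forall n, exists g, forall z, normc (z - p) <= r ->
     holo g z /\ normc (f z - g z) <= gap n by move=> n; exact: H (gap_gt0 n).
have r2 : 0 < r / 2 by rewrite divr_gt0.
have pr : normc (p - p) <= r by rewrite subrr normc0 ltW.
pose K := 4 / r.
have K0 : 0 < K by rewrite divr_gt0.
have diff n m z : normc (z - p) <= r -> normc (g n z - g m z) <= gap n + gap m.
  move=> zr; have -> : g n z - g m z = (f z - g m z) - (f z - g n z) by ring.
  apply: le_trans (normcD _ _) _; rewrite normc_opp addrC.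
  by rewrite lerD // (proj2 (Hg _ _ zr)).
have hdiff n m z : normc (z - p) <= r -> holo (fun z => g n z - g m z) z.
  by move=> zr; apply: holoB; exact: (proj1 (Hg _ _ zr)).
have ddiff n m z l : normc (z - p) <= r / 2 -> sder (fun z => g n z - g m z) z l ->
    normc l <= K * (gap n + gap m).
  move=> zr dl.
  have inr w : normc (w - z) <= r / 2 -> normc (w - p) <= r.
    by have := normc_triangle z w p; lra.
  apply: le_trans (cauchy_estimate (M := gap n + gap m) r2 _ _ dl) _.
  - by move=> w /inr; exact: hdiff.
  - by move=> w /inr; exact: diff.
  - by rewrite -subr_ge0 (_ : _ - _ = 0) // /K; field; rewrite gt_eqF.
have lip n m w w' : normc (w - p) <= r / 2 -> normc (w' - p) <= r / 2 ->
    normc ((g n w' - g m w') - (g n w - g m w)) <= K * (gap n + gap m) * normc (w' - w).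
  apply: (@holo_lipschitz _ (fun z => g n z - g m z) p (r / 2)) => z zr.
  have hz : holo (fun z => g n z - g m z) z by apply: hdiff; lra.
  by split => //; exact: ddiff zr (dcP hz).
(* The derivatives of the approximations at [p] form a Cauchy sequence. *)
have [|l Hl] := @complete_complex (fun n => dc (g n) p) K.
  move=> n m; apply: (@ddiff _ _ p); first by rewrite subrr normc0 ltW.
  have := sderD (dcP (proj1 (Hg n _ pr)))
    (sderM (sder_cst (-1) p) (dcP (proj1 (Hg m _ pr)))).
  rewrite mul0r add0r mulN1r; apply: (@sder_near _ _ _ _ _ 1) => // w _.
  by rewrite mulN1r.
have flip n w w' : normc (w - p) <= r / 2 -> normc (w' - p) <= r / 2 ->
    normc ((f w' - g n w') - (f w - g n w)) <= K * gap n * normc (w' - w).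
  move=> wr w'r; apply/ler_addgt0Pl => e e0.
  have k0 : 0 < K * normc (w' - w) + 2 by rewrite ltr_wpDl // mulr_ge0 ?normc_ge0 // ltW.
  have [m hm] := gap_lt (divr_gt0 e0 k0).
  have -> : (f w' - g n w') - (f w - g n w) =
      - ((g n w' - g m w') - (g n w - g m w)) + ((f w' - g m w') - (f w - g m w)) by ring.
  apply: le_trans (normcD _ _) _; rewrite normc_opp.
  have A := lip n m _ _ wr w'r.
  have B : normc ((f w' - g m w') - (f w - g m w)) <= gap m + gap m.
    apply: le_trans (normcD _ _) _; rewrite normc_opp lerD //.
      by apply: (proj2 (Hg _ _ _)); lra.
    by apply: (proj2 (Hg _ _ _)); lra.
  by move: hm; rewrite ltr_pdivlMr //; lra.
exists l; apply: (@sder_scale _ _ _ _ 2) => // e e0 _.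
have k0 : 0 < 3 * K by rewrite mulr_gt0.
have [n hn] := gap_lt (divr_gt0 e0 k0).
move: hn; rewrite ltr_pdivlMr // => hn.
have [d d0 Hd] := dcP (proj1 (Hg n _ pr)) e0.
exists (Num.min d (r / 2)); first by rewrite lt_min d0.
move=> w w'; rewrite !lt_min => /andP[wd wr] /andP[w'd w'r].
have -> : f w' - f w - l * (w' - w) =
  (g n w' - g n w - dc (g n) p * (w' - w)) + (((f w' - g n w') - (f w - g n w))
  + (dc (g n) p - l) * (w' - w)) by ring.
apply: le_trans (normcD _ _) _.
have -> : 2 * e * normc (w' - w) = e * normc (w' - w) + e * normc (w' - w) by ring.
rewrite lerD ?Hd //.
apply: le_trans (normcD _ _) _; rewrite normcM.
have A := flip n w w' (ltW wr) (ltW w'r).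
have B : normc (dc (g n) p - l) * normc (w' - w) <= 2 * K * gap n * normc (w' - w).
  by rewrite ler_wpM2r ?normc_ge0.
have : (3 * K * gap n) * normc (w' - w) <= e * normc (w' - w).
  by rewrite ler_wpM2r ?normc_ge0 //; lra.
by lra.
Qed.

(** The derivative is the uniform limit of the difference quotients with a
    fixed small step. *)
Lemma holo_dc f p (r : R) : 0 < r ->
  (forall z, normc (z - p) <= r -> holo f z) -> holo (dc f) p.
Proof.
move=> r0 hf; have r2 : 0 < r / 2 by rewrite divr_gt0.
apply: (holo_uniform_limit r2) => e e0.
have [|d d0 Hd] := @sder_uniform _ f p (-1) r _ _ e0.
  by move=> z /andP[_]; exact: hf.
pose t := Num.min d (r / 2) / 2.
have m0 : 0 < Num.min d (r / 2) by rewrite lt_min d0.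
have t0 : 0 < t by rewrite divr_gt0.
have : t < Num.min d (r / 2) by rewrite /t; lra.
rewrite lt_min => /andP[td tr].
have nt : normc (t%:C)%C = t by rewrite normc_real ger0_norm // ltW.
have tC : (t%:C)%C != 0 :> C by rewrite -normc_gt0 nt.
exists (fun z => (f (z + t%:C)%C - f z) / (t%:C)%C) => z zr; split.
  apply: holoM; last exact: holo_cst.
  apply: holoB; last by apply: hf; lra.
  apply: (@holo_comp _ (fun z => z + t%:C)%C).
    by apply: holoD; [exact: holo_id | exact: holo_cst].
  apply: hf; have := normc_triangle z (z + t%:C)%C p.
  by rewrite [(z + _)%C - z]addrC addKr nt; lra.
have := Hd z (z + t%:C)%C; rewrite [(z + _)%C - z]addrC addKr nt.
have -> : -1 <= normc (z - p) <= r.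
  by rewrite (le_trans _ (normc_ge0 _)) ?lerN10 //=; lra.
move=> /(_ isT td) h.
have -> : dc f z - (f (z + t%:C)%C - f z) / (t%:C)%C =
    - ((f (z + t%:C)%C - f z - dc f z * (t%:C)%C) / (t%:C)%C) by field.
by rewrite normc_opp normcM normcV nt ler_pdivrMr.
Qed.

(** The difference quotient extends holomorphically: it is the mean of the
    derivative along the segment from [p], a uniform limit of finite means. *)
Lemma holo_quotient f p (r : R) : 0 < r ->
  (forall z, normc (z - p) <= r -> holo f z) ->
  exists2 k : C -> C, holo k p &
    forall z, f z - f p = (z - p) * k z /\ (z != p -> k z = (f z - f p) / (z - p)).
Proof.
move=> r0 hf; have r2 : 0 < r / 2 by rewrite divr_gt0.
pose k z := if z == p then dc f p else (f z - f p) / (z - p).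
exists k; last first.
  move=> z; rewrite /k; case: eqVneq => [->|zp]; first by rewrite !subrr mul0r.
  by split=> //; rewrite mulrC divfK // subr_eq0.
apply: (holo_uniform_limit r2) => e e0.
have [|d d0 Hd] := @sder_uniform _ f p (-1) r _ _ e0.
  by move=> z /andP[_]; exact: hf.
have [n hn] := archi_div r d0.
pose N : R := n.+1%:R.
have N0 : 0 < N by rewrite /N ltr0n.
have NC : (N%:C)%C != 0 :> C by rewrite -normc_gt0 normc_real ger0_norm // ltW.
pose w z (j : nat) := p + ((j%:R / N)%:C)%C * (z - p).
have wp z (j : nat) : (j <= n.+1)%N -> normc (w z j - p) <= normc (z - p).
  move=> jn; rewrite /w addrC addKr normcM normc_real ger0_norm.
    by rewrite ler_piMl ?normc_ge0 // ler_pdivrMr // mul1r ler_nat.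
  by rewrite divr_ge0 // ltW.
have wS z j : w z j.+1 - w z j = (z - p) / (N%:C)%C.
  have Ninv : ((N^-1)%:C)%C = ((N%:C)%C)^-1 by rewrite -fmorphV.
  rewrite /w -(natr1 j) mulrDl mul1r rmorphD /= Ninv; ring.
exists (fun z => (\sum_(j < n.+1) dc f (w z j)) / (N%:C)%C) => z zr; split.
  apply: holoM; last exact: holo_cst.
  have hj (j : 'I_n.+1) : holo (fun y => dc f (w y j)) z.
    apply: (@holo_comp _ (fun y => w y j)).
      apply: holoD; first exact: holo_cst.
      apply: holoM; first exact: holo_cst.
      by apply: holoB; [exact: holo_id | exact: holo_cst].
    apply: (holo_dc r2) => y yr; apply: hf.
    have := normc_triangle (w z j) y p; have := wp z j (ltnW (ltn_ord j)); lra.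
  elim: (index_enum _) => [|j s IH].
    apply: (@holo_near _ (fun=> 0) _ _ 1) => //; last exact: holo_cst.
    by move=> y _; rewrite big_nil.
  apply: (@holo_near _ (fun y => dc f (w y j) + \sum_(i <- s) dc f (w y i)) _ _ 1) => //.
    by move=> y _; rewrite big_cons.
  by apply: holoD => //; exact: hj.
rewrite /k; case: eqVneq => [->|zp].
  have -> : \sum_(j < n.+1) dc f (w p j) = \sum_(j < n.+1) dc f p.
    by apply: eq_bigr => j _; rewrite /w subrr mulr0 addr0.
  rewrite sum_ord_const; have -> : n.+1%:R = (N%:C)%C :> C by rewrite rmorph_nat.
  by rewrite mulrAC divff // mul1r subrr normc0 ltW.
have z0 : z - p != 0 by rewrite subr_eq0.
have -> : f z - f p = \sum_(j < n.+1) (f (w z j.+1) - f (w z j)).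
  rewrite -(big_mkord xpredT (fun j => f (w z j.+1) - f (w z j))) telescope_sumr //.
  by rewrite /w !mul0r addr0 divff ?gt_eqF // mul1r (addrC p) subrK.
have -> : (\sum_(j < n.+1) (f (w z j.+1) - f (w z j))) / (z - p) -
    (\sum_(j < n.+1) dc f (w z j)) / (N%:C)%C =
    (\sum_(j < n.+1) (f (w z j.+1) - f (w z j) - dc f (w z j) * (w z j.+1 - w z j)))
    / (z - p).
  rewrite [in RHS]sumrB mulrBl; congr (_ - _); rewrite !mulr_suml.
  by apply: eq_bigr => j _; rewrite wS -mulrA [_ / _ / _]mulrAC divff // mul1r.
rewrite normcM normcV ler_pdivrMr ?normc_gt0 //.
apply: le_trans (normc_sum _ _ _) _.
apply: (@le_trans _ _ (\sum_(j < n.+1) e * (normc (z - p) / N))).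
  apply: ler_sum => j _.
  have nS : normc (w z j.+1 - w z j) = normc (z - p) / N.
    by rewrite wS normcM normcV normc_real ger0_norm // ltW.
  rewrite -nS; apply: Hd.
    rewrite (le_trans _ (normc_ge0 _)) ?lerN10 //=.
    by have := wp z j (ltnW (ltn_ord j)); lra.
  rewrite nS; apply: le_lt_trans hn; rewrite ler_pM2r ?invr_gt0 //; lra.
rewrite sum_ord_const -/N -subr_ge0 (_ : _ - _ = 0) //.
by field; rewrite gt_eqF.
Qed.

Definition copen (D : set C) := forall z, D z -> exists2 d, 0 < d &
  forall w, normc (w - z) < d -> D w.

Lemma copen_disc (D : set C) z : copen D -> D z -> exists2 r, 0 < r &
  forall w, normc (w - z) <= r -> D w.
Proof.
move=> Do /Do[d d0 Hd]; exists (d / 2); first by rewrite divr_gt0.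
by move=> w wd; apply: Hd; lra.
Qed.

Lemma holo_divide (D : set C) f p : copen D -> D p ->
  (forall z, D z -> holo f z) -> f p = 0 ->
  exists2 g, (forall z, D z -> holo g z) & forall z, f z = (z - p) * g z.
Proof.
move=> Do Dp hf fp; have [r r0 Hr] := copen_disc Do Dp.
have [|k hk Hk] := @holo_quotient f p r r0; first by move=> z /Hr /hf.
exists k; last by move=> z; rewrite -(proj1 (Hk z)) fp subr0.
move=> z Dz; have [->//|zp] := eqVneq z p.
apply: (@holo_near _ (fun y => (f y - f p) / (y - p)) _ _ (normc (z - p))).
- by rewrite normc_gt0 subr_eq0.
- move=> y yz; rewrite (proj2 (Hk y)) //; apply: contraTneq yz => ->.
  by rewrite normcB ltxx.
- apply: holoM; first by apply: holoB; [exact: hf | exact: holo_cst].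
  apply: holoV; last by rewrite subr_eq0.
  by apply: holoB; [exact: holo_id | exact: holo_cst].
Qed.

Definition near_zero f z := exists2 d, 0 < d &
  forall w, normc (w - z) < d -> f w = 0.

(** Where [f] vanishes near [z0], every [f / (z - z0)^n] is holomorphic, and
    the mean value property on a circle around [p] that stays at distance
    [3 |p - z0|] from [z0] gives [|f p| <= M / 3^n]. *)
Lemma near_zero_spread f p z0 (r : R) : 0 < r ->
  (forall z, normc (z - p) <= r -> holo f z) ->
  near_zero f z0 -> normc (z0 - p) <= r / 4 -> f p = 0.
Proof.
move=> r0 hf [d d0 Hd] z0r.
have [->|pz0] := eqVneq p z0; first by apply: Hd; rewrite subrr normc0.
set s := normc (z0 - p) in z0r.
have s0 : 0 < s by rewrite normc_gt0 subr_eq0 eq_sym.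
have [|M M0 HM] := @holo_bounded _ f p (-1) r.
  by move=> z /andP[_]; exact: hf.
have bound n : normc (f p / (p - z0) ^+ n) <= M / (3 * s) ^+ n.
  apply: (@mean_value_bound _ (fun z => f z / (z - z0) ^+ n) p _ r) => //.
  - move=> z zp zr; have [zz0|zz0] := eqVneq z z0.
      apply: (@holo_near _ (fun=> 0) _ _ d) => //; last exact: holo_cst.
      by move=> w; rewrite zz0 => /Hd ->; rewrite mul0r.
    apply: holoM; first exact: hf.
    apply: holoV; last by rewrite expf_neq0 // subr_eq0.
    by apply: holoX; apply: holoB; [exact: holo_id | exact: holo_cst].
  - have hp : holo (fun z => f z / (z - z0) ^+ n) p.
      apply: holoM; first by apply: hf; rewrite subrr normc0 ltW.
      apply: holoV; last by rewrite expf_neq0 // subr_eq0.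
      by apply: holoX; apply: holoB; [exact: holo_id | exact: holo_cst].
    move=> e e0; have [c c0 Hc] := holo_cont hp e0.
    by exists c => // z _ /Hc/ltW.
  - move=> z zr; rewrite normcM normcV normcX.
    have far : 3 * s <= normc (z - z0).
      by have := normc_triangle z0 z p; rewrite zr -/s; lra.
    apply: ler_pM; rewrite ?normc_ge0 ?invr_ge0 ?exprn_ge0 ?normc_ge0 //.
      by apply: HM; rewrite zr lexx andbT; lra.
    rewrite lef_pV2 ?posrE ?exprn_gt0 ?mulr_gt0 //.
      by rewrite lerXn2r // nnegrE ?normc_ge0 // mulr_ge0 // ltW.
    by apply: lt_le_trans far; rewrite mulr_gt0.
have small n : normc (f p) <= M / n.+1%:R.
  have := bound n; rewrite normcM normcV normcX (normcB p) -/s exprMn invfM mulrA.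
  rewrite ler_pM2r ?invr_gt0 ?exprn_gt0 // => /le_trans; apply.
  rewrite ler_pM2l // lef_pV2 ?posrE ?exprn_gt0 ?ltr0n // -natrX ler_nat.
  exact: (ltn_expl n (isT : (1 < 3)%N)).
apply: normc_le0 => e e0; have [n hn] := archi_div M e0.
by apply: le_trans (small n) _; exact: ltW.
Qed.

End LocalTheory.

(** * Cauchy-Riemann equations *)

Section QuaternionCoordinates.
Context {R : realType}.
Implicit Types (p q : quat R).

Lemma quat_sqnorm q : `|q| ^+ 2 = qnorm2 q.
Proof. by rewrite /Num.norm /= sqr_sqrtr ?qnorm2_ge0. Qed.

Let coord_le (x : R) q : x ^+ 2 <= qnorm2 q -> `|x| <= `|q|.
Proof.
move=> h; rewrite -(@ler_pXn2r _ 2) ?nnegrE // quat_sqnorm.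
by rewrite real_normK ?num_real.
Qed.

Lemma qre_le q : `|qre q| <= `|q|.
Proof. by apply: coord_le; rewrite /qnorm2 -!addrA lerDl !addr_ge0 ?sqr_ge0. Qed.

Lemma qi_le q : `|qi q| <= `|q|.
Proof.
apply: coord_le; rewrite /qnorm2 (addrC (qre q ^+ 2)) -!addrA lerDl.
by rewrite !addr_ge0 ?sqr_ge0.
Qed.

Lemma qj_le q : `|qj q| <= `|q|.
Proof.
apply: coord_le; rewrite /qnorm2 (addrC _ (qj q ^+ 2)) -!addrA lerDl.
by rewrite !addr_ge0 ?sqr_ge0.
Qed.

Lemma qk_le q : `|qk q| <= `|q|.
Proof. by apply: coord_le; rewrite /qnorm2 lerDr !addr_ge0 ?sqr_ge0. Qed.

Lemma quat_coordE q :
  q = qre q *: 1 + qi q *: Qi + qj q *: Qj + qk q *: Qk.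
Proof. by apply: quat_ext => /=; ring. Qed.

Definition coordinate (L : quat R -> R) :=
  [/\ forall p q, L (p - q) = L p - L q, forall a q, L (a *: q) = a * L q &
      forall q, `|L q| <= `|q|].

Lemma coordinate_qre : coordinate qre. Proof. by split=> //; exact: qre_le. Qed.
Lemma coordinate_qi : coordinate qi. Proof. by split=> //; exact: qi_le. Qed.
Lemma coordinate_qj : coordinate qj. Proof. by split=> //; exact: qj_le. Qed.
Lemma coordinate_qk : coordinate qk. Proof. by split=> //; exact: qk_le. Qed.

Lemma cvg_coordinate (T : Type) (F : set_system T) {FF : Filter F}
    (g : T -> quat R) (l : quat R) L :
  coordinate L -> g @ F --> l -> L \o g @ F --> L l.
Proof.
move=> [LB _ Ln] /cvgrPdist_le gl; apply/cvgrPdist_le => e e0.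
by near=> t; rewrite /= -LB (le_trans (Ln _)) //; near: t; exact: gl.
Unshelve. all: by end_near. Qed.

Lemma cvg_quat (T : Type) (F : set_system T) {FF : Filter F}
    (a b c d : T -> R) (a' b' c' d' : R) :
  a @ F --> a' -> b @ F --> b' -> c @ F --> c' -> d @ F --> d' ->
  (fun t => Quat (a t) (b t) (c t) (d t)) @ F --> Quat a' b' c' d'.
Proof.
move=> ha hb hc hd.
rewrite [X in _ --> X]quat_coordE /=.
rewrite (_ : (fun t => _) = (fun t => a t *: 1 + b t *: Qi + c t *: Qj + d t *: Qk)); last first.
  by apply/funext => t; rewrite [LHS]quat_coordE.
by do 3?[apply: cvgD]; apply: cvgZr_tmp.
Qed.

End QuaternionCoordinates.

Section PartialDerivatives.
Context {R : realType}.
Local Notation C := R[i].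
Implicit Types (z w : C) (x : R * R).

Definition pair_of z : R * R := (complex.Re z, complex.Im z).

Lemma cplxK : cancel cplx pair_of. Proof. by case. Qed.
Lemma pair_ofK : cancel pair_of cplx. Proof. by case. Qed.

Lemma nbhs_cplx x (P : set (R * R)) :
  nbhs x P <-> exists2 d, 0 < d & forall y, normc (cplx y - cplx x) < d -> P y.
Proof.
split.
  move=> /nbhs_ballP[e e0 He]; exists e => // y yx; apply: He.
  case: x y yx => [a b] [a' b'] /= h; split => /=.
    rewrite /ball /= distrC; apply: le_lt_trans h.
    exact: (normcRe (Complex (a' - a) (b' - b))).
  rewrite /ball /= distrC; apply: le_lt_trans h.
  exact: (normcIm (Complex (a' - a) (b' - b))).
move=> [d d0 Hd]; apply/nbhs_ballP; exists (d / 2) => /=; first by rewrite divr_gt0.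
move=> y [/= b1 b2]; apply: Hd; apply: le_lt_trans (normc_le _) _ => /=.
by move: b1 b2; rewrite /ball /= (distrC x.1) (distrC x.2); lra.
Qed.

Lemma mvt_disc (g dg : R -> R) (x0 d a b : R) :
  (forall t, `|t - x0| < d -> is_derive t 1 g (dg t)) ->
  `|a - x0| < d -> `|b - x0| < d ->
  exists2 c, `|c - x0| < d & g b - g a = dg c * (b - a).
Proof.
wlog ab : a b / a <= b => [hw hg ad bd|hg ad bd].
  have [ab|/ltW ba] := leP a b; first exact: hw.
  have [c cd E] := hw b a ba hg bd ad; exists c => //.
  by rewrite -opprB E; ring.
have inD t : t \in `[a, b] -> `|t - x0| < d.
  rewrite in_itv /= => /andP[h1 h2]; move: ad bd; rewrite !ltr_norml.
  by move=> /andP[? ?] /andP[? ?]; apply/andP; split; lra.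
have [||c cab E] := @MVT_segment _ g dg a b ab.
- move=> t tab; apply: hg; apply: inD.
  by move: tab; rewrite !in_itv /= => /andP[/ltW -> /ltW ->].
- apply: derivable_within_continuous => t tab.
  by have [] := hg t (inD t tab).
by exists c => //; exact: inD.
Qed.

(** The increment is split along a horizontal and a vertical segment, and the
    mean value theorem applies to each; the points it provides stay close to
    [z], where the partial derivatives are continuous. *)
Lemma partials_strict (P Pa Pb : R * R -> R) z (d0 : R) : 0 < d0 ->
  (forall w, normc (w - z) < d0 ->
     is_derive (pair_of w) (dir_alpha : R * R) P (Pa (pair_of w)) /\
     is_derive (pair_of w) (dir_beta : R * R) P (Pb (pair_of w))) ->
  {for pair_of z, continuous Pa} -> {for pair_of z, continuous Pb} ->
  forall e, 0 < e -> exists2 d, 0 < d &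
  forall w w', normc (w - z) < d -> normc (w' - z) < d ->
   `|P (pair_of w') - P (pair_of w) - Pa (pair_of z) * complex.Re (w' - w)
     - Pb (pair_of z) * complex.Im (w' - w)| <= e * normc (w' - w).
Proof.
move=> d00 HP ca cb e e0; have e2 : 0 < e / 2 by rewrite divr_gt0.
have [d1 d10 H1] : exists2 d, 0 < d & forall y, normc (cplx y - z) < d ->
    `|Pa (pair_of z) - Pa y| < e / 2.
  by have /cvgrPdist_lt/(_ _ e2)/nbhs_cplx := ca; rewrite pair_ofK.
have [d2 d20 H2] : exists2 d, 0 < d & forall y, normc (cplx y - z) < d ->
    `|Pb (pair_of z) - Pb y| < e / 2.
  by have /cvgrPdist_lt/(_ _ e2)/nbhs_cplx := cb; rewrite pair_ofK.
pose m := Num.min d0 (Num.min d1 d2).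
have m0 : 0 < m by rewrite !lt_min d00 d10 d20.
have m2 : 0 < m / 2 by rewrite divr_gt0.
exists (m / 2) => //.
case: z HP ca cb H1 H2 => x0 y0 HP ca cb H1 H2 [x y] [x' y'] wd w'd.
have box (s t : R) : `|s - x0| < m / 2 -> `|t - y0| < m / 2 ->
    normc (cplx (s, t) - Complex x0 y0) < m.
  move=> hs ht; apply: le_lt_trans (normc_le _) _ => /=; lra.
have xd : `|x - x0| < m / 2 := le_lt_trans (normcRe (Complex (x - x0) (y - y0))) wd.
have yd : `|y - y0| < m / 2 := le_lt_trans (normcIm (Complex (x - x0) (y - y0))) wd.
have x'd : `|x' - x0| < m / 2 := le_lt_trans (normcRe (Complex (x' - x0) (y' - y0))) w'd.
have y'd : `|y' - y0| < m / 2 := le_lt_trans (normcIm (Complex (x' - x0) (y' - y0))) w'd.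
have md0 (w : C) : normc (w - Complex x0 y0) < m -> normc (w - Complex x0 y0) < d0.
  by rewrite !lt_min => /andP[].
have hx t : `|t - x0| < m / 2 -> is_derive t 1 (fun s => P (s, y')) (Pa (t, y')).
  move=> ht; have [[dP eP] _] := HP (cplx (t, y')) (md0 _ (box _ _ ht y'd)).
  have E : (fun h : R => h^-1 *: (P (h *: (1 : R) + t, y') - P (t, y'))) =
     (fun h : R => h^-1 *: (P (h *: (dir_alpha : R * R) + (t, y')) - P (t, y'))).
    apply/funext => h; congr (_ *: (P _ - _)).
    by rewrite /dir_alpha; congr (_, _) => /=; rewrite ?scaler0 ?mulr0 add0r.
  split.
    by rewrite /derivable E; exact: dP.
  by rewrite -eP /derive E.
have hy t : `|t - y0| < m / 2 -> is_derive t 1 (fun s => P (x, s)) (Pb (x, t)).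
  move=> ht; have [_ [dP eP]] := HP (cplx (x, t)) (md0 _ (box _ _ xd ht)).
  have E : (fun h : R => h^-1 *: (P (x, h *: (1 : R) + t) - P (x, t))) =
     (fun h : R => h^-1 *: (P (h *: (dir_beta : R * R) + (x, t)) - P (x, t))).
    apply/funext => h; congr (_ *: (P _ - _)).
    by rewrite /dir_beta; congr (_, _) => /=; rewrite ?scaler0 ?mulr0 add0r.
  split.
    by rewrite /derivable E; exact: dP.
  by rewrite -eP /derive E.
have [c cd Ec] := mvt_disc hx xd x'd.
have [c' c'd Ec'] := mvt_disc hy yd y'd.
rewrite /pair_of /=.
have -> : P (x', y') - P (x, y) - Pa (x0, y0) * (x' - x) - Pb (x0, y0) * (y' - y) =
   - (Pa (x0, y0) - Pa (c, y')) * (x' - x) - (Pb (x0, y0) - Pb (x, c')) * (y' - y).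
  have -> : P (x', y') - P (x, y) =
    (P (x', y') - P (x, y')) + (P (x, y') - P (x, y)) by ring.
  by rewrite Ec Ec'; ring.
have h1 : `|Pa (x0, y0) - Pa (c, y')| <= e / 2.
  apply/ltW/H1; have := box _ _ cd y'd; rewrite !lt_min => /and3P[]; by [].
have h2 : `|Pb (x0, y0) - Pb (x, c')| <= e / 2.
  apply/ltW/H2; have := box _ _ xd c'd; rewrite !lt_min => /and3P[]; by [].
apply: le_trans (ler_normB _ _) _; rewrite !normrM normrN.
have n1 := normcRe (Complex x' y' - Complex x y).
have n2 := normcIm (Complex x' y' - Complex x y).
have -> : e * normc (Complex x' y' - Complex x y) =
  e / 2 * normc (Complex x' y' - Complex x y) + e / 2 * normc (Complex x' y' - Complex x y).
  by field.
by rewrite lerD // ler_pM.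
Qed.

Lemma cauchy_riemann_sder (P Q Pa Pb : R * R -> R) z (d0 : R) : 0 < d0 ->
  (forall w, normc (w - z) < d0 ->
     [/\ is_derive (pair_of w) (dir_alpha : R * R) P (Pa (pair_of w)),
     is_derive (pair_of w) (dir_beta : R * R) P (Pb (pair_of w)),
     is_derive (pair_of w) (dir_alpha : R * R) Q (- Pb (pair_of w)) &
     is_derive (pair_of w) (dir_beta : R * R) Q (Pa (pair_of w))]) ->
  {for pair_of z, continuous Pa} -> {for pair_of z, continuous Pb} ->
  sder (fun w => Complex (P (pair_of w)) (Q (pair_of w))) z
    (Complex (Pa (pair_of z)) (- Pb (pair_of z))).
Proof.
move=> d00 H ca cb.
have cNb : {for pair_of z, continuous (fun x => - Pb x)} by apply: cvgN.
apply: (@sder_scale _ _ _ _ 2) => // e e0 _.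
have [|d d_gt0 Hd] := @partials_strict P Pa Pb _ _ d00 _ ca cb _ e0.
  by move=> w /H[].
have [|d' d'0 Hd'] := @partials_strict Q (fun x => - Pb x) Pa _ _ d00 _ cNb ca _ e0.
  by move=> w /H[].
exists (Num.min d d'); first by rewrite lt_min d_gt0.
move=> w w'; rewrite !lt_min => /andP[w1 w2] /andP[w'1 w'2].
have := Hd _ _ w1 w'1; have := Hd' _ _ w2 w'2.
move: (w' - w) => t h1 h2; apply: le_trans (normc_le _) _.
have -> : 2 * e * normc t = e * normc t + e * normc t by ring.
apply: lerD.
  apply: le_trans h2; rewrite le_eqVlt; apply/orP; left; apply/eqP; congr `|_|.
  by case: t {h1} => h k /=; ring.
apply: le_trans h1; rewrite le_eqVlt; apply/orP; left; apply/eqP; congr `|_|.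
by case: t {h2} => h k /=; ring.
Qed.

Lemma ReB (a b : C) : complex.Re (a - b) = complex.Re a - complex.Re b.
Proof. by case: a b => ? ? []. Qed.
Lemma ImB (a b : C) : complex.Im (a - b) = complex.Im a - complex.Im b.
Proof. by case: a b => ? ? []. Qed.
Lemma ReZ (c : R) (a : C) : complex.Re (c%:C * a)%C = c * complex.Re a.
Proof. by case: a => a b; simpc. Qed.
Lemma ImZ (c : R) (a : C) : complex.Im (c%:C * a)%C = c * complex.Im a.
Proof. by case: a => a b; simpc. Qed.

Lemma sder_direction (f : C -> C) z v l (L : C -> R) :
  (forall a b, L (a - b) = L a - L b) ->
  (forall (c : R) a, L (c%:C * a)%C = c * L a) -> (forall a, `|L a| <= normc a) ->
  sder f z l ->
  (fun h : R => h^-1 * (L (f (z + h%:C * v)%C) - L (f z))) @ 0^' --> L (l * v).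
Proof.
move=> LB LZ Ln fl; apply/cvgrPdist_le => e e0.
have k0 : 0 < normc v + 1 by rewrite ltr_wpDl ?normc_ge0.
have [d d0 Hd] := fl _ (divr_gt0 e0 k0).
have dk0 : 0 < d / (normc v + 1) by rewrite divr_gt0.
have hb : \forall h \near (0 : R)^', `|h| < d / (normc v + 1) by exact: dnbhs0_lt.
have hn : \forall h \near (0 : R)^', h != 0 by exact: nbhs_dnbhs_neq.
near=> h.
have h0 : h != 0 by near: h.
have hd : `|h| < d / (normc v + 1) by near: h.
have step : (z + h%:C * v - z = h%:C * v)%C by ring.
have nstep : normc ((z + h%:C * v)%C - z) = `|h| * normc v.
  by rewrite step normcM normc_real.
have sd : normc ((z + h%:C * v)%C - z) < d.
  rewrite nstep; move: hd; rewrite ltr_pdivlMr // mulrDr mulr1.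
  by apply: le_lt_trans; rewrite lerDl.
have := Hd z (z + h%:C * v)%C; rewrite subrr normc0 => /(_ d0 sd).
rewrite nstep step => est.
have -> : L (l * v) - h^-1 * (L (f (z + h%:C * v)%C) - L (f z)) =
  - (h^-1 * L (f (z + h%:C * v)%C - f z - l * (h%:C * v))%C).
  rewrite !LB (_ : (l * (h%:C * v) = h%:C * (l * v))%C); last by ring.
  by rewrite LZ; field.
rewrite normrN normrM normfV ler_pdivrMl ?normr_gt0 //.
apply: le_trans (Ln _) _; apply: le_trans est _.
rewrite mulrAC ler_pdivrMr // (mulrC e) -!mulrA ler_wpM2l //.
by rewrite mulrC ler_wpM2l ?(ltW e0) // lerDl.
Unshelve. all: by end_near. Qed.

Lemma sder_partials (f : C -> C) x l : sder f (cplx x) l ->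
  [/\ is_derive x (dir_alpha : R * R) (fun y => complex.Re (f (cplx y))) (complex.Re l),
      is_derive x (dir_beta : R * R) (fun y => complex.Re (f (cplx y))) (- complex.Im l),
      is_derive x (dir_alpha : R * R) (fun y => complex.Im (f (cplx y))) (complex.Im l) &
      is_derive x (dir_beta : R * R) (fun y => complex.Im (f (cplx y))) (complex.Re l)].
Proof.
move=> fl.
have gen (L : C -> R) (v : R * R) : (forall a b, L (a - b) = L a - L b) ->
    (forall (c : R) a, L (c%:C * a)%C = c * L a) -> (forall a, `|L a| <= normc a) ->
    is_derive x v (fun y => L (f (cplx y))) (L (l * cplx v)).
  move=> LB LZ Ln.
  have lim := sder_direction (v := cplx v) LB LZ Ln fl.
  have E : (fun h : R => h^-1 *: (L (f (cplx (h *: v + x))) - L (f (cplx x)))) =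
      (fun h : R => h^-1 * (L (f (cplx x + h%:C * cplx v)%C) - L (f (cplx x)))).
    apply/funext => h; congr (_ * (L (f _) - _)).
    have e1 : (h *: v + x).1 = h * v.1 + x.1 by [].
    have e2 : (h *: v + x).2 = h * v.2 + x.2 by [].
    by rewrite /cplx e1 e2; simpc; congr Complex; rewrite addrC.
  split; first by rewrite /derivable E; apply/cvg_ex; exists (L (l * cplx v)); exact: lim.
  by rewrite /derive E; apply: cvg_lim => //; exact: lim.
have g1 := gen _ dir_alpha ReB ReZ normcRe.
have g2 := gen _ dir_beta ReB ReZ normcRe.
have g3 := gen _ dir_alpha ImB ImZ normcIm.
have g4 := gen _ dir_beta ImB ImZ normcIm.
have l1 : l * cplx dir_alpha = l by exact: mulr1.
have l2 : l * cplx dir_beta = Complex (- complex.Im l) (complex.Re l).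
  by rewrite /cplx /=; case: (l) => a b; simpc.
by rewrite l1 l2 in g1 g2 g3 g4.
Qed.

Lemma sder_line (f : C -> C) (t : R) v l (L : C -> R) :
  (forall a b, L (a - b) = L a - L b) ->
  (forall (c : R) a, L (c%:C * a)%C = c * L a) -> (forall a, `|L a| <= normc a) ->
  sder f (t%:C * v)%C l ->
  is_derive t 1 (fun s : R => L (f (s%:C * v)%C)) (L (l * v)).
Proof.
move=> LB LZ Ln fl; have lim := sder_direction (v := v) LB LZ Ln fl.
have E : (fun h : R => h^-1 *: (L (f ((h *: (1 : R) + t)%:C * v)%C) - L (f (t%:C * v)%C))) =
    (fun h : R => h^-1 * (L (f (t%:C * v + h%:C * v)%C) - L (f (t%:C * v)%C))).
  apply/funext => h; congr (_ * (L (f _) - _)).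
  by rewrite [_ *: _]mulr1 rmorphD /= mulrDl addrC.
split; first by rewrite /derivable E; apply/cvg_ex; exists (L (l * v)); exact: lim.
by rewrite /derive E; apply: cvg_lim => //; exact: lim.
Qed.

End PartialDerivatives.

(** * Complexified quaternions and slices *)

Section Biquaternions.
Context {R : realType}.
Local Notation C := R[i].

(** Complexified quaternions [F_0 + sqrt(-1) F_1].  Four complex coordinates
    are used, so that a stem function becomes a quadruple of holomorphic
    functions. *)
Record biquat := Biquat { b0 : C; b1 : C; b2 : C; b3 : C }.
Implicit Types (A B : biquat) (I : quat R).

Definition bre A : quat R :=
  Quat (complex.Re (b0 A)) (complex.Re (b1 A)) (complex.Re (b2 A)) (complex.Re (b3 A)).
Definition bim A : quat R :=
  Quat (complex.Im (b0 A)) (complex.Im (b1 A)) (complex.Im (b2 A)) (complex.Im (b3 A)).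
Definition bconj A : biquat :=
  Biquat (b0 A)^*%C (b1 A)^*%C (b2 A)^*%C (b3 A)^*%C.
Definition bmul A B : biquat :=
  Biquat (b0 A * b0 B - b1 A * b1 B - b2 A * b2 B - b3 A * b3 B)
         (b0 A * b1 B + b1 A * b0 B + b2 A * b3 B - b3 A * b2 B)
         (b0 A * b2 B - b1 A * b3 B + b2 A * b0 B + b3 A * b1 B)
         (b0 A * b3 B + b1 A * b2 B - b2 A * b1 B + b3 A * b0 B).
Definition badd A B : biquat :=
  Biquat (b0 A + b0 B) (b1 A + b1 B) (b2 A + b2 B) (b3 A + b3 B).
Definition bscale (c : C) A : biquat :=
  Biquat (c * b0 A) (c * b1 A) (c * b2 A) (c * b3 A).
Definition bscalar (c : C) : biquat := Biquat c 0 0 0.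
Definition bvec A : biquat := Biquat 0 (b1 A) (b2 A) (b3 A).
(** The quaternionic conjugate, which is [C]-linear, unlike [bconj]. *)
Definition bstar A : biquat := Biquat (b0 A) (- b1 A) (- b2 A) (- b3 A).
(** The bilinear dot product of the vector parts; [bdot A A] is [f_v^s] when
    [A] is the stem of [f]. *)
Definition bdot A B : C := b1 A * b1 B + b2 A * b2 B + b3 A * b3 B.

Definition ev I A : quat R := bre A + I * bim A.

Lemma bq_ext A B : b0 A = b0 B -> b1 A = b1 B -> b2 A = b2 B -> b3 A = b3 B -> A = B.
Proof. by case: A B => ? ? ? ? [? ? ? ?] /= -> -> -> ->. Qed.

Lemma bre_mul A B : bre (bmul A B) = bre A * bre B - bim A * bim B.
Proof.
case: A B => [[? ?] [? ?] [? ?] [? ?]] [[? ?] [? ?] [? ?] [? ?]].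
by apply: quat_ext => /=; ring.
Qed.

Lemma bim_mul A B : bim (bmul A B) = bre A * bim B + bim A * bre B.
Proof.
case: A B => [[? ?] [? ?] [? ?] [? ?]] [[? ?] [? ?] [? ?] [? ?]].
by apply: quat_ext => /=; ring.
Qed.

Lemma bre_add A B : bre (badd A B) = bre A + bre B.
Proof.
by case: A B => [[? ?] [? ?] [? ?] [? ?]] [[? ?] [? ?] [? ?] [? ?]]; apply: quat_ext.
Qed.

Lemma bim_add A B : bim (badd A B) = bim A + bim B.
Proof.
by case: A B => [[? ?] [? ?] [? ?] [? ?]] [[? ?] [? ?] [? ?] [? ?]]; apply: quat_ext.
Qed.

Lemma bre_conj A : bre (bconj A) = bre A.
Proof. by case: A => [[? ?] [? ?] [? ?] [? ?]]; apply: quat_ext. Qed.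

Lemma bim_conj A : bim (bconj A) = - bim A.
Proof. by case: A => [[? ?] [? ?] [? ?] [? ?]]; apply: quat_ext. Qed.

Lemma bq_ext_parts A B : bre A = bre B -> bim A = bim B -> A = B.
Proof.
case: A B => [[? ?] [? ?] [? ?] [? ?]] [[? ?] [? ?] [? ?] [? ?]].
by case=> -> -> -> -> [-> -> -> ->].
Qed.

Lemma ev_add I A B : ev I (badd A B) = ev I A + ev I B.
Proof. by rewrite /ev bre_add bim_add mulrDr addrACA. Qed.

Lemma ev_conj I A : ev (- I) (bconj A) = ev I A.
Proof. by rewrite /ev bre_conj bim_conj mulrNN. Qed.

(** The product of stem values is not evaluated pointwise: right factors are
    twisted by the value of the left factor, as in the star product. *)
Lemma ev_mul I A B : imag_units I ->
  ev I (bmul A B) = ev I A * bre B + I * ev I A * bim B.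
Proof.
move=> II; rewrite /ev bre_mul bim_mul !mulrDr !mulrDl !mulrA II !mulN1r.
by rewrite mulNr [in RHS](addrC (I * bre A * bim B)) [RHS]addrACA [in RHS](addrC (I * bim A * bre B)).
Qed.

Lemma ev_mul_eq0 I A B : imag_units I -> ev I A = 0 -> ev I (bmul A B) = 0.
Proof. by move=> II A0; rewrite ev_mul // A0 mulr0 !mul0r addr0. Qed.

Lemma imag_unitN I : imag_units I -> imag_units (- I).
Proof. by rewrite /imag_units /= mulrNN. Qed.

Lemma imag_unitP I :
  imag_units I <-> qre I = 0 /\ qi I ^+ 2 + qj I ^+ 2 + qk I ^+ 2 = 1.
Proof.
case: I => a b c d; split => [|[/= -> e]].
  case=> e0 /eqP e1 /eqP e2 /eqP e3.
  have a0 : a = 0.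
    have [//|a0] := eqVneq a 0; exfalso.
    have kill x y z : a * x + x * a + y * z - z * y == - 0 -> x = 0.
      rewrite oppr0 (_ : _ - _ = 2 * a * x); last by ring.
      by rewrite !mulf_eq0 pnatr_eq0 (negPf a0) /= => /eqP.
    have b0 : b = 0 by apply: (kill b c d).
    have c0 : c = 0.
      apply: (kill c d b); rewrite -(eqP e2); apply/eqP; ring.
    have d0 : d = 0.
      apply: (kill d b c); rewrite -(eqP e3); apply/eqP; ring.
    move: e0; rewrite b0 c0 d0 !mulr0 !subr0 => e0.
    by have := sqr_ge0 a; rewrite expr2 e0 lerNr oppr0 ler10.
  split=> //=; apply/eqP; rewrite -eqr_opp -e0 a0; apply/eqP; ring.
rewrite /imag_units /=; apply: quat_ext => /=; try by ring.
by rewrite -e; ring.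
Qed.

Lemma imag_unit_Qi : imag_units (Qi : quat R).
Proof. by apply/imag_unitP; split=> //=; ring. Qed.

Lemma imag_unit_Qj : imag_units (Qj : quat R).
Proof. by apply/imag_unitP; split=> //=; ring. Qed.

(** Half the sum and half the difference of the evaluations at [I] and [- I]
    give the two quaternionic components. *)
Lemma ev_inj I A B : imag_units I ->
  ev I A = ev I B -> ev (- I) A = ev (- I) B -> A = B.
Proof.
move=> II; rewrite /ev !mulNr => e1 e2.
have half (p q : quat R) : p + p = q + q -> p = q.
  move=> h; have h0 := congr1 qre h; have h1 := congr1 qi h.
  have h2 := congr1 qj h; have h3 := congr1 qk h.
  by move: h0 h1 h2 h3 => /= *; apply: quat_ext; lra.
have re : bre A = bre B.
  apply: half; have := congr2 +%R e1 e2.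
  by rewrite addrACA subrr addr0 addrACA subrr addr0.
apply: bq_ext_parts => //.
have {}e1 : I * bim A = I * bim B by move: e1; rewrite re => /addrI.
have : I * (I * bim A) = I * (I * bim B) by rewrite e1.
by rewrite !mulrA II !mulN1r => /oppr_inj.
Qed.

Lemma ev_bscalar I c :
  ev I (bscalar c) = (complex.Re c)%:A + complex.Im c *: I.
Proof.
by case: c => x y; rewrite /ev; congr (_ + _); case: I => *; apply: quat_ext => /=; ring.
Qed.

Lemma ev_scalar I c A : imag_units I ->
  ev I (bscalar c) * ev I A = ev I (bscale c A).
Proof.
move=> II; rewrite ev_bscalar /ev; set x := complex.Re c; set y := complex.Im c.
have -> : bre (bscale c A) = x *: bre A - y *: bim A.
  rewrite /x /y; case: (c) A => ? ? [[? ?] [? ?] [? ?] [? ?]].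
  by apply: quat_ext => /=; ring.
have -> : bim (bscale c A) = x *: bim A + y *: bre A.
  rewrite /x /y; case: (c) A => ? ? [[? ?] [? ?] [? ?] [? ?]].
  by apply: quat_ext => /=; ring.
rewrite mulrDl -!scalerAl mul1r mulrDr mulrA II mulN1r.
rewrite !scalerDr mulrDr !scalerAr scalerN -!addrA; congr (_ + _).
by rewrite addrA [RHS]addrC.
Qed.

Lemma ev_one I : ev I (bscalar 1) = 1.
Proof. by rewrite ev_bscalar /= scale1r scale0r addr0. Qed.

Lemma ev_scalar_eq0 I c : imag_units I -> ev I (bscalar c) = 0 -> c = 0.
Proof.
move=> /imag_unitP[]; rewrite ev_bscalar; case: I c => a i j k [x y] /= -> e h.
have h0 : x = 0 by have := congr1 qre h; rewrite /= mulr1 mulr0 addr0.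
have h1 : y * i = 0 by have := congr1 qi h; rewrite /= mulr0 add0r.
have h2 : y * j = 0 by have := congr1 qj h; rewrite /= mulr0 add0r.
have h3 : y * k = 0 by have := congr1 qk h; rewrite /= mulr0 add0r.
have -> : y = 0.
  rewrite -[y]mulr1 -e.
  have -> : y * (i ^+ 2 + j ^+ 2 + k ^+ 2) = (y * i) * i + (y * j) * j + (y * k) * k by ring.
  by rewrite h1 h2 h3 !mul0r !addr0.
by rewrite h0.
Qed.

Lemma ev_scalar_slice I c : ev I (bscalar c) = slice_pt I (pair_of c).
Proof. by rewrite ev_bscalar. Qed.

End Biquaternions.

Section Representation.
Context {R : realType}.
Local Notation C := R[i].
Implicit Types (I q : quat R) (z w : C) (f g : quat R -> quat R).
Implicit Types (F G : C -> biquat (R := R)) (Om : set (quat R)).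

Definition cdom Om : set C := [set z | stem_domain Om (pair_of z)].

(** The coordinate [alpha + i beta], [beta >= 0], of the sphere of [q].  Since
    [Om] is connected, working with it treats slice domains and product domains
    alike, although the stem domain of a product domain has two components. *)
Definition halfpt q : C := Complex (qre q) `|qvec q|.

Definition bholo F z :=
  [/\ holo (fun w => b0 (F w)) z, holo (fun w => b1 (F w)) z,
      holo (fun w => b2 (F w)) z & holo (fun w => b3 (F w)) z].

Definition evaluates Om f F := forall I z, imag_units I -> cdom Om z ->
  f (slice_pt I (pair_of z)) = ev I (F z).

(** [F] is the stem function of [f], written with complex coordinates:
    evenness of [F_0] and oddness of [F_1] become the reality condition
    [F z^* = bconj (F z)]. *)
Definition represents Om f F :=
  [/\ forall z, cdom Om z -> bholo F z,
      forall z, cdom Om z -> F z^*%C = bconj (F z) & evaluates Om f F].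

Lemma slice_pt_parts I z : imag_units I ->
  qre (slice_pt I (pair_of z)) = complex.Re z /\
  qvec (slice_pt I (pair_of z)) = complex.Im z *: I.
Proof.
move=> /imag_unitP[]; case: I z => a b c d [x y] /= -> _; split; first by ring.
by apply: quat_ext => /=; ring.
Qed.

Lemma imag_unit_norm I : imag_units I -> `|I| = 1.
Proof.
move=> /imag_unitP[e0 e1].
have : `|I| ^+ 2 = 1 ^+ 2 by rewrite quat_sqnorm /qnorm2 e0 expr0n add0r e1 expr1n.
by move/eqP; rewrite eqrXn2 // => /eqP.
Qed.

Lemma slice_ptN I z : slice_pt (- I) (pair_of z^*%C) = slice_pt I (pair_of z).
Proof. by case: z => x y; rewrite /slice_pt /= scalerN scaleNr opprK. Qed.

Lemma halfpt_slice I z : imag_units I -> 0 <= complex.Im z ->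
  halfpt (slice_pt I (pair_of z)) = z.
Proof.
move=> II z0; have [e1 e2] := slice_pt_parts z II.
by rewrite /halfpt e1 e2 normrZ imag_unit_norm // mulr1 ger0_norm //; case: (z).
Qed.

(** At a real point [imag_dir q] is zero, and any imaginary unit serves. *)
Lemma on_slice q : exists2 I, imag_units I &
  q = slice_pt I (pair_of (halfpt q)) /\ (`|qvec q| != 0 -> I = imag_dir q).
Proof.
have [v0|v0] := eqVneq `|qvec q| 0.
  exists Qi; first exact: imag_unit_Qi.
  split=> //; rewrite /slice_pt /= v0 scale0r addr0.
  move/eqP: v0; rewrite normr_eq0 => /eqP; case: q => a b c d [-> -> ->].
  by apply: quat_ext => /=; ring.
exists (imag_dir q).
  apply/imag_unitP; rewrite /imag_dir /=; split; first by rewrite mulr0.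
  have vE : qi q ^+ 2 + qj q ^+ 2 + qk q ^+ 2 = `|qvec q| ^+ 2.
    by rewrite quat_sqnorm /qnorm2 /=; ring.
  rewrite !exprMn -!mulrDr vE.
  by rewrite -exprMn mulVf // expr1n.
split=> //; rewrite /slice_pt /= /imag_dir scalerA mulfV // scale1r.
by case: q {v0} => a b c d; apply: quat_ext => /=; ring.
Qed.

Lemma circular_slice Om I z : circular_domain Om -> imag_units I ->
  cdom Om z -> Om (slice_pt I (pair_of z)).
Proof.
move=> [_ _ _ circ] II [J JJ zJ]; have [e1 e2] := slice_pt_parts z JJ.
have sp K : imag_units K -> Om (slice_pt K (complex.Re z, `|complex.Im z|)).
  move=> KK; apply: (circ _ zJ); exists K => //.
  by rewrite e1 e2 normrZ imag_unit_norm // mulr1.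
have [z0|z0] := leP 0 (complex.Im z).
  by have := sp I II; rewrite ger0_norm.
have := sp (- I) (imag_unitN II).
by rewrite ltr0_norm // /slice_pt /= scalerN scaleNr opprK.
Qed.

Lemma cdom_halfpt Om q : Om q -> cdom Om (halfpt q).
Proof. by move=> Oq; have [I II [e _]] := on_slice q; exists I => //; rewrite -e. Qed.

Lemma cdom_conj Om z : cdom Om z -> cdom Om z^*%C.
Proof.
by move=> [I II h]; exists (- I); [exact: imag_unitN | rewrite slice_ptN].
Qed.

Lemma open_ball Om q : open Om -> Om q ->
  exists2 d, 0 < d & forall p, `|p - q| < d -> Om p.
Proof.
move=> Oo Oq; have /nbhs_ballP[e e0 He] : nbhs q Om by exact: open_nbhs_nbhs.
by exists e => // p pq; apply: He; rewrite -ball_normE /ball_ /= distrC.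
Qed.

Lemma slice_pt_dist I z w : imag_units I ->
  `|slice_pt I (pair_of w) - slice_pt I (pair_of z)| = normc (w - z).
Proof.
move=> /imag_unitP[]; case: I z w => a b c d [x y] [x' y'] /= -> e.
have : `|slice_pt (Quat 0 b c d) (x', y') - slice_pt (Quat 0 b c d) (x, y)| ^+ 2 =
    normc (Complex x' y' - Complex x y) ^+ 2.
  rewrite quat_sqnorm normc_sqr /qnorm2 /=.
  have -> : (y' - y) ^+ 2 = (y' - y) ^+ 2 * (b ^+ 2 + c ^+ 2 + d ^+ 2) by rewrite e mulr1.
  by ring.
by move/eqP; rewrite eqrXn2 ?normc_ge0 // => /eqP.
Qed.

Lemma cdom_open Om : circular_domain Om -> copen (cdom Om).
Proof.
move=> dom z Dz; have [_ _ Oo _] := dom.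
have [d d0 Hd] := open_ball Oo (circular_slice dom imag_unit_Qi Dz).
exists d => // w wd; exists Qi; first exact: imag_unit_Qi.
by apply: Hd; rewrite slice_pt_dist //; exact: imag_unit_Qi.
Qed.

Lemma halfpt_lipschitz p q : normc (halfpt p - halfpt q) <= 2 * `|p - q|.
Proof.
apply: le_trans (normc_le _) _ => /=.
have h1 : `|qre p - qre q| <= `|p - q| by exact: (qre_le (p - q)).
have h2 : `| `|qvec p| - `|qvec q| | <= `|p - q|.
  apply: le_trans (ler_dist_dist _ _) _.
  rewrite -(@ler_pXn2r _ 2) ?nnegrE // !quat_sqnorm /qnorm2 /=.
  by rewrite lerD2r lerD2r lerD2r subrr expr0n /= sqr_ge0.
by lra.
Qed.

(** The identity theorem.  The set of points of [Om] over which [f] vanishes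
    locally is open, and by [near_zero_spread] its complement is open too. *)
Lemma identity_theorem Om (f : C -> C) q0 : circular_domain Om ->
  (forall z, cdom Om z -> holo f z) -> Om q0 -> near_zero f (halfpt q0) ->
  forall q, Om q -> f (halfpt q) = 0.
Proof.
move=> dom hf Oq0 nz0; have [_ Oc Oo _] := dom.
have hD := cdom_open dom.
pose B := [set q | Om q /\ near_zero f (halfpt q)].
suff -> : Om = B.
  by move=> q [_ [d d0 Hd]]; apply: Hd; rewrite subrr normc0.
apply/esym/Oc.
- by exists q0.
- exists B; last by apply/seteqP; split=> q [] // ? [].
  rewrite openE => q [Oq [d d0 Hd]].
  have [c c0 Hc] := open_ball Oo Oq.
  apply/nbhs_ballP; exists (Num.min c (d / 4)) => /=.
    by rewrite lt_min c0 divr_gt0.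
  move=> p; rewrite -ball_normE /ball_ /= distrC lt_min => /andP[pc pd].
  split; first exact: Hc.
  exists (d / 2); first by rewrite divr_gt0.
  move=> w wp; apply: Hd.
  have := normc_triangle (halfpt p) w (halfpt q).
  have := halfpt_lipschitz p q; lra.
- exists (~` (Om `\` B)).
    apply: open_closedC; rewrite openE => q [Oq nB].
    have [c c0 Hc] := open_ball Oo Oq.
    have [r r0 Hr] := copen_disc hD (cdom_halfpt Oq).
    (* The radii leave room for the factor [2] of [halfpt_lipschitz] and the
       quarter of a radius in [near_zero_spread]. *)
    apply/nbhs_ballP; exists (Num.min c (r / 64)) => /=.
      by rewrite lt_min c0 divr_gt0.
    move=> p; rewrite -ball_normE /ball_ /= distrC lt_min => /andP[pc pd].
    split; first exact: Hc.
    move=> [Op nzp]; apply: nB; split => //.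
    exists (r / 32); first by rewrite divr_gt0.
    move=> w wq; apply: (@near_zero_spread _ f w (halfpt p) (r / 2)) => //.
    + by rewrite divr_gt0.
    + move=> z zw; apply: hf; apply: Hr.
      by have := normc_triangle w z (halfpt q); lra.
    + have := normc_triangle (halfpt q) (halfpt p) w.
      by have := halfpt_lipschitz p q; rewrite (normcB (halfpt q) w); lra.
  apply/seteqP; split=> q.
    by move=> [Oq nq]; split=> // -[_]; exact.
  by move=> [Oq /not_andP[//|/contrapT[]]].
Qed.

Lemma half_to_all Om (P : C -> Prop) : circular_domain Om ->
  (forall z, cdom Om z -> P z -> P z^*%C) ->
  (forall q, Om q -> P (halfpt q)) -> forall z, cdom Om z -> P z.
Proof.
move=> dom PC PH z Dz; have II := @imag_unit_Qi R.
have [z0|z0] := leP 0 (complex.Im z).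
  by rewrite -(halfpt_slice II z0); apply: PH; exact: circular_slice.
have z0' : 0 <= complex.Im z^*%C by case: (z) z0 => x y /= y0; rewrite oppr_ge0 ltW.
have Dz' := cdom_conj Dz.
rewrite -(conjcK z); apply: PC => //.
by rewrite -(halfpt_slice II z0'); apply: PH; exact: circular_slice.
Qed.

End Representation.

(** * Stem functions and the star product *)

Section StemFunctions.
Context {R : realType}.
Local Notation C := R[i].
Implicit Types (I q : quat R) (z w : C) (x v : R * R) (f g : quat R -> quat R).
Implicit Types (F G : C -> biquat (R := R)) (Om : set (quat R)).
Implicit Types (S : (R * R -> quat R) * (R * R -> quat R)).

Definition biquat_of_stem S z : biquat :=
  Biquat (Complex (qre (S.1 (pair_of z))) (qre (S.2 (pair_of z))))
         (Complex (qi (S.1 (pair_of z))) (qi (S.2 (pair_of z))))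
         (Complex (qj (S.1 (pair_of z))) (qj (S.2 (pair_of z))))
         (Complex (qk (S.1 (pair_of z))) (qk (S.2 (pair_of z)))).

Lemma bre_of_stem S z : bre (biquat_of_stem S z) = S.1 (pair_of z).
Proof. by apply: quat_ext. Qed.

Lemma bim_of_stem S z : bim (biquat_of_stem S z) = S.2 (pair_of z).
Proof. by apply: quat_ext. Qed.

Lemma is_derive_coordinate (F : R * R -> quat R) x v L : coordinate L ->
  derivable F x v -> is_derive x v (L \o F) (L ('D_v F x)).
Proof.
move=> Lc Fd; have [LB LZ _] := Lc.
have lim := cvg_coordinate Lc Fd.
have E : (fun h : R => h^-1 *: ((L \o F) (h *: v + x) - (L \o F) x)) =
    L \o (fun h : R => h^-1 *: (F (h *: v + x) - F x)).
  by apply/funext => h /=; rewrite LZ LB.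
split; first by rewrite /derivable E; apply/cvg_ex; exists (L ('D_v F x)); exact: lim.
by rewrite /derive E; apply: cvg_lim => //; exact: lim.
Qed.

Lemma is_derive_quat (a b c d : R * R -> R) x v (a' b' c' d' : R) :
  is_derive x v a a' -> is_derive x v b b' -> is_derive x v c c' ->
  is_derive x v d d' ->
  is_derive x v (fun y => Quat (a y) (b y) (c y) (d y)) (Quat a' b' c' d').
Proof.
move=> [ad <-] [bd <-] [cd <-] [dd <-].
have lim := cvg_quat ad bd cd dd.
have E : (fun h : R => h^-1 *: (Quat (a (h *: v + x)) (b (h *: v + x))
      (c (h *: v + x)) (d (h *: v + x)) - Quat (a x) (b x) (c x) (d x))) =
  (fun h : R => Quat (h^-1 *: (a (h *: v + x) - a x)) (h^-1 *: (b (h *: v + x) - b x))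
      (h^-1 *: (c (h *: v + x) - c x)) (h^-1 *: (d (h *: v + x) - d x))).
  by apply/funext => h; apply: quat_ext.
split; first by rewrite /derivable E; apply/cvg_ex; eexists; exact: lim.
by rewrite /derive E; apply: cvg_lim => //; exact: lim.
Qed.

Lemma is_stem_represents Om f S : circular_domain Om ->
  is_stem Om f S -> represents Om f (biquat_of_stem S).
Proof.
move=> dom [[C1 C2] sym CR val]; split.
- move=> z Dz; have [d d0 Hd] := cdom_open dom Dz.
  have key L : coordinate L ->
      holo (fun w => Complex (L (S.1 (pair_of w))) (L (S.2 (pair_of w)))) z.
    move=> Lc.
    eexists; apply: (@cauchy_riemann_sder _ (L \o S.1) (L \o S.2)
      (fun x => L ('D_dir_alpha S.1 x)) (fun x => L ('D_dir_beta S.1 x)) z d d0).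
    + move=> w /Hd Dw; have [e1 e2] := CR _ Dw.
      have [da1 db1 _ _] := C1 _ Dw; have [da2 db2 _ _] := C2 _ Dw.
      have [LB LZ _] := Lc.
      have LN q : L (- q) = - L q by rewrite -scaleN1r LZ mulN1r.
      split; try exact: is_derive_coordinate.
        by rewrite e2 LN opprK; exact: is_derive_coordinate.
      by rewrite e1; exact: is_derive_coordinate.
    + by have [_ _ h _] := C1 _ Dz; exact: cvg_coordinate.
    + by have [_ _ _ h] := C1 _ Dz; exact: cvg_coordinate.
  split; apply: key; [exact: coordinate_qre | exact: coordinate_qi |
    exact: coordinate_qj | exact: coordinate_qk].
- move=> z Dz; have [e1 e2] := sym _ Dz.
  have cz : pair_of z^*%C = cconj (pair_of z) by case: z {Dz e1 e2}.
  by apply: bq_ext; rewrite /= cz e1 e2.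
- move=> I z II Dz; rewrite /ev bre_of_stem bim_of_stem; apply: val => //.
  exact: circular_slice.
Qed.

Lemma continuous_cplx (g : C -> R) x : (forall e, 0 < e -> exists2 d, 0 < d &
    forall w, normc (w - cplx x) < d -> `|g w - g (cplx x)| < e) ->
  {for x, continuous (fun y => g (cplx y))}.
Proof.
move=> H; apply/cvgrPdist_lt => e e0; have [d d0 Hd] := H e e0.
by apply/nbhs_cplx; exists d => // y /Hd; rewrite distrC.
Qed.

Lemma represents_is_stem Om f F : circular_domain Om ->
  represents Om f F -> is_stem Om f (fun x => bre (F (cplx x)), fun x => bim (F (cplx x))).
Proof.
move=> dom [hol sym val].
have Dc x : stem_domain Om x -> cdom Om (cplx x) by case: x.
pose d_ (b : biquat -> C) := dc (fun w => b (F w)).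
have der b x : holo (fun w => b (F w)) (cplx x) -> _ :=
  fun h => sder_partials (dcP h).
pose A1 x := Quat (complex.Re (d_ b0 (cplx x))) (complex.Re (d_ b1 (cplx x)))
  (complex.Re (d_ b2 (cplx x))) (complex.Re (d_ b3 (cplx x))).
pose A2 x := Quat (complex.Im (d_ b0 (cplx x))) (complex.Im (d_ b1 (cplx x)))
  (complex.Im (d_ b2 (cplx x))) (complex.Im (d_ b3 (cplx x))).
have D1 x : stem_domain Om x ->
  [/\ is_derive x (dir_alpha : R * R) (fun x => bre (F (cplx x))) (A1 x),
      is_derive x (dir_beta : R * R) (fun x => bre (F (cplx x))) (- A2 x),
      is_derive x (dir_alpha : R * R) (fun x => bim (F (cplx x))) (A2 x) &
      is_derive x (dir_beta : R * R) (fun x => bim (F (cplx x))) (A1 x)].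
  move=> /Dc/hol[/der[? ? ? ?] /der[? ? ? ?] /der[? ? ? ?] /der[? ? ? ?]].
  by split; apply: is_derive_quat.
have cont (l : C -> R) : (forall a b, `|l a - l b| <= normc (a - b)) ->
    forall x, stem_domain Om x -> forall b, (forall z, cdom Om z -> holo (fun w => b (F w)) z) ->
    {for x, continuous (fun y => l (d_ b (cplx y)))}.
  move=> ll x Dx b hb.
  apply: (@continuous_cplx (fun w => l (d_ b w))) => e e0.
  have [r r0 Hr] := copen_disc (cdom_open dom) (Dc _ Dx).
  have [|d d0 Hd] := @holo_cont _ (d_ b) (cplx x) _ _ e0.
    by apply: (holo_dc r0) => w /Hr; exact: hb.
  by exists d => // w wd; apply: le_lt_trans (ll _ _) _; exact: Hd.
have hb0 z : cdom Om z -> holo (fun w => b0 (F w)) z by move=> /hol[].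
have hb1 z : cdom Om z -> holo (fun w => b1 (F w)) z by move=> /hol[].
have hb2 z : cdom Om z -> holo (fun w => b2 (F w)) z by move=> /hol[].
have hb3 z : cdom Om z -> holo (fun w => b3 (F w)) z by move=> /hol[].
have lRe (a b : C) : `|complex.Re a - complex.Re b| <= normc (a - b).
  by have := normcRe (a - b); case: a b => ? ? [].
have lIm (a b : C) : `|complex.Im a - complex.Im b| <= normc (a - b).
  by have := normcIm (a - b); case: a b => ? ? [].
have cA1 x : stem_domain Om x -> {for x, continuous A1}.
  by move=> Dx; apply: cvg_quat; apply: cont.
have cA2 x : stem_domain Om x -> {for x, continuous A2}.
  by move=> Dx; apply: cvg_quat; apply: cont.
have near_dom x : stem_domain Om x -> \forall y \near x, stem_domain Om y.
  move=> Dx; have [d d0 Hd] := cdom_open dom (Dc _ Dx).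
  by apply/nbhs_cplx; exists d => // y /Hd; rewrite /cdom /= cplxK.
have cext (G H : R * R -> quat R) x : (forall y, stem_domain Om y -> G y = H y) ->
    stem_domain Om x -> {for x, continuous G} -> {for x, continuous H}.
  move=> GH Dx cG; rewrite /prop_for /continuous_at -GH //.
  apply: cvg_trans cG; apply: near_eq_cvg.
  by near=> y; apply/GH; near: y; exact: near_dom.
have cNA2 x : stem_domain Om x -> {for x, continuous (fun y => - A2 y)}.
  by move=> Dx; apply: cvgN; exact: cA2.
split=> /=.
- split=> x Dx; have [p1 p2 p3 p4] := D1 x Dx.
    have [d1 _] := p1; have [d2 _] := p2; split; [exact: d1 | exact: d2 | |].
      apply: cext Dx (cA1 _ Dx) => y Dy; have [[_ h] _ _ _] := D1 y Dy.
      exact: esym.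
    apply: cext Dx (cNA2 _ Dx) => y Dy; have [_ [_ h] _ _] := D1 y Dy.
    exact: esym.
  have [d3 _] := p3; have [d4 _] := p4; split; [exact: d3 | exact: d4 | |].
    apply: cext Dx (cA2 _ Dx) => y Dy; have [_ _ [_ h] _] := D1 y Dy.
    exact: esym.
  apply: cext Dx (cA1 _ Dx) => y Dy; have [_ _ _ [_ h]] := D1 y Dy.
  exact: esym.
- move=> x /Dc/sym; rewrite (_ : ((cplx x)^*)%C = cplx (cconj x)) // => ->.
  by rewrite bre_conj bim_conj.
- move=> x Dx; have [[_ p1] [_ p2] [_ p3] [_ p4]] := D1 x Dx.
  by rewrite p1 p2 p3 p4.
- by move=> I x II Ox; rewrite -[x in LHS]cplxK val //; exists I.
Unshelve. all: by end_near. Qed.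

Lemma regular_represents Om f : circular_domain Om -> slice_regular Om f ->
  exists F, represents Om f F.
Proof.
by move=> dom [S hS]; exists (biquat_of_stem S); exact: is_stem_represents.
Qed.

Lemma represents_regular Om f F : circular_domain Om -> represents Om f F ->
  slice_regular Om f.
Proof. by move=> dom fF; eexists; exact: represents_is_stem fF. Qed.

Definition slice_fun F q := ev (imag_dir q) (F (halfpt q)).

Lemma slice_fun_evaluates Om F : circular_domain Om ->
  (forall z, cdom Om z -> F z^*%C = bconj (F z)) -> evaluates Om (slice_fun F) F.
Proof.
move=> dom sym I z II Dz; rewrite /slice_fun.
have [e1 e2] := slice_pt_parts z II.
have dirE : imag_dir (slice_pt I (pair_of z)) =
    (`|complex.Im z|^-1 * complex.Im z) *: I.
  by rewrite /imag_dir e2 normrZ imag_unit_norm // mulr1 scalerA.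
have [z0|z0|z0] := ltgtP (complex.Im z) 0.
- have IN := imag_unitN II.
  have zE : slice_pt I (pair_of z) = slice_pt (- I) (pair_of z^*%C) by rewrite slice_ptN.
  rewrite dirE ltr0_norm // invrN mulNr mulVf ?lt_eqF // scaleN1r zE halfpt_slice //.
    by rewrite sym // ev_conj.
  by case: (z) z0 => x y /= y0; rewrite oppr_ge0 ltW.
- by rewrite dirE ger0_norm ?(ltW z0) // mulVf ?gt_eqF // scale1r halfpt_slice // ltW.
- rewrite dirE z0 mulr0 scale0r halfpt_slice ?z0 //.
  have zz : z^*%C = z by case: (z) z0 => x y /= ->; rewrite oppr0.
  have im0 : bim (F z) = 0.
    have := congr1 bim (sym _ Dz); rewrite zz bim_conj => h.
    have h1 := congr1 qre h; have h2 := congr1 qi h.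
    have h3 := congr1 qj h; have h4 := congr1 qk h.
    by move: h1 h2 h3 h4 => /= *; apply: quat_ext => /=; lra.
  by rewrite /ev im0 !mulr0.
Qed.

Lemma slice_fun_represents Om F : circular_domain Om ->
  (forall z, cdom Om z -> bholo F z) ->
  (forall z, cdom Om z -> F z^*%C = bconj (F z)) -> represents Om (slice_fun F) F.
Proof. by move=> dom hol sym; split=> //; exact: slice_fun_evaluates. Qed.

(** Conjugation by [f q] turns [slice_pt I z] into [slice_pt J z] with
    [f q * J = I * f q], which is the twist in [ev_mul]. *)
Lemma star_evaluates Om f g F G : circular_domain Om ->
  evaluates Om f F -> evaluates Om g G ->
  evaluates Om (star f g) (fun z => bmul (F z) (G z)).
Proof.
move=> dom fF gG I z II Dz; rewrite /star; have fE := fF I z II Dz.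
case: eqP => [f0|/eqP f0].
  by rewrite ev_mul_eq0 // -fE.
set q := slice_pt I (pair_of z) in fE f0 *.
have fu : f q \is a GRing.unit by [].
pose J := (f q)^-1 * I * f q.
have JJ : imag_units J.
  rewrite /imag_units /= /J !mulrA mulrK // -[_ * I * I]mulrA II.
  by rewrite mulrN1 mulNr mulVr.
have -> : (f q)^-1 * q * f q = slice_pt J (pair_of z).
  rewrite /q /slice_pt /= mulrDr mulrDl; congr (_ + _).
    by rewrite -scalerAr mulr1 -scalerAl mulVr.
  by rewrite -scalerAr -scalerAl.
rewrite gG // ev_mul // -fE /ev mulrDr; congr (_ + _).
by rewrite /J !mulrA mulrV // mul1r.
Qed.

End StemFunctions.

(** * Real part, vector part and symmetrization *)

Section SliceFunctions.
Context {R : realType}.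
Local Notation C := R[i].
Implicit Types (I q : quat R) (z w : C) (f g : quat R -> quat R) (a : C -> C).
Implicit Types (F G : C -> biquat (R := R)) (A : biquat (R := R)) (Om : set (quat R)).

Lemma represents_evaluates Om f F : represents Om f F -> evaluates Om f F.
Proof. by case. Qed.

Lemma evaluates_uniq Om f g F G : circular_domain Om ->
  evaluates Om f F -> evaluates Om g G -> {in Om, f =1 g} ->
  forall z, cdom Om z -> F z = G z.
Proof.
move=> dom fF gG fg z Dz; have II := @imag_unit_Qi R.
apply: (ev_inj II); rewrite -fF // -?gG //; try exact: imag_unitN.
  by apply: fg; rewrite inE; exact: circular_slice.
by apply: fg; rewrite inE; apply: circular_slice => //; exact: imag_unitN.
Qed.

Lemma evaluates_at Om f F : evaluates Om f F -> forall q, Om q ->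
  exists I, [/\ imag_units I, forall g G, evaluates Om g G -> g q = ev I (G (halfpt q)),
    f q = ev I (F (halfpt q)) & `|qvec q| != 0 -> I = imag_dir q].
Proof.
move=> fF q Oq; have [I II [e d]] := on_slice q; have Dq := cdom_halfpt Oq.
exists I; split=> //; first by move=> g G gG; rewrite {1}e; exact: gG.
by rewrite {1}e; exact: fF.
Qed.

Lemma evaluates_eqfun Om f g F : circular_domain Om -> evaluates Om f F ->
  {in Om, f =1 g} -> evaluates Om g F.
Proof.
move=> dom fF fg I z II Dz; rewrite -fF // fg // inE.
exact: circular_slice.
Qed.

Lemma evaluates_eqstem Om f F G : evaluates Om f F ->
  (forall z, cdom Om z -> F z = G z) -> evaluates Om f G.
Proof. by move=> fF FG I z II Dz; rewrite -FG //; exact: fF. Qed.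

Definition shol Om a := forall z, cdom Om z -> holo a z.
Definition ssym Om a := forall z, cdom Om z -> a z^*%C = (a z)^*%C.

Lemma represents_coord Om f F : represents Om f F ->
  [/\ shol Om (b0 \o F), shol Om (b1 \o F), shol Om (b2 \o F) & shol Om (b3 \o F)] /\
  [/\ ssym Om (b0 \o F), ssym Om (b1 \o F), ssym Om (b2 \o F) & ssym Om (b3 \o F)].
Proof.
move=> [hol sym _]; split; first by split=> z /hol[].
by split=> z /sym /= ->.
Qed.

Lemma represents_slice_fun Om F : circular_domain Om ->
  [/\ shol Om (b0 \o F), shol Om (b1 \o F), shol Om (b2 \o F) & shol Om (b3 \o F)] ->
  [/\ ssym Om (b0 \o F), ssym Om (b1 \o F), ssym Om (b2 \o F) & ssym Om (b3 \o F)] ->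
  represents Om (slice_fun F) F.
Proof.
move=> dom [h0 h1 h2 h3] [s0 s1 s2 s3]; apply: slice_fun_represents => // z Dz.
  by split; [exact: h0 | exact: h1 | exact: h2 | exact: h3].
by apply: bq_ext; [exact: s0 | exact: s1 | exact: s2 | exact: s3].
Qed.

Lemma shol_cst Om c : shol Om (fun=> c).
Proof. by move=> z _; exact: holo_cst. Qed.

Lemma ssym0 Om : ssym Om (fun=> 0).
Proof. by move=> z _; rewrite conjc0. Qed.

Definition scalar_fun a := slice_fun (fun z => bscalar (a z)).

Lemma scalar_fun_represents Om a : circular_domain Om -> shol Om a -> ssym Om a ->
  represents Om (scalar_fun a) (fun z => bscalar (a z)).
Proof.
move=> dom ha sa; apply: represents_slice_fun => //.
  by split=> //; exact: shol_cst.
by split=> //; exact: ssym0.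
Qed.

Lemma scalar_preserving Om f F : circular_domain Om -> represents Om f F ->
  (forall z, cdom Om z -> F z = bscalar (b0 (F z))) -> slice_preserving Om f.
Proof.
move=> dom fF sc; split; first exact: represents_regular fF.
move=> I II _ [q [Oq [x _ xq]] <-].
have Dx : cdom Om (cplx x) by exists I => //; rewrite cplxK xq.
rewrite -xq -[x]cplxK (represents_evaluates fF) // sc // ev_scalar_slice.
by eexists.
Qed.

Lemma scalar_fun_preserving Om a : circular_domain Om -> shol Om a -> ssym Om a ->
  slice_preserving Om (scalar_fun a).
Proof. by move=> dom ha sa; apply: (scalar_preserving dom (scalar_fun_represents dom ha sa)). Qed.

(** The value lies in [C_I] for [I = Qi], [- Qi], [Qj], [- Qj], which kills
    the three vector coordinates. *)
Lemma preserving_scalar Om f F : circular_domain Om -> slice_preserving Om f ->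
  evaluates Om f F -> forall z, cdom Om z -> F z = bscalar (b0 (F z)).
Proof.
move=> dom [_ pres] fF z Dz.
have key I : imag_units I -> exists x, ev I (F z) = slice_pt I x.
  move=> II; have Oq := circular_slice dom II Dz.
  have [|x _ xE] := pres I II (f (slice_pt I (pair_of z))).
    by exists (slice_pt I (pair_of z)) => //; split=> //; exists (pair_of z).
  by exists x; rewrite xE fF.
have [x1] := key _ imag_unit_Qi.
have [x2] := key _ (imag_unitN imag_unit_Qi).
have [x3] := key _ imag_unit_Qj.
have [x4] := key _ (imag_unitN imag_unit_Qj).
case: (F z) => [[p0 q0] [p1 q1] [p2 q2] [p3 q3]].
rewrite /ev /slice_pt => h4 h3 h2 h1.
have j1 := congr1 qj h1; have k1 := congr1 qk h1.
have j2 := congr1 qj h2; have k2 := congr1 qk h2.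
have i3 := congr1 qi h3; have i4 := congr1 qi h4.
have k3 := congr1 qk h3; have k4 := congr1 qk h4.
move: j1 k1 j2 k2 i3 i4 k3 k4 => /= j1 k1 j2 k2 i3 i4 k3 k4.
by apply: bq_ext => //=; congr Complex; lra.
Qed.

Lemma ev_decomp I A : ev I A = ev I (bscalar (b0 A)) + ev I (bscalar (b1 A)) * Qi
  + ev I (bscalar (b2 A)) * Qj + ev I (bscalar (b3 A)) * Qk.
Proof.
case: I A => a b c d [[? ?] [? ?] [? ?] [? ?]].
by rewrite /ev; apply: quat_ext => /=; ring.
Qed.

(** Slice preserving functions have scalar stems, so the four components of
    [f] can only be the coordinates of its stem. *)
Lemma real_part_evaluates Om f F : circular_domain Om -> represents Om f F ->
  evaluates Om (real_part Om f) (fun z => bscalar (b0 (F z))).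
Proof.
move=> dom fF; have [[h0 h1 h2 h3] [s0 s1 s2 s3]] := represents_coord fF.
have ex : exists f0, is_real_part Om f f0.
  exists (scalar_fun (b0 \o F)), (scalar_fun (b1 \o F)), (scalar_fun (b2 \o F)), (scalar_fun (b3 \o F)).
  split; try exact: scalar_fun_preserving.
  move=> q; rewrite inE => Oq.
  have [I [II gE -> _]] := evaluates_at (represents_evaluates fF) Oq.
  have r0 := gE _ _ (represents_evaluates (scalar_fun_represents dom h0 s0)).
  have r1 := gE _ _ (represents_evaluates (scalar_fun_represents dom h1 s1)).
  have r2 := gE _ _ (represents_evaluates (scalar_fun_represents dom h2 s2)).
  have r3 := gE _ _ (represents_evaluates (scalar_fun_represents dom h3 s3)).
  by rewrite r0 r1 r2 r3; exact: ev_decomp.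
have [f1 [f2 [f3 [p0 p1 p2 p3 fE]]]] : is_real_part Om f (real_part Om f) := xgetPex _ ex.
have scal g : slice_preserving Om g -> exists a, evaluates Om g (fun z => bscalar (a z)).
  move=> pg; have [G gG] := regular_represents dom (proj1 pg).
  exists (b0 \o G); apply: evaluates_eqstem (represents_evaluates gG) _.
  exact: preserving_scalar pg (represents_evaluates gG).
have [a0 e0] := scal _ p0; have [a1 e1] := scal _ p1.
have [a2 e2] := scal _ p2; have [a3 e3] := scal _ p3.
apply: (evaluates_eqstem e0) => z Dz.
suff -> : F z = Biquat (a0 z) (a1 z) (a2 z) (a3 z) by [].
apply: (@evaluates_uniq Om f f F (fun z => Biquat (a0 z) (a1 z) (a2 z) (a3 z))) => //.
  exact: represents_evaluates.
move=> I w II Dw; rewrite fE; last by rewrite inE; exact: circular_slice.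
by rewrite e0 // e1 // e2 // e3 // [RHS]ev_decomp.
Qed.

Lemma ev_split I A : ev I A = ev I (bscalar (b0 A)) + ev I (bvec A).
Proof.
rewrite -ev_add; congr ev; case: A => *.
by apply: bq_ext; rewrite /= ?addr0 ?add0r.
Qed.

Lemma vector_part_represents Om f F : circular_domain Om -> represents Om f F ->
  represents Om (vector_part Om f) (fun z => bvec (F z)).
Proof.
move=> dom fF; have [hol sym _] := fF; split.
- by move=> z /hol[] *; split=> //; exact: holo_cst.
- by move=> z /sym ->; apply: bq_ext => //=; rewrite oppr0.
- move=> I z II Dz; rewrite /vector_part (represents_evaluates fF) //.
  by rewrite (real_part_evaluates dom fF) // (ev_split I (F z)) addrC addKr.
Qed.

Lemma slice_conj_evaluates Om f F : circular_domain Om -> represents Om f F ->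
  evaluates Om (slice_conj Om f) (fun z => bstar (F z)).
Proof.
move=> dom fF.
have st : is_stem Om f (stem Om f).
  by apply: xgetPex; eexists; exact: represents_is_stem fF.
have fS := is_stem_represents dom st.
have SF : forall z, cdom Om z -> biquat_of_stem (stem Om f) z = F z.
  exact: (evaluates_uniq dom (represents_evaluates fS) (represents_evaluates fF)).
have [_ sym _] := fF.
have E : evaluates Om (slice_fun (fun z => bstar (F z))) (fun z => bstar (F z)).
  apply: slice_fun_evaluates => // z Dz; rewrite sym //.
  by apply: bq_ext => //=; rewrite rmorphN.
apply: (evaluates_eqfun dom E) => q; rewrite inE => Oq.
have SFq := SF _ (cdom_halfpt Oq).
have h1 : bre (bstar (F (halfpt q))) = qconj ((stem Om f).1 (qre q, `|qvec q|)).
  have := congr1 bre SFq; rewrite bre_of_stem => ->.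
  by case: (F _) => [[? ?] [? ?] [? ?] [? ?]]; apply: quat_ext.
have h2 : bim (bstar (F (halfpt q))) = qconj ((stem Om f).2 (qre q, `|qvec q|)).
  have := congr1 bim SFq; rewrite bim_of_stem => ->.
  by case: (F _) => [[? ?] [? ?] [? ?] [? ?]]; apply: quat_ext.
by rewrite /slice_fun /slice_conj /induced /= /ev h1 h2.
Qed.

Lemma symm_evaluates Om f F : circular_domain Om -> represents Om f F ->
  evaluates Om (symm Om f) (fun z => bscalar (b0 (F z) ^+ 2 + bdot (F z) (F z))).
Proof.
move=> dom fF.
have := star_evaluates dom (represents_evaluates fF) (slice_conj_evaluates dom fF).
move=> /evaluates_eqstem; apply => z _.
by case: (F z) => x y u v; apply: bq_ext; rewrite /= /bdot /=; ring.
Qed.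

Lemma star_exp_evaluates Om f F n : circular_domain Om -> evaluates Om f F ->
  evaluates Om (star_exp f n) (fun z => iter n (bmul (F z)) (bscalar 1)).
Proof.
move=> dom fF; elim: n => [|n IH].
  by move=> I z II Dz; rewrite [RHS]ev_one.
by have := star_evaluates dom fF IH.
Qed.

End SliceFunctions.

(** * The complex exponential *)

Section ComplexExponential.
Context {R : realType}.
Local Notation C := R[i].
Implicit Types (z w l : C) (t x y : R).

Definition cexp z : C := (expR (complex.Re z))%:C%C * cis (complex.Im z).

Lemma cexpD z w : cexp (z + w) = cexp z * cexp w.
Proof.
case: z w => a b [c d]; rewrite /cexp /= expRD cisD rmorphM /=; ring.
Qed.

Lemma cexp0 : cexp 0 = 1.
Proof. by rewrite /cexp /= expR0 cis0 mulr1. Qed.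

Lemma normc_cexp z : normc (cexp z) = expR (complex.Re z).
Proof. by rewrite /cexp normcM normc_cis mulr1 normc_real ger0_norm // expR_ge0. Qed.

Lemma cexp_neq0 z : cexp z != 0.
Proof. by rewrite -normc_gt0 normc_cexp expR_gt0. Qed.

Lemma cexpN z : cexp (- z) = (cexp z)^-1.
Proof.
by apply: (mulfI (cexp_neq0 z)); rewrite -cexpD subrr cexp0 mulfV ?cexp_neq0.
Qed.

Let is_derive_fst (P : R * R -> R) x y d :
  is_derive x 1 (fun s => P (s, y)) d -> is_derive (x, y) (dir_alpha : R * R) P d.
Proof.
move=> [dP eP].
have E : (fun h : R => h^-1 *: (P (h *: (dir_alpha : R * R) + (x, y)) - P (x, y))) =
    (fun h : R => h^-1 *: (P (h *: (1 : R) + x, y) - P (x, y))).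
  apply/funext => h; congr (_ *: (P _ - _)).
  by rewrite /dir_alpha; congr (_, _) => /=; rewrite ?scaler0 ?mulr0 add0r.
by split; [rewrite /derivable E | rewrite -eP /derive E].
Qed.

Let is_derive_snd (P : R * R -> R) x y d :
  is_derive y 1 (fun s => P (x, s)) d -> is_derive (x, y) (dir_beta : R * R) P d.
Proof.
move=> [dP eP].
have E : (fun h : R => h^-1 *: (P (h *: (dir_beta : R * R) + (x, y)) - P (x, y))) =
    (fun h : R => h^-1 *: (P (x, h *: (1 : R) + y) - P (x, y))).
  apply/funext => h; congr (_ *: (P _ - _)).
  by rewrite /dir_beta; congr (_, _) => /=; rewrite ?scaler0 ?mulr0 add0r.
by split; [rewrite /derivable E | rewrite -eP /derive E].
Qed.

Lemma sder_cexp z : sder cexp z (cexp z).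
Proof.
pose P (p : R * R) : R := expR p.1 * cos p.2.
pose Q (p : R * R) : R := expR p.1 * sin p.2.
have cP (g : R -> R) : continuous g -> continuous (fun p : R * R => expR p.1 * g p.2).
  move=> cg p; apply: cvgM.
    by apply: (@continuous_comp _ _ _ fst); [exact: cvg_fst | exact: continuous_expR].
  by apply: (@continuous_comp _ _ _ snd); [exact: cvg_snd | exact: cg].
have -> : cexp z = Complex (P (pair_of z)) (- - Q (pair_of z)).
  by case: z => a b; rewrite /cexp /cis /P /Q opprK; simpc.
have PQ : sder (fun w => Complex (P (pair_of w)) (Q (pair_of w))) z
    (Complex (P (pair_of z)) (- - Q (pair_of z))).
  apply: (@cauchy_riemann_sder _ P Q P (fun p => - Q p) z 1) => //.
  - case=> a b _; rewrite /pair_of /=; split.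
    + apply: is_derive_fst; rewrite /P /=.
      by apply: is_derive_eq; rewrite /GRing.scale /=; ring.
    + apply: is_derive_snd; rewrite /P /Q /=.
      by apply: is_derive_eq; rewrite /GRing.scale /=; ring.
    + rewrite opprK; apply: is_derive_fst; rewrite /Q /=.
      by apply: is_derive_eq; rewrite /GRing.scale /=; ring.
    + apply: is_derive_snd; rewrite /P /Q /=.
      by apply: is_derive_eq; rewrite /GRing.scale /=; ring.
  - by apply: cP; exact: continuous_cos.
  - by apply: cvgN; apply: cP; exact: continuous_sin.
apply: sder_near PQ => // w _.
by case: w => a b; rewrite /cexp /cis /P /Q; simpc.
Qed.

Lemma holo_cexp z : holo cexp z.
Proof. by exists (cexp z); exact: sder_cexp. Qed.

Definition exp_sum n z : C := \sum_(k < n) (k`!%:R)^-1 * z ^+ k.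

Lemma exp_sumS n z : exp_sum n.+1 z = exp_sum n z + (n`!%:R)^-1 * z ^+ n.
Proof. by rewrite /exp_sum big_ord_recr. Qed.

Let sderX n z : sder (fun w => w ^+ n.+1) z (n.+1%:R * z ^+ n).
Proof.
elim: n => [|n IH].
  by rewrite expr0 mulr1; exact: sder_id.
have := sderM (sder_id z) IH.
have -> : 1 * z ^+ n.+1 + z * (n.+1%:R * z ^+ n) = n.+2%:R * z ^+ n.+1.
  by rewrite -(natr1 n.+1) exprS; ring.
by apply: sder_near => // w _; rewrite [RHS]exprS.
Qed.

Let sder_remainder n z :
  sder (fun w => cexp w - exp_sum n.+1 w) z (cexp z - exp_sum n z).
Proof.
elim: n => [|n IH].
  have := sderD (sder_cexp z) (sder_cst (-1) z).
  rewrite addr0 {2}/exp_sum big_ord0 subr0; apply: (@sder_near _ _ _ _ _ 1) => // w _.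
  by rewrite exp_sumS /exp_sum big_ord0 add0r expr0 mulr1 invr1.
have := sderD IH (sderM (sder_cst (- (n.+1`!%:R)^-1) z) (sderX n z)).
have -> : cexp z - exp_sum n z + (0 * z ^+ n.+1 + - (n.+1`!%:R)^-1 * (n.+1%:R * z ^+ n)) =
    cexp z - exp_sum n.+1 z.
  have key : (n.+1`!%:R)^-1 * n.+1%:R = (n`!%:R)^-1 :> C.
    by rewrite factS natrM invfM mulrAC mulVf ?pnatr_eq0 // mul1r.
  by rewrite exp_sumS -key; ring.
apply: (@sder_near _ _ _ _ _ 1) => // w _.
by rewrite (exp_sumS n.+1); ring.
Qed.

Let real_remainder (u du : R -> R) (K : R) n : 0 <= K -> u 0 = 0 ->
  (forall t, is_derive t 1 u (du t)) ->
  (forall t, 0 <= t <= 1 -> `|du t| <= K * (t ^+ n / n`!%:R)) ->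
  forall t, 0 <= t <= 1 -> `|u t| <= K * (t ^+ n.+1 / n.+1`!%:R).
Proof.
move=> K0 u0 hu hdu t /andP[t0 t1].
pose G t := K * (t ^+ n.+1 / n.+1`!%:R).
have dG (s : R) : is_derive s 1 G (K * (s ^+ n / n`!%:R)).
  have dX : is_derive s 1 (fun t => t ^+ n.+1) (n.+1%:R * s ^+ n).
    by apply: DeriveDef; [exact: exprn_derivable | rewrite exp_derive [LHS]mulr1].
  have -> : G = (K / n.+1`!%:R) \*: (fun t => t ^+ n.+1).
    apply/funext => t'.
    have e : K * (t' ^+ n.+1 / n.+1`!%:R) = (K / n.+1`!%:R) * t' ^+ n.+1 by ring.
    exact: e.
  apply: is_derive_eq; rewrite /GRing.scale /=.
  have key : (n.+1`!%:R)^-1 * n.+1%:R = (n`!%:R)^-1 :> R.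
    by rewrite factS natrM invfM mulrAC mulVf ?pnatr_eq0 // mul1r.
  by rewrite -key; ring.
have G0 : G 0 = 0 by rewrite /G expr0n mul0r mulr0.
have mono (v dv : R -> R) : v 0 = 0 -> (forall s : R, is_derive s 1 v (dv s)) ->
    (forall s : R, 0 <= s <= 1 -> 0 <= dv s) -> 0 <= v t.
  move=> v0 hv hdv.
  have [|c] := @MVT_segment _ v dv 0 t t0 (fun s _ => hv s).
    by apply: derivable_within_continuous => s _; have [] := hv s.
  rewrite in_itv /= => /andP[c0 ct]; rewrite v0 !subr0 => ->.
  by rewrite mulr_ge0 // hdv // c0 (le_trans ct t1).
rewrite ler_norml; apply/andP; split.
  rewrite -subr_ge0 opprK addrC.
  apply: (mono (fun s => G s + u s) (fun s => K * (s ^+ n / n`!%:R) + du s)).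
  - by rewrite G0 u0 addr0.
  - by move=> s /hdu; rewrite ler_norml => /andP[]; lra.
rewrite -subr_ge0.
apply: (mono (fun s => G s - u s) (fun s => K * (s ^+ n / n`!%:R) - du s)).
- by rewrite G0 u0 subr0.
- by move=> s /hdu; rewrite ler_norml => /andP[]; lra.
Qed.

(** Taylor's formula along the segment from [0] to [z]: the [n]-th remainder is
    the derivative of the next one. *)
Let remainder_bound z n : let L := `|complex.Re z| + `|complex.Im z| in
  forall t, 0 <= t <= 1 ->
  `|complex.Re (cexp (t%:C * z)%C - exp_sum n (t%:C * z)%C)|
      <= expR L * L ^+ n * (t ^+ n / n`!%:R) /\
  `|complex.Im (cexp (t%:C * z)%C - exp_sum n (t%:C * z)%C)|
      <= expR L * L ^+ n * (t ^+ n / n`!%:R).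
Proof.
move=> L; have L0 : 0 <= L by rewrite addr_ge0.
elim: n => [|n IH] t t01.
  have [t0 t1] := andP t01.
  rewrite /exp_sum big_ord0 subr0 !expr0 mulr1 fact0 divr1 mulr1.
  have : normc (cexp (t%:C * z)%C) <= expR L.
    rewrite normc_cexp ler_expR ReZ.
    apply: (@le_trans _ _ `|complex.Re z|); last by rewrite /L lerDl.
    apply: le_trans (ler_norm _) _; rewrite normrM ger0_norm //.
    by rewrite ler_piMl.
  move=> h; split; first exact: le_trans (normcRe _) h.
  exact: le_trans (normcIm _) h.
set K := expR L * L ^+ n.+1.
have K0 : 0 <= K by rewrite mulr_ge0 ?expR_ge0 ?exprn_ge0.
pose E m s := cexp (s%:C * z)%C - exp_sum m (s%:C * z)%C.
have E0 : E n.+1 0 = 0.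
  rewrite /E mul0r cexp0; elim: (n) => [|m IHm].
    by rewrite exp_sumS /exp_sum big_ord0 add0r expr0 mulr1 invr1 subrr.
  by rewrite exp_sumS expr0n mulr0 addr0.
have bnd s : 0 <= s <= 1 ->
    `|complex.Re (E n s)| * L <= K * (s ^+ n / n`!%:R) /\
    `|complex.Im (E n s)| * L <= K * (s ^+ n / n`!%:R).
  move=> /IH[h1 h2]; rewrite /K exprS.
  have -> : expR L * (L * L ^+ n) * (s ^+ n / n`!%:R) =
    expR L * L ^+ n * (s ^+ n / n`!%:R) * L by ring.
  by split; rewrite ler_wpM2r.
have prodRe (a b : C) : complex.Re (a * b) =
    complex.Re a * complex.Re b - complex.Im a * complex.Im b by case: a b => ? ? [].
have prodIm (a b : C) : complex.Im (a * b) =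
    complex.Re a * complex.Im b + complex.Im a * complex.Re b by case: a b => ? ? [].
have combine (a b B : R) : `|a| * L <= B -> `|b| * L <= B ->
    `|a| * `|complex.Re z| + `|b| * `|complex.Im z| <= B.
  move=> ha hb; have n1 := normr_ge0 (complex.Re z); have n2 := normr_ge0 (complex.Im z).
  have [ab|/ltW ba] := leP `|a| `|b|.
    apply: le_trans hb; rewrite /L mulrDr lerD //; exact: ler_wpM2r.
  apply: le_trans ha; rewrite /L mulrDr lerD //; exact: ler_wpM2r.
split.
- apply: (@real_remainder (fun s => complex.Re (E n.+1 s))
    (fun s => complex.Re (E n s * z)) K n) => //.
  + by rewrite E0.
  + by move=> s; exact: (sder_line ReB ReZ normcRe (sder_remainder n _)).
  + move=> s /bnd[h1 h2]; rewrite prodRe; apply: le_trans (ler_normB _ _) _.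
    by rewrite !normrM; exact: combine.
- apply: (@real_remainder (fun s => complex.Im (E n.+1 s))
    (fun s => complex.Im (E n s * z)) K n) => //.
  + by rewrite E0.
  + by move=> s; exact: (sder_line ImB ImZ normcIm (sder_remainder n _)).
  + move=> s /bnd[h1 h2]; rewrite prodIm addrC; apply: le_trans (ler_normD _ _) _.
    by rewrite !normrM addrC [X in X <= _]addrC; exact: combine.
Qed.

Definition ccvg (u : nat -> C) (l : C) :=
  (fun n => complex.Re (u n)) @ \oo --> complex.Re l /\
  (fun n => complex.Im (u n)) @ \oo --> complex.Im l.

Lemma exp_sum_cvg z : ccvg (exp_sum^~ z) (cexp z).
Proof.
pose L := `|complex.Re z| + `|complex.Im z|.
have lim0 : (fun n => expR L * (L ^+ n / n`!%:R)) @ \oo --> (0 : R).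
  rewrite -[X in _ --> X](mulr0 (expR L)); apply: cvgM; first exact: cvg_cst.
  exact: cvg_exp_coeff.
have one : (1%:C * z)%C = z by rewrite mul1r.
have b01 : is_true ((0 : R) <= (1 : R) <= (1 : R)).
  by rewrite ler01 lexx.
have gen (u : nat -> R) (y : R) :
    (forall n, `|y - u n| <= expR L * (L ^+ n / n`!%:R)) -> u @ \oo --> y.
  move=> h; apply/cvgrPdist_le => e e0.
  have /cvgrPdist_le/(_ _ e0)[N _ HN] := lim0.
  exists N => // n /= Nn; apply: le_trans (h n) _.
  have := HN n Nn; rewrite /= sub0r normrN; apply: le_trans.
  exact: ler_norm.
split; apply: gen => n; have [h1 h2] := remainder_bound z n b01.
  by move: h1; rewrite one expr1n ReB mul1r mulrA.
by move: h2; rewrite one expr1n ImB mul1r mulrA.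
Qed.

Lemma cis_2pi_int (k : int) : cis (2 * pi * k%:~R : R) = 1.
Proof.
have nat_case (n : nat) : cis (2 * pi * n%:R : R) = 1.
  rewrite mulr_natr cisX; have -> : cis (2 * pi : R) = 1; last by rewrite expr1n.
  by rewrite mulr_natl /cis cos2pi sin2pi.
case: k => n; first exact: nat_case.
rewrite NegzE mulrNz mulrN.
have := nat_case n.+1; rewrite /cis cosN sinN => -[-> ->].
by rewrite oppr0.
Qed.

Lemma cos_eq1 x : cos x = 1 -> exists k : int, x = 2 * pi * k%:~R.
Proof.
move=> cx; have p0 : 0 < 2 * pi :> R by rewrite mulr_gt0 ?pi_gt0.
pose k := Num.floor (x / (2 * pi)); exists k.
pose r := x - 2 * pi * k%:~R.
have r0 : 0 <= r by rewrite subr_ge0 mulrC -ler_pdivlMr // floor_le.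
have r1 : r < 2 * pi.
  rewrite ltrBlDl -{2}(mulr1 (2 * pi)) -mulrDr mulrC -ltr_pdivrMr //.
  by have := floorD1_gt (x / (2 * pi)); rewrite -/k intrD1.
have cr : cos r = 1.
  have : cis r = cis x.
    have -> : x = r + 2 * pi * k%:~R by rewrite /r subrK.
    by rewrite cisD cis_2pi_int mulr1.
  by case=> ->.
apply/eqP; rewrite -subr_eq0 -/r; case: (eqVneq r 0) => [//|rn].
have rp : 0 < r by rewrite lt_neqAle eq_sym rn.
have s0 : 0 < sin (r / 2) by apply: sin_gt0_pi; apply/andP; split; lra.
have := cos_mulr2n (r / 2).
have -> : r / 2 *+ 2 = r by rewrite -mulr_natr divfK // pnatr_eq0.
rewrite cr cos2sin2 => h.
have : sin (r / 2) ^+ 2 = 0 by lra.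
by move/eqP; rewrite sqrf_eq0 gt_eqF.
Qed.

Lemma cexp_inj z w : cexp z = cexp w ->
  exists k : int, z = w + Complex 0 (2 * pi * k%:~R).
Proof.
move=> h.
have re : complex.Re z = complex.Re w.
  by apply: expR_inj; rewrite -!normc_cexp h.
have ci : cis (complex.Im z) = cis (complex.Im w).
  move: h; rewrite /cexp re => /mulfI; apply.
  by rewrite -normc_gt0 normc_real ger0_norm ?expR_ge0 // expR_gt0.
have c1 : cos (complex.Im z - complex.Im w) = 1.
  move: ci => [cE sE].
  by rewrite cosB cE sE -!expr2 cos2Dsin2.
have [k hk] := cos_eq1 c1; exists k.
move: re hk; case: (z) (w) => a b [c d] /= -> hk; simpc; congr Complex.
by rewrite -hk addrC subrK.
Qed.

Lemma cexp_ipi (k : nat) : cexp (Complex 0 (pi * k%:R)) = (-1) ^+ k.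
Proof.
rewrite /cexp /= expR0 mul1r mulr_natr cisX /cis cospi sinpi.
by congr (_ ^+ _); apply/eqP; rewrite eq_complex /= oppr0 !eqxx.
Qed.

End ComplexExponential.

(** * The star exponential in closed form *)

Section BiquaternionExponential.
Context {R : realType}.
Local Notation C := R[i].
Local Notation biquat := (biquat (R := R)).
Implicit Types (A B : biquat) (I : quat R) (x y X Y s : C).

Definition combo x y A : biquat := badd (bscalar x) (bscale y (bvec A)).

Lemma bmul_combo A x y :
  bmul A (combo x y A) = combo (b0 A * x - bdot A A * y) (b0 A * y + x) A.
Proof. by case: A => ? ? ? ?; apply: bq_ext; rewrite /= /bdot /=; ring. Qed.

Definition iu : C := Complex 0 1.

Lemma iu2 : iu * iu = -1. Proof. exact: sqr_i. Qed.

Lemma iu_neq0 : iu != 0.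
Proof. by rewrite /iu eq_complex /= oner_eq0 andbF. Qed.

Lemma complex2_neq0 : (2 : C) != 0. Proof. by rewrite pnatr_eq0. Qed.

(** [X + Y f_v] is the exponential of a stem value [A = f_0 + f_v]: since
    [f_v^2 = - u] with [u = f_v^s], the algebra generated by [A] has the
    eigenvalues [f_0 + i s] and [f_0 - i s], where [s^2 = u]. *)
Definition bexp A X Y := exists2 s, s ^+ 2 = bdot A A &
  if s == 0 then X = cexp (b0 A) /\ Y = cexp (b0 A) else
  X = (cexp (b0 A + iu * s) + cexp (b0 A - iu * s)) / 2 /\
  Y = (cexp (b0 A + iu * s) - cexp (b0 A - iu * s)) / (2 * iu * s).

Lemma bexp_exists A : exists X Y, bexp A X Y.
Proof.
have [s0|s0] := eqVneq (sqrtc (bdot A A)) 0.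
  exists (cexp (b0 A)), (cexp (b0 A)), (sqrtc (bdot A A)); first exact: sqr_sqrtc.
  by rewrite s0 eqxx.
eexists; eexists; exists (sqrtc (bdot A A)); first exact: sqr_sqrtc.
by rewrite (negPf s0).
Qed.

Let bpow_diag A s n : s ^+ 2 = bdot A A -> s != 0 ->
  iter n (bmul A) (bscalar 1) =
  combo (((b0 A + iu * s) ^+ n + (b0 A - iu * s) ^+ n) / 2)
        (((b0 A + iu * s) ^+ n - (b0 A - iu * s) ^+ n) / (2 * iu * s)) A.
Proof.
move=> su s0; elim: n => [|n IH].
  rewrite /= !expr0 subrr mul0r -mulr2n -(mulr_natl 1 2) mulr1 divff //.
  by case: A {su} => *; apply: bq_ext; rewrite /= ?mul0r ?addr0.
rewrite iterS IH bmul_combo -su [(_ + _) ^+ n.+1]exprS [(_ - _) ^+ n.+1]exprS.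
move: (_ ^+ n) (_ ^+ n) => q p.
congr combo; last by field; rewrite s0 iu_neq0.
have -> : s ^+ 2 * ((p - q) / (2 * iu * s)) = - (iu * s * (p - q) / 2).
  have iiV : iu^-1 = - iu by apply: (mulfI iu_neq0); rewrite divff ?iu_neq0 // mulrN iu2 opprK.
  by rewrite !invfM iiV; field.
by field.
Qed.

Let bpow_nil A n : bdot A A = 0 ->
  iter n (bmul A) (bscalar 1) = combo (b0 A ^+ n) (n%:R * b0 A ^+ n.-1) A.
Proof.
move=> u0; elim: n => [|n IH].
  by case: A {u0} => *; apply: bq_ext; rewrite /= ?mul0r ?addr0.
rewrite iterS IH bmul_combo u0 mul0r subr0 exprS; congr combo.
by case: n {IH} => [|n]; rewrite ?mul0r ?mulr0 ?add0r ?expr0 ?mulr1 //= -(natr1 n.+1) exprS; ring.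
Qed.

Lemma ev_combo I x y A : imag_units I -> ev I (combo x y A) =
  complex.Re x *: 1 + complex.Im x *: I + complex.Re y *: ev I (bvec A)
  + complex.Im y *: (I * ev I (bvec A)).
Proof.
move=> II; rewrite /combo ev_add -ev_scalar // !ev_bscalar mulrDl -!scalerAl mul1r.
by rewrite addrA.
Qed.

Lemma ccvgD (u v : nat -> C) l m : ccvg u l -> ccvg v m -> ccvg (fun n => u n + v n) (l + m).
Proof.
have ReD (a b : C) : complex.Re (a + b) = complex.Re a + complex.Re b by case: a b => ? ? [].
have ImD (a b : C) : complex.Im (a + b) = complex.Im a + complex.Im b by case: a b => ? ? [].
move=> [u1 u2] [v1 v2]; split.
  by rewrite ReD; under eq_fun do rewrite ReD; exact: cvgD.
by rewrite ImD; under eq_fun do rewrite ImD; exact: cvgD.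
Qed.

Lemma ccvgM c (u : nat -> C) l : ccvg u l -> ccvg (fun n => u n * c) (l * c).
Proof.
have prodRe (a b : C) : complex.Re (a * b) =
    complex.Re a * complex.Re b - complex.Im a * complex.Im b by case: a b => ? ? [].
have prodIm (a b : C) : complex.Im (a * b) =
    complex.Re a * complex.Im b + complex.Im a * complex.Re b by case: a b => ? ? [].
move=> [u1 u2]; split.
  by rewrite prodRe; under eq_fun do rewrite prodRe; apply: cvgB; apply: cvgM => //; exact: cvg_cst.
by rewrite prodIm; under eq_fun do rewrite prodIm; apply: cvgD; apply: cvgM => //; exact: cvg_cst.
Qed.

Let exp_sum_shift z n :
  \sum_(k < n) (k`!%:R)^-1 * (k%:R * z ^+ k.-1) = exp_sum n.-1 z :> C.
Proof.
elim: n => [|n IH]; first by rewrite /exp_sum !big_ord0.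
rewrite big_ord_recr /= IH; case: n {IH} => [|n].
  by rewrite mul0r mulr0 addr0.
rewrite exp_sumS /=; congr (_ + _).
by rewrite factS natrM invfM mulrACA mulVf ?pnatr_eq0 // mul1r.
Qed.

(** The powers of [A] stay in the plane spanned by [1] and the vector part. *)
Lemma bexp_series A X Y : bexp A X Y -> exists x y : nat -> C,
  [/\ forall n, iter n (bmul A) (bscalar 1) = combo (x n) (y n) A,
      ccvg (fun n => \sum_(k < n) (k`!%:R)^-1 * x k) X &
      ccvg (fun n => \sum_(k < n) (k`!%:R)^-1 * y k) Y].
Proof.
case=> s su; case: eqVneq => [s0|s0] [-> ->].
  have u0 : bdot A A = 0 by rewrite -su s0 expr0n.
  exists (fun n => b0 A ^+ n), (fun n => n%:R * b0 A ^+ n.-1); split.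
  - by move=> n; exact: bpow_nil.
  - exact: exp_sum_cvg.
  - under eq_fun do rewrite exp_sum_shift.
    have [h1 h2] := exp_sum_cvg (b0 A).
    by split; rewrite -cvg_shiftS.
exists (fun n => ((b0 A + iu * s) ^+ n + (b0 A - iu * s) ^+ n) / 2).
exists (fun n => ((b0 A + iu * s) ^+ n - (b0 A - iu * s) ^+ n) / (2 * iu * s)).
have eP := exp_sum_cvg (b0 A + iu * s); have eM := exp_sum_cvg (b0 A - iu * s).
split.
- by move=> n; exact: bpow_diag.
- rewrite (_ : (fun n => _) = (fun n => (exp_sum n (b0 A + iu * s) + exp_sum n (b0 A - iu * s)) / 2)).
    exact: ccvgM (ccvgD eP eM).
  apply/funext => n; rewrite /exp_sum -big_split mulr_suml; apply: eq_bigr => k _ /=.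
  by rewrite -mulrDr mulrA.
- rewrite (_ : (fun n => _) = (fun n => (exp_sum n (b0 A + iu * s)
      + exp_sum n (b0 A - iu * s) * (-1)) / (2 * iu * s))).
    rewrite -[X in X / _](_ : cexp (b0 A + iu * s) + cexp (b0 A - iu * s) * (-1) = _).
      exact: ccvgM (ccvgD eP (ccvgM _ eM)).
    by rewrite mulrN1.
  apply/funext => n; rewrite /exp_sum mulrN1 -sumrB mulr_suml; apply: eq_bigr => k _ /=.
  by rewrite -mulrBr mulrA.
Qed.

Lemma exp_star_at Om f F : circular_domain Om -> evaluates Om f F ->
  forall I z X Y, imag_units I -> cdom Om z -> bexp (F z) X Y ->
  exp_star f (slice_pt I (pair_of z)) = ev I (combo X Y (F z)).
Proof.
move=> dom fF I z X Y II Dz /bexp_series[x [y [pw cx cy]]].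
set q := slice_pt I (pair_of z).
pose xs n := \sum_(k < n) (k`!%:R)^-1 * x k; pose ys n := \sum_(k < n) (k`!%:R)^-1 * y k.
have partial n : series (fun k => (k`!%:R : R)^-1 *: star_exp f k q) n =
    ev I (combo (xs n) (ys n) (F z)).
  elim: n => [|n IH].
    by rewrite /series /= big_geq // ev_combo // /xs /ys !big_ord0 /= !scale0r !addr0.
  rewrite seriesSr IH.
  rewrite (star_exp_evaluates n dom fF) // pw !ev_combo // /xs /ys !big_ord_recr /=.
  move: (\sum_(_ < n) _) (\sum_(_ < n) _) (x n) (y n) => [a a'] [b b'] [c c'] [d d'].
  have fE : (n`!%:R)^-1 = ((n`!%:R)^-1)%:C%C :> C by rewrite fmorphV rmorph_nat.
  rewrite fE; simpc; rewrite /= !scalerDr !scalerA !scalerDl.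
  by rewrite addrACA; congr (_ + _); rewrite addrACA; congr (_ + _); rewrite addrACA.
rewrite /exp_star (_ : series _ = fun n => ev I (combo (xs n) (ys n) (F z))); last exact/funext.
apply: cvg_lim => //.
rewrite ev_combo //; under eq_fun do rewrite ev_combo //.
have [x1 x2] := cx; have [y1 y2] := cy.
by do 3?[apply: cvgD]; apply: cvgZr_tmp.
Qed.

End BiquaternionExponential.

(** * Stem values with equal exponentials *)

Section EqualExponentials.
Context {R : realType}.
Local Notation C := R[i].
Local Notation biquat := (biquat (R := R)).
Implicit Types (A B : biquat) (F G : C -> biquat) (I : quat R) (X Y s z : C)
  (Om : set (quat R)).

Definition piC (k : int) : C := ((pi * k%:~R)%:C)%C.

Lemma piCD j k : piC (j + k) = piC j + piC k.
Proof. by rewrite /piC intrD mulrDr rmorphD. Qed.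

Lemma piCB j k : piC (j - k) = piC j - piC k.
Proof. by rewrite /piC intrB mulrBr rmorphB. Qed.

Lemma piC0 : piC 0 = 0. Proof. by rewrite /piC mulr0. Qed.

Lemma piC_eq0 k : (piC k == 0) = (k == 0).
Proof.
rewrite /piC -(rmorph0 (real_complex R)) (inj_eq (@complexI R)) mulf_eq0.
by rewrite (gt_eqF (pi_gt0 R)) intr_eq0.
Qed.

Let ipiE (k : int) : Complex 0 (2 * pi * k%:~R) = 2 * (iu * piC k) :> C.
Proof.
have -> : (2 : C) = (2%:C)%C by rewrite rmorph_nat.
by rewrite /iu /piC; simpc; congr Complex; ring.
Qed.

Let cexp_injE X Y : cexp X = cexp Y -> exists k, X = Y + 2 * (iu * piC k).
Proof. by move=> /cexp_inj[k ->]; exists k; rewrite ipiE. Qed.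

Definition bparallel A B :=
  [/\ b1 A * b2 B = b2 A * b1 B, b2 A * b3 B = b3 A * b2 B &
      b1 A * b3 B = b3 A * b1 B].

Definition bsub A B := Biquat (b0 A - b0 B) (b1 A - b1 B) (b2 A - b2 B) (b3 A - b3 B).

(** Pointwise form of the theorem.  Where the vector part of the common
    exponential does not vanish, the vector parts of [A] and [B] are
    [s H] and [s' H] with the same [H], and the eigenvalues [b0 A + i s],
    [b0 A - i s] of [A] differ from those of [B] by [2 i pi a] and [2 i pi b]. *)
Lemma equal_bexp A B X Y X' Y' : bexp A X Y -> bexp B X' Y' ->
  combo X Y A = combo X' Y' B -> Y != 0 -> bvec A <> bscalar 0 ->
  exists a b : int, [/\ b0 B = b0 A + iu * piC (a + b),
    bdot (bsub B A) (bsub B A) = piC (a - b) ^+ 2, bparallel A B &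
    a = b -> bvec B = bvec A].
Proof.
move=> [s su hA] [s' su' hB] E Y0 v0.
have eX : X = X' by have := congr1 b0 E; rewrite /= !mulr0 !addr0.
have e1 : Y * b1 A = Y' * b1 B by have := congr1 b1 E; rewrite /= !add0r.
have e2 : Y * b2 A = Y' * b2 B by have := congr1 b2 E; rewrite /= !add0r.
have e3 : Y * b3 A = Y' * b3 B by have := congr1 b3 E; rewrite /= !add0r.
have Y'0 : Y' != 0.
  apply/eqP => Y'0; apply: v0; rewrite Y'0 !mul0r in e1 e2 e3.
  by move/eqP: e1; move/eqP: e2; move/eqP: e3; rewrite !mulf_eq0 (negPf Y0) /=;
     move=> /eqP h3 /eqP h2 /eqP h1; apply: bq_ext.
have dots : Y ^+ 2 * s ^+ 2 = Y' ^+ 2 * s' ^+ 2.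
  rewrite su su' /bdot.
  transitivity ((Y * b1 A) ^+ 2 + (Y * b2 A) ^+ 2 + (Y * b3 A) ^+ 2); first by ring.
  by rewrite e1 e2 e3; ring.
have [s0|s0] := eqVneq s 0.
  have s'0 : s' = 0.
    move: dots; rewrite s0 expr0n mulr0 => /esym/eqP.
    by rewrite mulf_eq0 !sqrf_eq0 (negPf Y'0) => /eqP.
  move: hA hB; rewrite s0 s'0 eqxx => -[XA YA] [XB YB].
  have YY : Y = Y' by rewrite YA YB -XA -XB.
  have h1 : b1 A = b1 B by apply: (mulfI Y0); rewrite e1 YY.
  have h2 : b2 A = b2 B by apply: (mulfI Y0); rewrite e2 YY.
  have h3 : b3 A = b3 B by apply: (mulfI Y0); rewrite e3 YY.
  have /cexp_injE[k hk] : cexp (b0 B) = cexp (b0 A) by rewrite -XA -XB.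
  exists k, k; split.
  - by rewrite hk piCD; ring.
  - by rewrite subrr piC0 expr0n /bdot /= h1 h2 h3 !subrr !mul0r !addr0.
  - by rewrite /bparallel h1 h2 h3; split; rewrite mulrC.
  - by move=> _; rewrite /bvec h1 h2 h3.
have s'0 : s' != 0.
  apply/eqP => s'0; move: dots; rewrite s'0 expr0n mulr0 => /eqP.
  by rewrite mulf_eq0 !sqrf_eq0 (negPf Y0) (negPf s0).
move: hA hB; rewrite (negPf s0) (negPf s'0) => -[XA YA] [XB YB].
have lamA : cexp (b0 A + iu * s) = X + iu * (Y * s).
  by rewrite XA YA; field; rewrite s0 iu_neq0.
have muA : cexp (b0 A - iu * s) = X - iu * (Y * s).
  by rewrite XA YA; field; rewrite s0 iu_neq0.
have lamB : cexp (b0 B + iu * s') = X' + iu * (Y' * s').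
  by rewrite XB YB; field; rewrite s'0 iu_neq0.
have muB : cexp (b0 B - iu * s') = X' - iu * (Y' * s').
  by rewrite XB YB; field; rewrite s'0 iu_neq0.
(* The sign of [s'] for which the two vector parts have the same direction. *)
have [t tQ [lamT muT]] : exists2 t, Y' * t = Y * s &
    cexp (b0 B + iu * t) = X + iu * (Y * s) /\ cexp (b0 B - iu * t) = X - iu * (Y * s).
  have : (Y' * s') ^+ 2 == (Y * s) ^+ 2 by rewrite !exprMn dots.
  rewrite eqf_sqr => /orP[/eqP h|/eqP h].
    by exists s' => //; rewrite lamB muB -eX h.
  exists (- s'); first by rewrite mulrN h opprK.
  rewrite mulrN opprK muB lamB -eX h.
  by rewrite !mulrN opprK.
have [a ha] : exists k, b0 B + iu * t = b0 A + iu * s + 2 * (iu * piC k).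
  by apply: cexp_injE; rewrite lamT lamA.
have [b hb] : exists k, b0 B - iu * t = b0 A - iu * s + 2 * (iu * piC k).
  by apply: cexp_injE; rewrite muT muA.
have tE : t = s + piC (a - b).
  apply: (mulfI iu_neq0); apply: (mulfI complex2_neq0).
  have -> : 2 * (iu * t) = (b0 B + iu * t) - (b0 B - iu * t) by ring.
  by rewrite ha hb piCB; ring.
have prop l l' : Y * l = Y' * l' -> s * l' = t * l.
  move=> h; apply: (mulfI Y'0).
  have -> : Y' * (t * l) = (Y' * t) * l by ring.
  have -> : Y' * (s * l') = s * (Y' * l') by ring.
  by rewrite tQ -h; ring.
have p1 := prop _ _ e1; have p2 := prop _ _ e2; have p3 := prop _ _ e3.
exists a, b; split.
- apply: (mulfI complex2_neq0).
  have -> : 2 * b0 B = (b0 B + iu * t) + (b0 B - iu * t) by ring.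
  by rewrite ha hb piCD; ring.
- have s20 : s ^+ 2 != 0 by rewrite sqrf_eq0.
  apply: (mulfI s20); rewrite [in RHS]su /bdot /=.
  transitivity ((s * b1 B - s * b1 A) ^+ 2 + (s * b2 B - s * b2 A) ^+ 2 +
    (s * b3 B - s * b3 A) ^+ 2); first by ring.
  by rewrite p1 p2 p3 tE; ring.
- have par l l' m m' : s * l' = t * l -> s * m' = t * m -> l * m' = m * l'.
    move=> h1 h2; apply: (mulfI s0).
    have -> : s * (l * m') = l * (s * m') by ring.
    by rewrite h2 -[s * (m * l')]mulrCA h1; ring.
  by split; apply: par.
- move=> ab; rewrite ab subrr piC0 addr0 in tE; rewrite tE in p1 p2 p3.
  by rewrite /bvec (mulfI s0 p1) (mulfI s0 p2) (mulfI s0 p3).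
Qed.

(** [sin s / s] vanishes exactly where [s^2 = (k pi)^2] with [k > 0]. *)
Definition resonant A := exists2 k : nat, (0 < k)%N & bdot A A = piC k ^+ 2.

Let cexp_piC (k : nat) : cexp (iu * piC k) = (-1) ^+ k /\ cexp (- (iu * piC k)) = (-1) ^+ k.
Proof.
have e : iu * piC k = Complex 0 (pi * k%:R) by rewrite /iu /piC; simpc.
rewrite cexpN e cexp_ipi; split=> //.
by rewrite -exprVn invrN1.
Qed.

Lemma bexp_resonant A X Y (k : nat) : (0 < k)%N -> bdot A A = piC k ^+ 2 ->
  bexp A X Y -> X = (-1) ^+ k * cexp (b0 A) /\ Y = 0.
Proof.
move=> k0 uk [s su].
have pk : piC k != 0 by rewrite piC_eq0 eqz_nat -lt0n.
have [c1 c2] := cexp_piC k.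
have : s ^+ 2 == piC k ^+ 2 by rewrite su uk.
rewrite eqf_sqr => /orP[/eqP ->|/eqP ->].
  rewrite (negPf pk) => -[-> ->]; rewrite !cexpD c1 c2 subrr mul0r; split=> //.
  by field.
rewrite oppr_eq0 (negPf pk) !mulrN opprK => -[-> ->].
rewrite !cexpD c1 c2 subrr mul0r; split=> //.
by field.
Qed.

Lemma bexp_nonresonant A X Y : bexp A X Y -> Y = 0 -> resonant A.
Proof.
move=> [s su]; have [s0|s0] := eqVneq s 0.
  by move=> [_ ->] /eqP; rewrite (negPf (cexp_neq0 _)).
move=> [_ ->] /eqP; rewrite mulf_eq0 invr_eq0 !mulf_eq0 (negPf complex2_neq0) (negPf s0).
rewrite (negPf iu_neq0) /= orbF subr_eq0 => /eqP/cexp_injE[k hk].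
have sk : s = piC k.
  apply: (mulfI iu_neq0); apply: (mulfI complex2_neq0).
  have -> : 2 * (iu * s) = (b0 A + iu * s) - (b0 A - iu * s) by ring.
  by rewrite hk; ring.
exists `|k|%N; first by rewrite absz_gt0 -piC_eq0 -sk.
rewrite -su sk /piC -!rmorphXn /=; congr (_%:C)%C.
by rewrite !exprMn abszE intr_norm real_normK ?num_real.
Qed.

Lemma piC_gap (j k : int) : (piC j ^+ 2 != piC k ^+ 2) ->
  1 <= normc (piC j ^+ 2 - piC k ^+ 2).
Proof.
have sqE l : piC l ^+ 2 = ((pi ^+ 2 * (l ^+ 2)%:~R)%:C)%C.
  by rewrite /piC -rmorphXn exprMn -rmorphXn.
rewrite !sqE => jk.
have {}jk : j ^+ 2 != k ^+ 2 by apply: contra jk => /eqP ->.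
rewrite -rmorphB normc_real -mulrBr -intrB normrM.
have p1 : 1 <= `|pi ^+ 2 : R|.
  have := pi_ge2 R => p2; rewrite ger0_norm ?sqr_ge0 // expr2.
  by rewrite (le_trans (_ : 1 <= pi)) // ?ler_peMl //; lra.
rewrite -[X in X <= _]mul1r ler_pM // -intr_norm.
rewrite -[X in X <= _]/((1%Z)%:~R) ler_int -gtz0_ge1.
by rewrite normr_gt0 subr_eq0.
Qed.

Lemma normc_iu : normc (iu : C) = 1.
Proof. by rewrite /= expr0n add0r expr1n sqrtr1. Qed.

Lemma normc_piC_ge1 (k : int) : k != 0 -> 1 <= normc (piC k).
Proof.
move=> k0; rewrite /piC normc_real normrM ger0_norm ?pi_ge0 //.
have p1 : 1 <= pi :> R by have := pi_ge2 R; lra.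
rewrite -[X in X <= _]mul1r ler_pM // -intr_norm.
by rewrite -[X in X <= _]/((1%Z)%:~R) ler_int -gtz0_ge1 normr_gt0.
Qed.

(** Only finitely many of the values [(k pi)^2] are close to [f_v^s], so that
    being resonant is a closed condition. *)
Lemma resonant_gap A : ~ resonant A -> exists2 e, 0 < e &
  forall k : nat, (0 < k)%N -> e <= normc (bdot A A - piC k ^+ 2).
Proof.
move=> nr; set u := bdot A A.
pose N := (Num.truncn (normc u)).+2.
have far (k : nat) : (N <= k)%N -> 1 <= normc (u - piC k ^+ 2).
  move=> Nk.
  have uk : normc u + 1 <= k%:R.
    apply: le_trans (_ : N%:R <= _); last by rewrite ler_nat.
    by rewrite /N -natr1 lerD2r ltW // truncnS_gt.
  have k1 : 1 <= k%:R :> R by rewrite ler1n (leq_trans _ Nk).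
  have pk : k%:R <= normc (piC k ^+ 2).
    rewrite normcX /piC normc_real ger0_norm ?mulr_ge0 ?pi_ge0 //.
    have p1 : 1 <= pi :> R by have := pi_ge2 R; lra.
    have h : k%:R <= pi * k%:R :> R by rewrite ler_peMl.
    apply: (le_trans h); rewrite expr2 ler_peMl ?mulr_ge0 ?pi_ge0 //.
    exact: le_trans k1 h.
  have := normc_triangle u (piC k ^+ 2) 0; rewrite !subr0 (normcB (piC k ^+ 2)).
  by lra.
have near : forall n, exists2 e, 0 < e & forall k : nat, (0 < k)%N -> (k < n)%N ->
    e <= normc (u - piC k ^+ 2).
  elim=> [|n [e e0 IH]]; first by exists 1.
  have [n0|n0] := posnP n.
    by exists 1 => // k k0; rewrite n0 ltnS leqNgt k0.
  have d0 : 0 < normc (u - piC n ^+ 2).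
    by rewrite normc_gt0 subr_eq0; apply/eqP => h; apply: nr; exists n.
  exists (Num.min e (normc (u - piC n ^+ 2))); first by rewrite lt_min e0.
  move=> k k0; rewrite ltnS leq_eqVlt => /orP[/eqP ->|kn].
    by rewrite ge_min lexx orbT.
  by rewrite ge_min IH.
have [e e0 He] := near N.
exists (Num.min e 1); first by rewrite lt_min e0 ltr01.
move=> k k0; have [kN|kN] := ltnP k N; first by rewrite ge_min He.
by rewrite ge_min far // orbT.
Qed.

Lemma shol_dot Om F G : (forall z, cdom Om z -> bholo F z) ->
  (forall z, cdom Om z -> bholo G z) -> shol Om (fun z : C => bdot (F z) (G z)).
Proof.
move=> hF hG z Dz; have [f0 f1 f2 f3] := hF z Dz; have [g0 g1 g2 g3] := hG z Dz.
by apply: holoD; [apply: holoD|]; apply: holoM.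
Qed.

Lemma bdot_conj A B : bdot (bconj A) (bconj B) = (bdot A B)^*%C.
Proof. by rewrite /bdot /= !rmorphD /= !rmorphM. Qed.

Lemma piC_conj k : (piC k)^*%C = piC k.
Proof. exact: conjc_real. Qed.

Lemma piC2_conj k : (piC k ^+ 2)^*%C = piC k ^+ 2.
Proof. by rewrite rmorphXn; congr (_ ^+ 2); exact: piC_conj. Qed.

Lemma bvec_neq0_near F z : bholo F z -> bvec (F z) <> bscalar 0 ->
  exists2 d, 0 < d & forall w, normc (w - z) < d -> bvec (F w) <> bscalar 0.
Proof.
have nz (b : biquat -> C) : holo (fun w => b (F w)) z -> b (F z) != 0 ->
    exists2 d, 0 < d & forall w, normc (w - z) < d -> b (F w) != 0.
  move=> hb; rewrite -normc_gt0 => b0; have [d d0 Hd] := holo_cont hb b0.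
  exists d => // w /Hd h; apply: contraTneq h => ->.
  by rewrite sub0r normc_opp ltxx.
move=> [h0 h1 h2 h3] vz.
have [e1|e1] := eqVneq (b1 (F z)) 0; last first.
  by have [d d0 Hd] := nz _ h1 e1; exists d => // w /Hd/eqP hw [].
have [e2|e2] := eqVneq (b2 (F z)) 0; last first.
  by have [d d0 Hd] := nz _ h2 e2; exists d => // w /Hd/eqP hw [].
have [e3|e3] := eqVneq (b3 (F z)) 0; last first.
  by have [d d0 Hd] := nz _ h3 e3; exists d => // w /Hd/eqP hw [].
by exfalso; apply: vz; apply: bq_ext.
Qed.

(** If the exponential has no vector part, then [f_v] vanishes or [f_v^s] is
    a constant [(k pi)^2], and the exponential is [(-1)^k exp f_0]. *)
Lemma exp_slice_preserving Om f F : circular_domain Om -> represents Om f F ->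
  (forall q, Om q -> bvec (F (halfpt q)) = bscalar 0 \/ resonant (F (halfpt q))) ->
  slice_preserving Om (exp_star f).
Proof.
move=> dom fF H; have [hol sym _] := fF; have fE := represents_evaluates fF.
have cexp_conj z : cexp z^*%C = (cexp z)^*%C.
  by case: z => a b; rewrite /cexp /cis /= cosN sinN; simpc.
suff [c csym hc] : exists2 c : C, c^*%C = c & forall z, cdom Om z ->
    forall X Y, bexp (F z) X Y -> combo X Y (F z) = bscalar (c * cexp (b0 (F z))).
  pose Gs z := bscalar (c * cexp (b0 (F z))).
  apply: (@scalar_preserving _ Om _ Gs) => //; split.
  - move=> z Dz; have [h0 _ _ _] := hol z Dz.
    split; try exact: holo_cst.
    apply: holoM; first exact: holo_cst.
    by apply: (holo_comp h0); exact: holo_cexp.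
  - move=> z Dz; rewrite /Gs sym //.
    by apply: bq_ext; rewrite /= ?oppr0 // rmorphM /= csym cexp_conj.
  - move=> I z II Dz; have [X [Y XY]] := bexp_exists (F z).
    by rewrite (exp_star_at dom fE II Dz XY) (hc _ Dz _ _ XY).
have all z : cdom Om z -> bvec (F z) = bscalar 0 \/ resonant (F z).
  move: z; apply: (half_to_all dom) => // z Dz [v0|[k k0 uk]]; rewrite sym //.
    by left; case: v0 => e1 e2 e3; apply: bq_ext; rewrite //= ?e1 ?e2 ?e3 conjc0.
  by right; exists k => //; rewrite bdot_conj uk piC2_conj.
have [allv|] := pselect (forall z, cdom Om z -> bvec (F z) = bscalar 0).
  exists 1; first exact: conjc1.
  move=> z Dz X Y [s su]; have [e1 e2 e3] := allv z Dz.
  have s0 : s = 0.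
    by apply/eqP; rewrite -sqrf_eq0 su /bdot e1 e2 e3 !mul0r !addr0.
  rewrite s0 eqxx => -[-> _].
  by apply: bq_ext; rewrite /= ?e1 ?e2 ?e3 ?mulr0 ?addr0 ?mul1r.
move=> /existsNP[z1 /not_implyP[Dz1 v1]].
have [//|[k k0 uk]] := all _ Dz1.
exists ((-1) ^+ k); first by rewrite rmorphXn rmorphN /= oppr0.
suff res z : cdom Om z -> bdot (F z) (F z) - piC k ^+ 2 = 0.
  move=> z Dz X Y XY.
  have uz : bdot (F z) (F z) = piC k ^+ 2 by apply/eqP; rewrite -subr_eq0 res.
  have [-> ->] := bexp_resonant k0 uz XY.
  by apply: bq_ext; rewrite /= ?mul0r ?addr0.
move: z; apply: (half_to_all dom) => [z Dz|].
  rewrite sym // bdot_conj => h.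
  by rewrite -[piC k ^+ 2]piC2_conj -rmorphB h rmorph0.
have hu : shol Om (fun z => bdot (F z) (F z) - piC k ^+ 2).
  by move=> z Dz; apply: holoB; [exact: (shol_dot hol hol) | exact: holo_cst].
have [q1 Oq1 q1z] : exists2 q, Om q & halfpt q = z1 \/ halfpt q = z1^*%C.
  have II := @imag_unit_Qi R.
  have [z0|z0] := leP 0 (complex.Im z1).
    exists (slice_pt Qi (pair_of z1)); first exact: circular_slice.
    by left; rewrite halfpt_slice.
  exists (slice_pt Qi (pair_of z1^*%C)); first by apply: circular_slice => //; exact: cdom_conj.
  right; rewrite halfpt_slice //.
  by case: (z1) z0 => x y /= y0; rewrite oppr_ge0 ltW.
apply: (identity_theorem dom hu Oq1).
have {q1z} [Dq vq uq] : [/\ cdom Om (halfpt q1), bvec (F (halfpt q1)) <> bscalar 0 &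
    bdot (F (halfpt q1)) (F (halfpt q1)) = piC k ^+ 2].
  case: q1z => ->; first by [].
  split; first exact: cdom_conj.
    rewrite sym // => -[/eqP e1 /eqP e2 /eqP e3]; apply: v1.
    rewrite !conjc_eq0 in e1 e2 e3.
    by apply: bq_ext => //=; apply/eqP.
  by rewrite sym // bdot_conj uk piC2_conj.
have [r r0 Hr] := copen_disc (cdom_open dom) Dq.
have [d d0 Hd] := bvec_neq0_near (hol _ Dq) vq.
have [c c0 Hc] := holo_cont (hu _ Dq) (ltr01 : 0 < 1 :> R).
exists (Num.min r (Num.min d c)); first by rewrite !lt_min r0 d0 c0.
move=> w; rewrite !lt_min => /and3P[wr wd wc].
have [//|[k' k'0 uk']] := all w (Hr _ (ltW wr)).
  by move/(Hd _ wd).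
have := Hc _ wc; rewrite uq subrr subr0 uk' => close.
have [->|kk] := eqVneq (piC k' ^+ 2) (piC k ^+ 2); first by rewrite subrr.
by have := piC_gap kk; rewrite leNgt close.
Qed.

End EqualExponentials.

(** * Functions of the form a H *)

Section PolarForm.
Context {R : realType}.
Local Notation C := R[i].
Local Notation biquat := (biquat (R := R)).
Implicit Types (I q : quat R) (z w c : C) (f g : quat R -> quat R) (a : C -> C).
Implicit Types (F G H : C -> biquat) (A B : biquat) (Om : set (quat R)).

(** [f = a H] with [a] slice preserving and [H] a vectorial function with
    [H^s = 1]; the data are stem functions. *)
Definition polar Om f F a H :=
  [/\ represents Om f F, shol Om a, ssym Om a, represents Om (slice_fun H) H &
      forall z, cdom Om z ->
        [/\ F z = bscale (a z) (H z), b0 (H z) = 0 & bdot (H z) (H z) = 1]].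

Lemma ev_scalarM I c c' : imag_units I ->
  ev I (bscalar c) * ev I (bscalar c') = ev I (bscalar (c * c')).
Proof.
by move=> II; rewrite ev_scalar //; congr ev; apply: bq_ext; rewrite /= ?mulr0.
Qed.

Lemma ev_scalarX I c n : imag_units I ->
  ev I (bscalar c) ^+ n = ev I (bscalar (c ^+ n)).
Proof.
move=> II; elim: n => [|n IH]; first by rewrite ev_one.
by rewrite !exprS IH ev_scalarM.
Qed.

Lemma ev_scalarD I c c' :
  ev I (bscalar c) + ev I (bscalar c') = ev I (bscalar (c + c')).
Proof. by rewrite -ev_add; congr ev; apply: bq_ext; rewrite /= ?addr0. Qed.

Lemma ev_real I (x : R) : ev I (bscalar (x%:C)%C) = x%:A.
Proof. by rewrite ev_bscalar /= scale0r addr0. Qed.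

Lemma ev0 I : ev I (bscalar 0) = 0.
Proof. by rewrite ev_bscalar /= !scale0r addr0. Qed.

Lemma polar_sqrt Om f F a H : circular_domain Om -> polar Om f F a H ->
  has_sqrt Om (symm Om f).
Proof.
move=> dom [fF ha sa hH pF]; exists (scalar_fun a); first exact: scalar_fun_preserving.
move=> q; rewrite inE => Oq.
have [I [II gE e _]] := evaluates_at (symm_evaluates dom fF) Oq.
rewrite e (gE _ _ (represents_evaluates (scalar_fun_represents dom ha sa))) ev_scalarX //.
have [-> e0 e1] := pF _ (cdom_halfpt Oq); congr (ev I (bscalar _)).
rewrite /= e0 mulr0 expr0n add0r /bdot /=; rewrite /bdot in e1.
by rewrite -[LHS]mulr1 -e1; ring.
Qed.

(** Since [f * f = - a^2], a function that multiplies [f] to zero is killed by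
    [a^2], and then vanishes by the identity theorem. *)
Lemma polar_not_zero_divisor Om f F a H : circular_domain Om ->
  polar Om f F a H -> ~ zero_divisor Om f.
Proof.
move=> dom [fF ha sa hH pF] [fn0 [g [gr gn0 fg0]]].
have [G gG] := regular_represents dom gr.
have fE := represents_evaluates fF; have gE := represents_evaluates gG.
have zE : evaluates Om (fun=> 0) (fun=> bscalar 0) by move=> I z _ _; rewrite ev0.
have key z : cdom Om z -> bscale (a z ^+ 2) (G z) = bscalar 0.
  move=> Dz; have [Fz e0 e1] := pF z Dz; rewrite /bdot in e1.
  have e2 : a z ^+ 2 = b1 (F z) ^+ 2 + b2 (F z) ^+ 2 + b3 (F z) ^+ 2.
    by rewrite Fz /= -[LHS]mulr1 -e1; ring.
  have F0 : b0 (F z) = 0 by rewrite Fz /= e0 mulr0.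
  case: fg0 => fg0.
    have := evaluates_uniq dom (star_evaluates dom fE gE) zE fg0 Dz.
    move=> /(congr1 (bmul (F z))) h.
    have -> : bscale (a z ^+ 2) (G z) = bscale (-1) (bmul (F z) (bmul (F z) (G z))).
      by rewrite e2; apply: bq_ext => /=; rewrite F0; ring.
    by rewrite h; apply: bq_ext => /=; rewrite F0; ring.
  have := evaluates_uniq dom (star_evaluates dom gE fE) zE fg0 Dz.
  move=> /(congr1 (fun B => bmul B (F z))) h.
  have -> : bscale (a z ^+ 2) (G z) = bscale (-1) (bmul (bmul (G z) (F z)) (F z)).
    by rewrite e2; apply: bq_ext => /=; rewrite F0; ring.
  by rewrite h; apply: bq_ext => /=; rewrite F0; ring.
have [q1 Oq1 a1] : exists2 q, Om q & a (halfpt q) != 0.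
  apply: contrapT => no; apply: fn0 => q; rewrite inE => Oq.
  have [I [II _ -> _]] := evaluates_at fE Oq.
  have [-> _ _] := pF _ (cdom_halfpt Oq).
  have -> : a (halfpt q) = 0 by apply: contrapT => /eqP h; apply: no; exists q.
  by rewrite -(ev0 I); congr ev; apply: bq_ext; rewrite /= mul0r.
have [r r0 Hr] := copen_disc (cdom_open dom) (cdom_halfpt Oq1).
have na : 0 < normc (a (halfpt q1)) by rewrite normc_gt0.
have [d d0 Hd] := holo_cont (ha _ (cdom_halfpt Oq1)) na.
have zero (b : biquat -> C) : shol Om (b \o G) ->
    (forall z, cdom Om z -> a z ^+ 2 * b (G z) = 0) ->
    forall q, Om q -> b (G (halfpt q)) = 0.
  move=> hb kb; apply: (identity_theorem dom hb Oq1).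
  exists (Num.min r d); first by rewrite lt_min r0.
  move=> w; rewrite lt_min => /andP[/ltW wr wd].
  have /eqP := kb _ (Hr _ wr); rewrite mulf_eq0 sqrf_eq0 => /orP[/eqP aw|/eqP //].
  by have := Hd _ wd; rewrite aw sub0r normc_opp ltxx.
have [[h0 h1 h2 h3] _] := represents_coord gG.
have z0 := zero b0 h0 (fun z Dz => congr1 b0 (key z Dz)).
have z1 := zero b1 h1 (fun z Dz => congr1 b1 (key z Dz)).
have z2 := zero b2 h2 (fun z Dz => congr1 b2 (key z Dz)).
have z3 := zero b3 h3 (fun z Dz => congr1 b3 (key z Dz)).
apply: gn0 => q; rewrite inE => Oq.
have [I [II _ -> _]] := evaluates_at gE Oq.
by rewrite -(ev0 I); congr ev; apply: bq_ext; rewrite ?z0 ?z1 ?z2 ?z3.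
Qed.

Lemma holo_conj (k : C -> C) z : holo k z^*%C -> holo (fun w => (k w^*%C)^*%C) z.
Proof.
move=> [l kl]; exists l^*%C => e e0; have [d d0 Hd] := kl e e0.
exists d => // w w' wd w'd.
rewrite -(normc_conj (w - z)) rmorphB in wd.
rewrite -(normc_conj (w' - z)) rmorphB in w'd.
have := Hd _ _ wd w'd.
have -> : (k w'^*%C)^*%C - (k w^*%C)^*%C - l^*%C * (w' - w) =
    (k w'^*%C - k w^*%C - l * (w'^*%C - w^*%C))^*%C.
  by rewrite !rmorphB rmorphM rmorphB /= !conjcK.
by rewrite normc_conj -(normc_conj (w' - w)) rmorphB.
Qed.

(** Approaching [z] along a horizontal ray suffices for the use made of this
    lemma, because the two roots of [Delta] lie on a vertical line. *)
Lemma holo_zero_limit (k : C -> C) z (d0 : R) : 0 < d0 -> holo k z ->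
  (forall t : R, 0 < t -> t < d0 -> k (z + t%:C)%C = 0) -> k z = 0.
Proof.
move=> d00 hk H; apply: normc_le0 => e e0.
have [d d_gt0 Hd] := holo_cont hk e0.
pose t := Num.min d d0 / 2.
have m0 : 0 < Num.min d d0 by rewrite lt_min d_gt0.
have t0 : 0 < t by rewrite divr_gt0.
have : t < Num.min d d0 by rewrite /t; lra.
rewrite lt_min => /andP[td td0].
have := Hd (z + t%:C)%C; rewrite [(z + _)%C - z]addrC addKr normc_real.
by rewrite ger0_norm ?(ltW t0) // H // sub0r normc_opp => /(_ td)/ltW.
Qed.

(** The stem of [Delta]. *)
Let delta q0 z := (z - halfpt q0) * (z - (halfpt q0)^*%C).

Lemma sphere_poly_ev q0 I z : imag_units I ->
  sphere_poly q0 (slice_pt I (pair_of z)) = ev I (bscalar (delta q0 z)).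
Proof.
move=> II; rewrite /sphere_poly -ev_scalar_slice -!(ev_real I).
have -> : (2 : quat R) = ev I (bscalar 2).
  rewrite -[X in bscalar X](_ : (2%:C)%C = 2); last by rewrite rmorph_nat.
  by rewrite ev_real scaler_nat.
have N c : - ev I (bscalar c) = ev I (bscalar (- c)).
  by case: c => x y; rewrite !ev_bscalar /= !scaleNr opprD.
rewrite ev_scalarX // !ev_scalarM // N !ev_scalarD; congr (ev I (bscalar _)).
have e : `|q0| ^+ 2 = qre q0 ^+ 2 + `|qvec q0| ^+ 2.
  by rewrite !quat_sqnorm /qnorm2 /=; ring.
rewrite e /delta /halfpt; case: z => x y.
by simpc; congr Complex; ring.
Qed.

(** A non-real isolated zero [q0] of [f = a H = Delta^m g] is a zero of
    the scalar factor of [g], because [H] has no zeros; this factor is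
    then divisible by [Delta], against the maximality of [m]. *)
Lemma polar_no_isolated_zero Om f F a H : circular_domain Om ->
  polar Om f F a H -> no_nonreal_isolated_zero Om f.
Proof.
move=> dom [fF ha sa hH pF] q0 [Oq0 nr _ [m [g [[gr fg] maxm gq0]]]].
have [G gG] := regular_represents dom gr.
have fE := represents_evaluates fF; have gE := represents_evaluates gG.
pose z0 := halfpt q0; pose dl := delta q0.
have Dop := cdom_open dom.
have Dz0 : cdom Om z0 by exact: cdom_halfpt.
have Dz0c := cdom_conj Dz0.
have z0c : z0^*%C != z0.
  rewrite /z0 /halfpt eq_complex /= eqxx /=; apply/eqP => h.
  have v0 : `|qvec q0| = 0 by lra.
  apply: nr; exists (qre q0) => //; move/eqP: v0; rewrite normr_eq0 => /eqP v0.
  have [v1 v2 v3] : [/\ qi q0 = 0, qj q0 = 0 & qk q0 = 0] by move: v0 => -[].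
  by apply: quat_ext; rewrite /= ?mulr1 ?mulr0 ?v1 ?v2 ?v3.
have FG z : cdom Om z -> F z = bscale (dl z ^+ m) (G z).
  move: z; apply: (@evaluates_uniq _ Om f f F) => //.
  move=> I z II Dz; rewrite fg; last by rewrite inE; exact: circular_slice.
  by rewrite sphere_poly_ev // gE // ev_scalarX // ev_scalar.
have [[g0 g1 g2 g3] [gs0 gs1 gs2 gs3]] := represents_coord gG.
have [[h0 h1 h2 h3] [hs0 hs1 hs2 hs3]] := represents_coord hH.
pose aG z := bdot (G z) (H z).
have aGh : shol Om aG by apply: shol_dot; [by case: gG | by case: hH].
have aGs : ssym Om aG.
  by move=> z Dz; have [_ s _] := gG; have [_ s' _] := hH; rewrite /aG s // s' // bdot_conj.
have dl_off z t : dl z = 0 -> 0 < t -> dl (z + t%:C)%C != 0.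
  move=> /eqP; rewrite /dl /delta mulf_eq0 => dz t0.
  have rez : complex.Re z = qre q0.
    by case/orP: dz; rewrite subr_eq0 => /eqP ->.
  have off (y : R) : (z + t%:C)%C - Complex (qre q0) y != 0.
    rewrite subr_eq0; apply/eqP => /(congr1 (@complex.Re R)).
    case: (z) rez => x' y' /= ->; lra.
  by rewrite mulf_neq0 // off.
have off_zero (k : C -> C) : shol Om k -> (forall z, cdom Om z -> dl z != 0 -> k z = 0) ->
    forall z, cdom Om z -> k z = 0.
  move=> hk kz z Dz; have [dz|dz] := eqVneq (dl z) 0; last exact: kz.
  have [r r0 Hr] := copen_disc Dop Dz.
  apply: (@holo_zero_limit k z r r0 (hk _ Dz)) => t t0 tr; apply: kz; last exact: dl_off.
  apply: Hr; rewrite [(z + _)%C - z]addrC addKr normc_real ger0_norm; exact: ltW.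
(* Off the roots of [Delta] this is division; at the roots, continuity. *)
have GaH z : cdom Om z -> G z = bscale (aG z) (H z).
  have off w : cdom Om w -> dl w != 0 -> G w = bscale (aG w) (H w).
    move=> Dw dw; have [Fw e0 e1] := pF w Dw; have FGw := FG w Dw; rewrite Fw in FGw.
    have dm : dl w ^+ m != 0 by rewrite expf_neq0.
    have GE (b : biquat -> C) : (forall c A, b (bscale c A) = c * b A) ->
        b (G w) = a w / dl w ^+ m * b (H w).
      move=> bZ; have := congr1 b FGw; rewrite !bZ => h.
      by apply: (mulfI dm); rewrite -h; field.
    have aGE : aG w = a w / dl w ^+ m.
      rewrite /aG /bdot (GE b1) // (GE b2) // (GE b3) //.
      by rewrite -[RHS]mulr1 -e1 /bdot; ring.
    by rewrite aGE; apply: bq_ext => /=; exact: GE.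
  have comp (b : biquat -> C) : (forall c A, b (bscale c A) = c * b A) ->
      shol Om (b \o G) -> shol Om (b \o H) -> forall z, cdom Om z -> b (G z) = aG z * b (H z).
    move=> bZ hG hH' w Dw; apply/eqP; rewrite -subr_eq0; apply/eqP.
    move: w Dw; apply: (off_zero (fun w => b (G w) - aG w * b (H w))) => w Dw.
      by apply: holoB; [exact: hG | apply: holoM; [exact: aGh | exact: hH']].
    by move=> dw; rewrite {1}(off w Dw dw) bZ subrr.
  by move=> Dz; apply: bq_ext => /=; [exact: (comp b0) | exact: (comp b1) | exact: (comp b2) | exact: (comp b3)].
have aGz0 : aG z0 = 0.
  have [I [II _ e _]] := evaluates_at gE Oq0.
  move: e; rewrite gq0 GaH // -ev_scalar // => e.
  apply: (@ev_scalar_eq0 _ I) => //.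
  have Hu : ev I (H z0) \is a GRing.unit.
    suff : ev I (H z0) != 0 by [].
    apply/eqP => H0.
    have [_ e0 e1] := pF z0 Dz0.
    have := ev_mul_eq0 (H z0) II H0.
    have -> : bmul (H z0) (H z0) = bscalar (- 1).
      rewrite -e1 /bdot; apply: bq_ext => /=; rewrite e0; ring.
    by move=> /(ev_scalar_eq0 II)/eqP; rewrite oppr_eq0 oner_eq0.
  by apply: (mulIr Hu); rewrite mul0r -e.
have [a1 a1h a1E] := holo_divide Dop Dz0 aGh aGz0.
have a1z0 : a1 z0^*%C = 0.
  have : aG z0^*%C = 0 by rewrite aGs // aGz0 conjc0.
  by rewrite a1E => /eqP; rewrite mulf_eq0 subr_eq0 (negPf z0c) => /eqP.
have [b bh bE] := holo_divide Dop Dz0c a1h a1z0.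
have aGb z : aG z = dl z * b z by rewrite a1E bE /dl /delta mulrA.
have dlc z : dl z^*%C = (dl z)^*%C.
  rewrite /dl /delta [RHS]rmorphM [RHS]mulrC; congr (_ * _); rewrite [RHS]rmorphB //.
  by congr (_ - _); exact: esym (conjcK _).
have bs : ssym Om b.
  move=> z Dz; apply/eqP; rewrite -(inj_eq (can_inj (@conjcK R))) conjcK -subr_eq0; apply/eqP.
  move: z Dz; apply: (off_zero (fun z => (b z^*%C)^*%C - b z)) => z Dz.
    by apply: holoB; [apply: holo_conj; apply: bh; exact: cdom_conj | exact: bh].
  move=> dz; apply/eqP; rewrite subr_eq0; apply/eqP.
  have h : dl z^*%C * b z^*%C = (dl z * b z)^*%C by rewrite -!aGb aGs.
  apply: (mulfI dz); transitivity ((dl z^*%C * b z^*%C)^*%C); last first.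
    by rewrite h; exact: conjcK.
  by rewrite dlc [RHS]rmorphM; congr (_ * _); exact: esym (conjcK _).
have g'rep : represents Om (slice_fun (fun z => bscale (b z) (H z))) (fun z => bscale (b z) (H z)).
  apply: represents_slice_fun => //.
    by split=> z Dz; apply: holoM; [exact: bh | exact: h0 | exact: bh | exact: h1
      | exact: bh | exact: h2 | exact: bh | exact: h3].
  by split=> z Dz; rewrite /= bs // rmorphM; congr (_ * _); [exact: hs0 | exact: hs1
    | exact: hs2 | exact: hs3].
have := maxm m.+1 _ (conj (represents_regular dom g'rep) _).
rewrite ltnn => H1; suff: false by []; apply: H1 => q; rewrite inE => Oq.
have [I [II gIE e _]] := evaluates_at fE Oq.
rewrite e (gIE _ _ (represents_evaluates g'rep)) (gIE (sphere_poly q0) (fun z => bscalar (dl z))).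
  rewrite ev_scalarX // ev_scalar //; congr ev.
  have Dq := cdom_halfpt Oq.
  by rewrite FG // GaH // aGb; apply: bq_ext => /=; rewrite exprS; ring.
by move=> J z JJ _; exact: sphere_poly_ev.
Qed.

End PolarForm.

(** * From one point to the whole domain *)

Section GlobalAlternative.
Context {R : realType}.
Local Notation C := R[i].
Local Notation biquat := (biquat (R := R)).
Implicit Types (z w : C) (f g : quat R -> quat R) (F G : C -> biquat) (Om : set (quat R)).

(** The integers of [equal_bexp] are locally constant, hence its conclusions
    are identities between holomorphic functions near one point, and hold
    everywhere. *)
Lemma equal_exp_star Om f g F G : circular_domain Om ->
  represents Om f F -> represents Om g G ->
  {in Om, exp_star f =1 exp_star g} -> ~ slice_preserving Om (exp_star f) ->
  exists n m : int, (m = n %[mod 2])%Z /\ forall q, Om q ->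
    let A := F (halfpt q) in let B := G (halfpt q) in
    [/\ b0 B = b0 A + iu * piC n, bdot (bsub B A) (bsub B A) = piC m ^+ 2,
        bparallel A B & m = 0 -> bvec B = bvec A].
Proof.
move=> dom fF gG fg nsp; have Dop := cdom_open dom.
have [hF _ fE] := fF; have [hG _ gE] := gG.
have comboE z X Y X' Y' : cdom Om z -> bexp (F z) X Y -> bexp (G z) X' Y' ->
    combo X Y (F z) = combo X' Y' (G z).
  move=> Dz XY XY'.
  have val I : imag_units I -> ev I (combo X Y (F z)) = ev I (combo X' Y' (G z)).
    move=> II; rewrite -(exp_star_at dom fE II Dz XY) -(exp_star_at dom gE II Dz XY').
    by apply: fg; rewrite inE; exact: circular_slice.
  by apply: (ev_inj imag_unit_Qi); apply: val; [|apply: imag_unitN]; exact: imag_unit_Qi.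
have [q0 [Oq0 v0 nr0]] : exists q, [/\ Om q, bvec (F (halfpt q)) <> bscalar 0 &
    ~ resonant (F (halfpt q))].
  apply: contrapT => no; apply: nsp; apply: exp_slice_preserving fF _ => // q Oq.
  have [|v0] := pselect (bvec (F (halfpt q)) = bscalar 0); first by left.
  by right; apply: contrapT => nr; apply: no; exists q.
have good z : cdom Om z -> bvec (F z) <> bscalar 0 -> ~ resonant (F z) ->
    exists a b : int, [/\ b0 (G z) = b0 (F z) + iu * piC (a + b),
      bdot (bsub (G z) (F z)) (bsub (G z) (F z)) = piC (a - b) ^+ 2,
      bparallel (F z) (G z) & a = b -> bvec (G z) = bvec (F z)].
  move=> Dz vz nrz; have [X [Y XY]] := bexp_exists (F z).
  have [X' [Y' XY']] := bexp_exists (G z).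
  apply: (equal_bexp XY XY' (comboE _ _ _ _ _ Dz XY XY')) => //.
  by apply/eqP => Y0; apply: nrz; exact: bexp_nonresonant XY Y0.
set z0 := halfpt q0 in v0 nr0; have Dz0 : cdom Om z0 by exact: cdom_halfpt.
have [a [b [E1 E2 E3 E4]]] := good _ Dz0 v0 nr0.
exists (a + b), (a - b); split.
  apply/eqP; rewrite eqz_mod_dvd (_ : _ - _ = b * (-2)); last by ring.
  by apply: dvdz_mull; rewrite dvdzE.
pose u z := bdot (F z) (F z); pose w z := bdot (bsub (G z) (F z)) (bsub (G z) (F z)).
pose c z := b0 (G z) - b0 (F z).
have hD z : cdom Om z -> bholo (fun y => bsub (G y) (F y)) z.
  by move=> Dz; have [? ? ? ?] := hF z Dz; have [? ? ? ?] := hG z Dz; split; apply: holoB.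
have hu : shol Om u by exact: shol_dot.
have hw : shol Om w by exact: shol_dot.
have hc : shol Om c by move=> z /hD[].
have [e e0 He] := resonant_gap nr0.
have [r r0 Hr] := copen_disc Dop Dz0.
have [d1 d10 H1] := bvec_neq0_near (hF _ Dz0) v0.
have [d2 d20 H2] := holo_cont (hu _ Dz0) e0.
have [d3 d30 H3] := holo_cont (hw _ Dz0) (ltr01 : 0 < 1 :> R).
have [d4 d40 H4] := holo_cont (hc _ Dz0) (ltr01 : 0 < 1 :> R).
pose d := Num.min r (Num.min (Num.min d1 d2) (Num.min d3 d4)).
have d0 : 0 < d by rewrite !lt_min r0 d10 d20 d30 d40.
have local z : normc (z - z0) < d -> [/\ c z - iu * piC (a + b) = 0,
    w z - piC (a - b) ^+ 2 = 0, bparallel (F z) (G z) & a - b = 0 -> bvec (G z) = bvec (F z)].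
  rewrite !lt_min => /and3P[zr /andP[zd1 zd2] /andP[zd3 zd4]].
  have Dz := Hr _ (ltW zr).
  have nrz : ~ resonant (F z).
    move=> [k k0 uk]; have := He k k0; rewrite -uk normcB.
    by have := H2 _ zd2; rewrite /u => h1 h2; have := lt_le_trans h1 h2; rewrite ltxx.
  have [a' [b' [E1' E2' E3' E4']]] := good _ Dz (H1 _ zd1) nrz.
  have cE : c z - iu * piC (a + b) = iu * piC ((a' + b') - (a + b)).
    by rewrite /c E1' piCB; ring.
  have w0 : w z = piC (a - b) ^+ 2.
    rewrite /w E2'; apply/eqP; rewrite -[_ == _]negbK; apply/negP => ne.
    by have := piC_gap ne; rewrite -E2 -E2' leNgt (H3 _ zd3).
  split=> //.
  - rewrite cE; have -> : (a' + b') - (a + b) = 0; last by rewrite piC0 mulr0.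
    apply/eqP; rewrite -[_ == 0]negbK; apply/negP => ne; have := H4 _ zd4.
    have -> : c z - c z0 = iu * piC ((a' + b') - (a + b)) by rewrite -cE /c E1; ring.
    by rewrite normcM normc_iu mul1r ltNge normc_piC_ge1.
  - by rewrite w0 subrr.
  - move=> ab; apply: E4'; apply/eqP; rewrite -subr_eq0 -(@piC_eq0 R) -sqrf_eq0.
    by rewrite -E2' -/(w z) w0 ab piC0 expr0n.
have glob (k : C -> C) : shol Om k -> (forall z, normc (z - z0) < d -> k z = 0) ->
    forall q, Om q -> k (halfpt q) = 0.
  by move=> hk kz; apply: (identity_theorem dom hk Oq0); exists d.
move=> q Oq; split.
- have := glob (fun z => c z - iu * piC (a + b)) _ _ q Oq; rewrite /c => h.
  apply/eqP; rewrite -subr_eq0 opprD addrA; apply/eqP; apply: h.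
    by move=> z Dz; apply: holoB; [exact: hc | exact: holo_cst].
  by move=> z /local[].
- have := glob (fun z => w z - piC (a - b) ^+ 2) _ _ q Oq; rewrite /w => h.
  apply/eqP; rewrite -subr_eq0; apply/eqP; apply: h.
    by move=> z Dz; apply: holoB; [exact: hw | exact: holo_cst].
  by move=> z /local[].
- have par (l l' : biquat -> C) : shol Om (l \o F) -> shol Om (l' \o F) ->
      shol Om (l \o G) -> shol Om (l' \o G) ->
      (forall z, normc (z - z0) < d -> l (F z) * l' (G z) = l' (F z) * l (G z)) ->
      l (F (halfpt q)) * l' (G (halfpt q)) = l' (F (halfpt q)) * l (G (halfpt q)).
    move=> k1 k2 k3 k4 eqs; apply/eqP; rewrite -subr_eq0; apply/eqP.
    apply: (glob (fun z => l (F z) * l' (G z) - l' (F z) * l (G z)) _ _ q Oq).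
      by move=> z Dz; apply: holoB; apply: holoM; [exact: k1 | exact: k4 | exact: k2 | exact: k3].
    by move=> z /eqs ->; rewrite subrr.
  have [[_ f1 f2 f3] _] := represents_coord fF; have [[_ g1 g2 g3] _] := represents_coord gG.
  by split; apply: par => // z /local[_ _ []].
- move=> ab.
  have vec (l : biquat -> C) : shol Om (l \o F) -> shol Om (l \o G) ->
      (forall A, l A = l (bvec A)) -> l (G (halfpt q)) = l (F (halfpt q)).
    move=> k1 k2 lv; apply/eqP; rewrite -subr_eq0; apply/eqP.
    apply: (glob (fun z => l (G z) - l (F z)) _ _ q Oq).
      by move=> z Dz; apply: holoB; [exact: k2 | exact: k1].
    by move=> z /local[_ _ _ /(_ ab) h]; rewrite lv h -lv subrr.
  have [[_ f1 f2 f3] _] := represents_coord fF; have [[_ g1 g2 g3] _] := represents_coord gG.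
  by apply: bq_ext => //=; exact: vec.
Qed.

(** The difference [D] of the vector parts satisfies [D^s = (pi m)^2] and is
    parallel to both, so [H = D / (pi m)] is defined globally and
    [f_v = (f_v . H) H]. *)
Lemma equal_exp_polar Om f g F G (n m : int) : circular_domain Om ->
  represents Om f F -> represents Om g G -> m != 0 ->
  (forall q, Om q -> let A := F (halfpt q) in let B := G (halfpt q) in
    [/\ b0 B = b0 A + iu * piC n, bdot (bsub B A) (bsub B A) = piC m ^+ 2,
        bparallel A B & m = 0 -> bvec B = bvec A]) ->
  exists a H, polar Om (vector_part Om f) (fun z => bvec (F z)) a H /\
    polar Om (vector_part Om g) (fun z => bvec (G z)) (fun z => a z + piC m) H.
Proof.
move=> dom fF gG m0 glob; have pm : piC m != 0 :> C by rewrite piC_eq0.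
have [hF sF _] := fF; have [hG sG _] := gG.
have [[f0 f1 f2 f3] [fs0 fs1 fs2 fs3]] := represents_coord fF.
have [[g0 g1 g2 g3] [gs0 gs1 gs2 gs3]] := represents_coord gG.
have [c cm cc] : exists2 c : C, c * piC m = 1 & c^*%C = c.
  exists (piC m)^-1; first by rewrite mulVf.
  by rewrite fmorphV; congr (_^-1); exact: piC_conj.
pose H z := bscale c (bvec (bsub (G z) (F z))).
pose a z := bdot (F z) (H z).
have H0 z : b0 (H z) = 0 by rewrite /= mulr0.
have sB x y : c * (y^*%C - x^*%C) = (c * (y - x))^*%C.
  by rewrite [RHS]rmorphM [X in _ = _ * X]rmorphB; congr (_ * _); rewrite -[LHS]cc.
have hH : represents Om (slice_fun H) H.
  apply: represents_slice_fun => //.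
    by split=> z Dz; apply: holoM; try exact: holo_cst; apply: holoB;
      [exact: g1 | exact: f1 | exact: g2 | exact: f2 | exact: g3 | exact: f3].
  by split=> z Dz; rewrite [LHS]/= ?sF ?sG // [LHS]/=; try exact: sB;
    rewrite mulr0 -(conjc0 R) -(H0 z).
have [hholo hsym _] := hH.
have ha : shol Om a by exact: shol_dot.
have sa : ssym Om a by move=> z Dz; rewrite /a sF // hsym // bdot_conj.
have pol z : cdom Om z -> bdot (H z) (H z) = 1 /\ bvec (F z) = bscale (a z) (H z).
  move: z; apply: (half_to_all dom) => [z Dz [e1 e2]|q Oq].
    split; first by rewrite hsym // bdot_conj e1 rmorph1.
    rewrite sF // sa // hsym //; have := congr1 bconj e2.
    move=> h; apply: bq_ext.
    - transitivity ((a z)^*%C * (b0 (H z))^*%C); last by [].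
      by rewrite H0 conjc0 mulr0.
    - transitivity ((a z * b1 (H z))^*%C); [exact: (congr1 b1 h) | exact: rmorphM].
    - transitivity ((a z * b2 (H z))^*%C); [exact: (congr1 b2 h) | exact: rmorphM].
    - transitivity ((a z * b3 (H z))^*%C); [exact: (congr1 b3 h) | exact: rmorphM].
  have [_ E2 [p1 p2 p3] _] := glob q Oq.
  have H1 : bdot (H (halfpt q)) (H (halfpt q)) = 1.
    transitivity (c ^+ 2 * bdot (bsub (G (halfpt q)) (F (halfpt q)))
        (bsub (G (halfpt q)) (F (halfpt q)))); first by rewrite /bdot /=; ring.
    by rewrite E2 -exprMn cm expr1n.
  split=> //; rewrite /a; move: H1; rewrite /H /bdot /=.
  move: p1 p2 p3; case: (F _) (G _) => [x0 x1 x2 x3] [y0 y1 y2 y3] /= p1 p2 p3.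
  move=> H1; apply: bq_ext => /=; rewrite ?mulr0 //.
  + rewrite -[LHS]mulr1 -H1; apply/eqP; rewrite -subr_eq0; apply/eqP.
    transitivity (c ^+ 2 * ((y2 - x2) * (x1 * y2 - x2 * y1) + (y3 - x3) * (x1 * y3 - x3 * y1))).
      by ring.
    by rewrite p1 p3 !subrr !mulr0 addr0 mulr0.
  + rewrite -[LHS]mulr1 -H1; apply/eqP; rewrite -subr_eq0; apply/eqP.
    transitivity (c ^+ 2 * ((y3 - x3) * (x2 * y3 - x3 * y2) - (y1 - x1) * (x1 * y2 - x2 * y1))).
      by ring.
    by rewrite p1 p2 !subrr !mulr0 subr0 mulr0.
  + rewrite -[LHS]mulr1 -H1; apply/eqP; rewrite -subr_eq0; apply/eqP.
    transitivity (- c ^+ 2 * ((y1 - x1) * (x1 * y3 - x3 * y1) + (y2 - x2) * (x2 * y3 - x3 * y2))).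
      by ring.
    by rewrite p2 p3 !subrr !mulr0 addr0 mulr0.
exists a, H; split; split=> //.
- exact: vector_part_represents.
- by move=> z Dz; have [e1 e2] := pol z Dz; split.
- exact: vector_part_represents.
- by move=> z Dz; apply: holoD; [exact: ha | exact: holo_cst].
- move=> z Dz; transitivity ((a z)^*%C + (piC m)^*%C).
    by rewrite piC_conj -sa.
  by rewrite -[LHS]rmorphD.
- move=> z Dz; have [e1 e2] := pol z Dz; split=> //.
  have v1 := congr1 b1 e2; have v2 := congr1 b2 e2; have v3 := congr1 b3 e2.
  by move: v1 v2 v3 => /= v1 v2 v3; apply: bq_ext => /=;
    rewrite ?mulr0 // mulrDl -?v1 -?v2 -?v3 mulrCA mulrA cm mul1r addrC subrK.
Qed.

End GlobalAlternative.

(** * The theorem *)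

Section Conclusions.
Context {R : realType}.
Local Notation C := R[i].
Local Notation biquat := (biquat (R := R)).
Implicit Types (I q : quat R) (z w : C) (f g : quat R -> quat R) (F G : C -> biquat).
Implicit Types (a : C -> C) (H : C -> biquat) (Om : set (quat R)).

Lemma polar_unit_vector Om f F a H : circular_domain Om -> polar Om f F a H ->
  unit_vector_fun Om (slice_fun H).
Proof.
move=> dom [_ _ _ hH pF]; split; first exact: represents_regular hH.
- move=> q; rewrite inE => Oq.
  have [I [_ _ -> _]] := evaluates_at (real_part_evaluates dom hH) Oq.
  by have [_ -> _] := pF _ (cdom_halfpt Oq); rewrite ev0.
- move=> q; rewrite inE => Oq.
  have [I [_ _ -> _]] := evaluates_at (symm_evaluates dom hH) Oq.
  by have [_ -> ->] := pF _ (cdom_halfpt Oq); rewrite expr0n add0r ev_one.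
Qed.

Lemma product_domain_nonreal Om q : product_domain Om -> Om q -> `|qvec q| != 0.
Proof.
move=> pr Oq; apply/eqP => v0; have : (Om `&` real_line) q.
  split=> //; exists (qre q) => //; move/eqP: v0; rewrite normr_eq0 => /eqP v0.
  have [v1 v2 v3] : [/\ qi q = 0, qj q = 0 & qk q = 0] by move: v0 => -[].
  by apply: quat_ext; rewrite /= ?mulr1 ?mulr0 ?v1 ?v2 ?v3.
by rewrite pr.
Qed.

Lemma ev_piC I (k : int) : ev I (bscalar (piC k)) = (pi * k%:~R)%:A.
Proof. exact: ev_real. Qed.

Lemma ev_ipiC I (k : int) : ev I (bscalar (iu * piC k)) = (pi * k%:~R) *: I.
Proof.
have -> : iu * piC k = Complex 0 (pi * k%:~R) :> C by rewrite /iu /piC; simpc.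
by rewrite ev_bscalar /= scale0r add0r.
Qed.

End Conclusions.

Theorem theorem1p2 (R : realType) (Om : set (quat R))
    (h ht : quat R -> quat R)
    (dom : circular_domain Om)
    (h_reg : slice_regular Om h) (ht_reg : slice_regular Om ht)
    (h_neq : ~ {in Om, h =1 ht})
    (exp_eq : {in Om, exp_star h =1 exp_star ht})
    (exp_notin : ~ slice_preserving Om (exp_star h)) :
  (slice_domain Om ->
    [/\ {in Om, real_part Om h =1 real_part Om ht},
        no_nonreal_isolated_zero Om (vector_part Om h) /\
        no_nonreal_isolated_zero Om (vector_part Om ht),
        has_sqrt Om (symm Om (vector_part Om h)) /\
        has_sqrt Om (symm Om (vector_part Om ht)) &
        exists (m : int) (al Hv : quat R -> quat R),
          [/\ m != 0, slice_preserving Om al, unit_vector_fun Om Hv &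
            forall q, Om q ->
              [/\ vector_part Om h q = al q * Hv q,
                  vector_part Om ht q = (al q + (2 * pi * m%:~R)%:A) * Hv q,
                  vector_part Om ht q =
                    vector_part Om h q + (2 * pi * m%:~R) *: Hv q &
                  ht q = h q + (2 * pi * m%:~R) *: Hv q]]])
  /\
  (product_domain Om ->
    (exists2 n : int, n != 0 &
       forall q, Om q -> ht q = h q + (2 * pi * n%:~R) *: imag_dir q)
    \/
    [/\ ~ zero_divisor Om (vector_part Om h) /\
        ~ zero_divisor Om (vector_part Om ht),
        no_nonreal_isolated_zero Om (vector_part Om h) /\
        no_nonreal_isolated_zero Om (vector_part Om ht),
        has_sqrt Om (symm Om (vector_part Om h)) /\
        has_sqrt Om (symm Om (vector_part Om ht)) &
        exists (n m : int) (al Hv : quat R -> quat R),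
          [/\ m != 0 /\ (m = n %[mod 2])%Z,
              slice_preserving Om al, unit_vector_fun Om Hv &
            forall q, Om q ->
              [/\ vector_part Om h q = al q * Hv q,
                  ht q = real_part Om h q + (pi * n%:~R) *: imag_dir q +
                         (al q + (pi * m%:~R)%:A) * Hv q &
                  ht q = h q + pi *: (n%:~R *: imag_dir q + m%:~R *: Hv q)]]]).
Proof.
have [F hF] := regular_represents dom h_reg.
have [G hG] := regular_represents dom ht_reg.
have [n [m [nm glob]]] := equal_exp_star dom hF hG exp_eq exp_notin.
have hE := represents_evaluates hF; have hvE := represents_evaluates (vector_part_represents dom hF).
have tE := represents_evaluates hG; have tvE := represents_evaluates (vector_part_represents dom hG).
have hrE := real_part_evaluates dom hF; have trE := real_part_evaluates dom hG.
have nm0 : ~ (n = 0 /\ m = 0).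
  move=> [n0 m0]; apply: h_neq => q; rewrite inE => Oq.
  have [I [II gE -> _]] := evaluates_at hE Oq; rewrite (gE _ _ tE).
  have [E1 _ _ /(_ m0) E4] := glob q Oq.
  by rewrite ev_split [RHS]ev_split E1 n0 piC0 mulr0 addr0 E4.
have m_even : n = 0 -> exists k : int, m = 2 * k.
  move=> n0; have /dvdzP[k ->] : (2 %| m)%Z.
    by apply/dvdz_mod0P; rewrite nm n0 mod0z.
  by exists k; rewrite mulrC.
split=> [[x [Ox [r _ rx]]]|prod].
  (* At a real point both real parts are real, while they differ by i pi n. *)
  have n0 : n = 0.
    have [E1 _ _ _] := glob x Ox.
    have zx : (halfpt x)^*%C = halfpt x.
      rewrite /halfpt -rx /=; have -> : qvec (r%:A : quat R) = 0.
        by apply: quat_ext; rewrite /= ?mulr0.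
      by rewrite normr0 oppr0.
    have Dx := cdom_halfpt Ox.
    have real (b : biquat (R := R) -> R[i]) K : ssym Om (b \o K) -> complex.Im (b (K (halfpt x))) = 0.
      move=> /(_ _ Dx); rewrite zx /=; case: (b _) => u v /= -[]; lra.
    have [_ [sF _ _ _]] := represents_coord hF; have [_ [sG _ _ _]] := represents_coord hG.
    have := real _ _ sG; rewrite /= E1.
    have := real _ _ sF; rewrite /= /piC /iu; case: (b0 _) => u v /= ->.
    rewrite add0r mul0r mul1r add0r => /eqP.
    by rewrite mulf_eq0 (gt_eqF (pi_gt0 R)) /= intr_eq0 => /eqP.
  have [k mk] := m_even n0.
  have m0 : m != 0 by apply/eqP => m0; apply: nm0.
  have [a [H [pF pG]]] := equal_exp_polar dom hF hG m0 glob.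
  have [_ ha sa hH pol] := pF.
  have aE := represents_evaluates (scalar_fun_represents dom ha sa).
  have HE := represents_evaluates hH.
  split.
  - move=> q; rewrite inE => Oq.
    have [I [II gE -> _]] := evaluates_at hrE Oq; rewrite (gE _ _ trE).
    by have [-> _ _ _] := glob q Oq; rewrite n0 piC0 mulr0 addr0.
  - by split; [exact: polar_no_isolated_zero pF | exact: polar_no_isolated_zero pG].
  - by split; [exact: polar_sqrt pF | exact: polar_sqrt pG].
  - exists k, (scalar_fun a), (slice_fun H); split.
    + by apply: contraNneq m0 => k0; rewrite mk k0 mulr0.
    + exact: scalar_fun_preserving.
    + exact: polar_unit_vector pF.
    + move=> q Oq; have [I [II gE hq _]] := evaluates_at hE Oq.
      have Dq := cdom_halfpt Oq.
      have [_ _ _ _ pol'] := pG.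
      have [vF _ _] := pol _ Dq; have [vG _ _] := pol' _ Dq.
      have pk : 2 * pi * k%:~R = pi * m%:~R :> R by rewrite mk intrM; ring.
      have e1 : vector_part Om h q = scalar_fun a q * slice_fun H q.
        by rewrite (gE _ _ hvE) (gE _ _ aE) (gE _ _ HE) vF -ev_scalar.
      have e2 : vector_part Om ht q = (scalar_fun a q + (2 * pi * k%:~R)%:A) * slice_fun H q.
        rewrite (gE _ _ tvE) (gE _ _ aE) (gE _ _ HE) vG -ev_scalar // pk.
        by rewrite -(ev_piC I) ev_scalarD.
      have e3 : vector_part Om ht q = vector_part Om h q + (2 * pi * k%:~R) *: slice_fun H q.
        by rewrite e1 e2 mulrDl mulr_algl.
      split=> //.
      have [E1 _ _ _] := glob q Oq.
      rewrite (gE _ _ tE) hq ev_split (ev_split I (F _)) E1 n0 piC0 mulr0 addr0.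
      by rewrite -(gE _ _ tvE) -(gE _ _ hvE) e3 addrA.
have [m0|m0] := eqVneq m 0.
  left; have n0 : n != 0 by apply/eqP => n0; apply: nm0.
  have [k nk] : exists k : int, n = 2 * k.
    have /dvdzP[k ->] : (2 %| n)%Z by apply/dvdz_mod0P; rewrite -nm m0 mod0z.
    by exists k; rewrite mulrC.
  exists k; first by apply: contraNneq n0 => k0; rewrite nk k0 mulr0.
  move=> q Oq; have [I [II gE hq dir]] := evaluates_at hE Oq.
  have [E1 _ _ /(_ m0) E4] := glob q Oq.
  have pk : 2 * pi * k%:~R = pi * n%:~R :> R by rewrite nk intrM; ring.
  rewrite -(dir (product_domain_nonreal prod Oq)) (gE _ _ tE) hq.
  rewrite ev_split (ev_split I (F _)) E1 E4 pk -(ev_ipiC I) -ev_scalarD.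
  by rewrite addrAC.
right; have [a [H [pF pG]]] := equal_exp_polar dom hF hG m0 glob.
have [_ ha sa hH pol] := pF.
have aE := represents_evaluates (scalar_fun_represents dom ha sa).
have HE := represents_evaluates hH.
split.
- by split; [exact: polar_not_zero_divisor pF | exact: polar_not_zero_divisor pG].
- by split; [exact: polar_no_isolated_zero pF | exact: polar_no_isolated_zero pG].
- by split; [exact: polar_sqrt pF | exact: polar_sqrt pG].
- exists n, m, (scalar_fun a), (slice_fun H); split.
  + by [].
  + exact: scalar_fun_preserving.
  + exact: polar_unit_vector pF.
  + move=> q Oq; have [I [II gE hq dir]] := evaluates_at hE Oq.
    have Dq := cdom_halfpt Oq.
    have [_ _ _ _ pol'] := pG.
    have [vF _ _] := pol _ Dq; have [vG _ _] := pol' _ Dq.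
    have [E1 _ _ _] := glob q Oq.
    rewrite -(dir (product_domain_nonreal prod Oq)).
    have e1 : vector_part Om h q = scalar_fun a q * slice_fun H q.
      by rewrite (gE _ _ hvE) (gE _ _ aE) (gE _ _ HE) vF -ev_scalar.
    have e2 : ht q = real_part Om h q + (pi * n%:~R) *: I +
        (scalar_fun a q + (pi * m%:~R)%:A) * slice_fun H q.
      rewrite (gE _ _ tE) (gE _ _ hrE) (gE _ _ aE) (gE _ _ HE) ev_split E1 vG.
      by rewrite -ev_scalar // -(ev_piC I) -(ev_ipiC I) !ev_scalarD.
    split=> //.
    have hs : h q = real_part Om h q + vector_part Om h q.
      by rewrite /vector_part addrC subrK.
    rewrite e2 hs e1; move: (scalar_fun a q) (slice_fun H q) (real_part Om h q) => u v w.
    rewrite (mulrDl u) mulr_algl scalerDr !scalerA.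
    by rewrite !addrA; congr (_ + _); rewrite addrAC.
Qed.
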